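(* Let $d\ge 1$ be an integer, let $\lambda>0$ be a constant and let $p:\mathbb{N}\to[0,1]$ satisfy $p(n)\sim \lambda/n^d$ as $n\to\infty$. Then $p$ is a convergence law; that is, for every first-order property $P$ of $(d+1)$-uniform hypergraphs, the limit $\lim_{n\to\infty}\mathbb{P}[G^{d+1}(n,p(n))\models P]$ exists.
   Context: $G^{d+1}(n,p)$ is the random $(d+1)$-uniform hypergraph on $n$ labelled vertices in which each of the $\binom{n}{d+1}$ potential edges ($(d+1)$-element vertex sets) is present with probability $p$, independently of the others. First-order (elementary) properties are those expressible by a sentence of first-order logic with equality in the language with one $(d+1)$-ary relation symbol $\sigma$, where quantifiers range over vertices and $\sigma(x_0,\dots,x_d)$ means that $\{x_0,\dots,x_d\}$ is an edge. $f\sim g$ means $f(n)/g(n)\to 1$. *)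

(* Defs.v *)
From HB Require Import structures.
From mathcomp Require Import all_boot all_order all_algebra.
From mathcomp Require Import all_classical all_reals all_analysis.

Set Implicit Arguments.
Unset Strict Implicit.
Unset Printing Implicit Defensive.

Import Order.TTheory GRing.Theory Num.Theory.
Import numFieldNormedType.Exports.

Local Open Scope ring_scope.
Local Open Scope classical_set_scope.

Definition potential_edges (d n : nat) : {set {set 'I_n}} :=
  [set e : {set 'I_n} | #|e| == d.+1]%SET.

Record hypergraph (d n : nat) := Hypergraph {
  edges :> {set {set 'I_n}};
  edges_uniform : edges \subset potential_edges d n }.

HB.instance Definition _ d n := [isSub for @edges d n].
HB.instance Definition _ d n := [Finite of hypergraph d n by <:].

(* [formula d k]: first-order formulas whose free variables are among
   'I_k.  [FEx f] binds the variable ord0 of [f]; variable i of [FEx f]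
   is variable i.+1 of [f].  The remaining connectives and the universal
   quantifier are definable from these. *)
Inductive formula (d : nat) : nat -> Type :=
| FEq k of 'I_k & 'I_k : formula d k
| FEdge k of (d.+1).-tuple 'I_k : formula d k
| FNot k of formula d k : formula d k
| FAnd k of formula d k & formula d k : formula d k
| FEx k of formula d k.+1 : formula d k.

Notation sentence d := (formula d 0).

Definition extend_env (T : Type) (k : nat) (x : T) (v : 'I_k -> T) :
    'I_k.+1 -> T :=
  fun i => if unlift ord0 i is Some j then v j else x.

Definition empty_env (T : Type) : 'I_0 -> T :=
  fun i => False_rect T (notF (ltn_ord i)).

Fixpoint sat (d n : nat) (H : hypergraph d n) (k : nat) (f : formula d k) :
    ('I_k -> 'I_n) -> bool :=
  match f with
  | FEq _ i j => fun v => v i == v j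
  | FEdge _ t => fun v => [set v (tnth t i) | i : 'I_d.+1]%SET \in edges H
  | FNot _ g => fun v => ~~ sat H g v
  | FAnd _ g h => fun v => sat H g v && sat H h v
  | FEx _ g => fun v => [exists x : 'I_n, sat H g (extend_env x v)]
  end.

Definition models (d n : nat) (H : hypergraph d n) (phi : sentence d) : bool :=
  sat H phi (@empty_env 'I_n).

Definition hypergraph_property (d : nat) := forall n : nat, pred (hypergraph d n).

Definition first_order (d : nat) (P : hypergraph_property d) : Prop :=
  exists phi : sentence d,
    forall (n : nat) (H : hypergraph d n), P n H = models H phi.

Section RandomHypergraph.
Variable R : realType.

Definition random_hypergraph_weight (d n : nat) (p : R) (H : hypergraph d n) : R :=
  \prod_(e in potential_edges d n) (if e \in edges H then p else 1 - p).

Definition Pr_random_hypergraph (d n : nat) (p : R)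
    (A : pred (hypergraph d n)) : R :=
  \sum_(H : hypergraph d n | A H) random_hypergraph_weight p H.

Lemma Pr_random_hypergraphT (d n : nat) (p : R) :
  Pr_random_hypergraph p (fun _ : hypergraph d n => true) = 1.
Proof.
rewrite /Pr_random_hypergraph /random_hypergraph_weight.
set K := potential_edges d n.
have -> : \sum_(H : hypergraph d n)
    \prod_(e in K) (if e \in edges H then p else 1 - p) =
    \sum_(E : {set {set 'I_n}} | E \subset K)
      \prod_(e in K) (if e \in E then p else 1 - p).
  rewrite [RHS](reindex_omap (@edges d n) insub) /=.
    by apply: eq_bigl => H; rewrite edges_uniform valK eqxx.
  by move=> E EK; rewrite insubT.
transitivity (\prod_(e : {set 'I_n})
    ((if e \in K then p else 0) + (if e \in K then 1 - p else 1))); last first.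
  by rewrite big1 // => e _; case: ifP => _; rewrite ?add0r // addrC subrK.
rewrite finset.bigA_distr big_mkcond /=; apply: eq_bigr => E _.
case: ifPn => [/fintype.subsetP EK|/fintype.subsetPn[e eE eK]].
  rewrite big_mkcond /=; apply: eq_bigr => e _.
  by case: ifPn => // /(contra (EK e))/negPf ->.
by rewrite (bigD1 e) //= eE (negPf eK) mul0r.
Qed.

Definition asymp_equiv (f g : nat -> R) : Prop :=
  (fun n : nat => f n / g n) @ \oo --> (1 : R).

Definition convergence_law (d : nat) (p : nat -> R) : Prop :=
  forall P : hypergraph_property d, first_order P ->
    cvgn (fun n : nat => Pr_random_hypergraph (p n) (P n)).

End RandomHypergraph.

(* Main.v *)
Require Import Defs.
From mathcomp Require Import all_boot all_order all_algebra.
From mathcomp Require Import all_classical all_reals all_analysis.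
From mathcomp Require Import zify ring lra.
Import mathcomp.boot.fintype mathcomp.boot.finset.
Import Order.TTheory GRing.Theory Num.Theory.
Import numFieldNormedType.Exports.

Set Implicit Arguments.
Unset Strict Implicit.
Unset Printing Implicit Defensive.

(** A first-order sentence sees only two features of a sparse random hypergraph:
    which local patterns occur at all, and how its short cycles are arranged and
    surrounded. At density [lambda / n ^ d] every tree occurs many times with
    probability tending to one, so that the first feature is deterministic in the
    limit, while the second one is a random hypergraph of bounded expected size
    whose law converges.

    Cycles enter through a count of vertices. A family of [m] edges that forms a
    tree covers [d * m + 1] vertices; a family is called dense here if it covers at
    most [d * m], and the dense core of order [N] is the union of the dense
    families with at most [N] edges. A family covering [v] vertices has about
    [n ^ v] positions, each of probability about [n ^ (- d * m)], so dense families
    have bounded expected number, and families covering less than [d * m] vertices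
    almost never occur.

    Logic. A ball that avoids the dense core is a tree ([hball_forest]). In the
    Ehrenfeucht-Fraisse game on two hypergraphs, a move near the core or near
    earlier moves is answered inside the ball around them. A remote move sees a
    tree, and is answered in a component of the other hypergraph that is a tree of
    the same type for the remaining rounds; there are finitely many types, and many
    components of each. Hence the isomorphism type of the core of a suitable order
    decides every sentence of a given quantifier depth ([models_core]).

    Probability. The tree components are found by a second moment computation
    ([tends_few_copies]), and the size of the core is controlled by the first moment
    ([prob_large_core]). The law of the core is obtained without computing the
    probability [Z n] of an empty core: for a fixed hypergraph [Y], the probability
    that the core is [Y] is that of the presence of [Y] and of the absence of
    further edges next to it, times [Z n], up to rare events ([prob_core]). Summing
    over the positions of [Y], the probability of each isomorphism type (a shape) is
    asymptotic to a constant times [Z n] ([shape_limit]). As boundedly many shapes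
    carry almost all the probability, the total weight of those that satisfy a given
    sentence, divided by the total weight of all of them, approximates the
    probability of that sentence ([shape_mixture]); so the latter converges. *)
Local Open Scope nat_scope.
Local Open Scope set_scope.

(** * Hypergraphs, dense cores and balls *)

Section Hypergraphs.
Variables (d : nat) (V : finType).
Implicit Types (E F : {set {set V}}) (e X Y A B D : {set V}) (x y : V).

Definition uniform E := E \subset [set e : {set V} | #|e| == d.+1].

(** Nonempty forests have more than [d] vertices per edge, so that a nonempty
    dense family contains a cycle. Connectedness is not asked for: this makes
    density stable under unions in sparse families (see [card_cover_core]). *)
Definition edense F := #|cover F| <= d * #|F|.

(** The core plays the part of the short cycles together with their
    surroundings. Bounding numbers of edges rather than lengths makes the core
    of the core the core itself ([dcore_dcore]), and the neighbourhood of a core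
    a part of the core of the next order ([touch_dcore]). *)
Definition dcore N E : {set {set V}} :=
  \bigcup_(F : {set {set V}} | [&& F \subset E, #|F| <= N & edense F]) F.

Fixpoint hball E X r : {set V} :=
  if r is r'.+1 then
    hball E X r' :|: cover [set e in E | ~~ [disjoint e & hball E X r']]
  else X.

Definition induced E A := [set e in E | e \subset A].

Lemma uniform_card E e : uniform E -> e \in E -> #|e| = d.+1.
Proof. by move=> /subsetP uE /uE; rewrite inE => /eqP. Qed.

Lemma uniformS E F : F \subset E -> uniform E -> uniform F.
Proof. exact: subset_trans. Qed.

Lemma uniform_neq0 E e : uniform E -> e \in E -> exists x, x \in e.
Proof.
move=> uE eE; apply/set0Pn; rewrite -card_gt0.
by rewrite (uniform_card uE eE).
Qed.

Lemma coverP E x : reflect (exists2 e, e \in E & x \in e) (x \in cover E).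
Proof. exact: bigcupP. Qed.

Lemma coverS E F : F \subset E -> cover F \subset cover E.
Proof.
move=> /subsetP sFE; apply/subsetP => x /coverP[e eF xe].
by apply/coverP; exists e => //; apply: sFE.
Qed.

Lemma coverU E F : cover (E :|: F) = cover E :|: cover F.
Proof. by rewrite /cover bigcup_setU. Qed.

Lemma cover_ub E e : e \in E -> e \subset cover E.
Proof. by move=> eE; apply: bigcup_sup. Qed.

Lemma touchP A B : reflect (exists2 x, x \in A & x \in B) (~~ [disjoint A & B]).
Proof.
by apply: (iffP pred0Pn) => [[x /andP[]]|[x xA xB]]; exists x => //; apply/andP.
Qed.

Lemma dcoreP N E e : reflect
  (exists F, [/\ F \subset E, #|F| <= N, edense F & e \in F]) (e \in dcore N E).
Proof.
apply: (iffP bigcupP) => [[F /and3P[? ? ?] ?]|[F [? ? ? ?]]]; exists F => //.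
by apply/and3P.
Qed.

Lemma dcore_ub N E F : F \subset E -> #|F| <= N -> edense F ->
  F \subset dcore N E.
Proof. by move=> *; apply/subsetP=> e eF; apply/dcoreP; exists F. Qed.

Lemma dcore_sub N E : dcore N E \subset E.
Proof.
by apply/subsetP => e /dcoreP[F [/subsetP sFE _ _ eF]]; exact: sFE.
Qed.

Lemma dcoreS N E F : F \subset E -> dcore N F \subset dcore N E.
Proof.
move=> sFE; apply/subsetP => e /dcoreP[G [sGF cG dG eG]].
by apply/dcoreP; exists G; split=> //; apply: subset_trans sFE.
Qed.

Lemma dcore_leq M N E : M <= N -> dcore M E \subset dcore N E.
Proof.
move=> MN; apply/subsetP => e /dcoreP[G [sGF cG dG eG]].
by apply/dcoreP; exists G; split=> //; apply: leq_trans MN.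
Qed.

Lemma dcore_dcore M N E : M <= N -> dcore M (dcore N E) = dcore M E.
Proof.
move=> MN; apply/eqP; rewrite eqEsubset dcoreS ?dcore_sub //=.
apply/subsetP => e /dcoreP[G [sGF cG dG eG]].
apply/dcoreP; exists G; split=> //; apply: dcore_ub => //.
exact: leq_trans MN.
Qed.

Lemma card_attach A e : #|e| = d.+1 -> ~~ [disjoint e & A] ->
  #|e :|: A| <= #|A| + d.
Proof.
move=> ce /touchP[x xe xA].
have := cardsUI e A; rewrite ce.
suff: 0 < #|e :&: A| by lia.
by rewrite card_gt0; apply/set0Pn; exists x; rewrite inE xe.
Qed.

Lemma edense_attach F e : #|e| = d.+1 -> ~~ [disjoint e & cover F] ->
  edense F -> edense (e |: F).
Proof.
move=> ce ne dF; have [eF|eF] := boolP (e \in F).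
  by rewrite (setUidPr _) ?sub1set.
rewrite /edense coverU {1}/cover big_set1 cardsU1 eF mulnDr muln1.
by apply: leq_trans (card_attach ce ne) _; rewrite addnC leq_add2l.
Qed.

(** An edge glued to a dense family brings at most [d] new vertices, so the
    larger family is still dense. *)
Lemma touch_dcore M E e : uniform E -> e \in E ->
  ~~ [disjoint e & cover (dcore M E)] -> e \in dcore M.+1 E.
Proof.
move=> uE eE /touchP[x xe /coverP[e' /dcoreP[F [sFE cF dF e'F]] xe']].
apply/dcoreP; exists (e |: F); split; last by rewrite !inE eqxx.
- by rewrite subUset sub1set eE.
- by rewrite cardsU1; case: (_ \notin _) => //=; rewrite ?add1n ?add0n ?ltnS // leqW.
- apply: edense_attach => //; first exact: uniform_card eE.
  by apply/touchP; exists x => //; apply/coverP; exists e'.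
Qed.

Lemma hball_incr E X r : hball E X r \subset hball E X r.+1.
Proof. exact: subsetUl. Qed.

Lemma hball_leq E X r s : r <= s -> hball E X r \subset hball E X s.
Proof.
move=> rs; rewrite -(subnK rs); elim: (s - r) => [|k IH] //.
by rewrite addSn; apply: subset_trans IH (hball_incr _ _ _).
Qed.

Lemma hball_touch E X r e : e \in E -> ~~ [disjoint e & hball E X r] ->
  e \subset hball E X r.+1.
Proof.
move=> eE ne; apply: subset_trans (subsetUr _ _).
by apply: cover_ub; rewrite inE eE.
Qed.

Lemma hballS E X Y r : X \subset Y -> hball E X r \subset hball E Y r.
Proof.
move=> sXY; elim: r => [|r IH] //=; apply: setUSS => //; apply: coverS.
apply/subsetP => e; rewrite !inE => /andP[-> /touchP[x xe xX]].
by apply/touchP; exists x => //; apply: (subsetP IH).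
Qed.

Lemma hballD E X r s : hball E (hball E X r) s = hball E X (s + r).
Proof. by elim: s => [|s IH] //=; rewrite IH. Qed.

Lemma hballU E X Y r : hball E (X :|: Y) r = hball E X r :|: hball E Y r.
Proof.
apply/eqP; rewrite eqEsubset; apply/andP; split; last first.
  by rewrite subUset !hballS ?subsetUl ?subsetUr.
elim: r => [|r IH] //=; rewrite subUset; apply/andP; split.
  by apply: subset_trans IH _; apply: setUSS; apply: subsetUl.
apply/subsetP => x /coverP[e]; rewrite inE => /andP[eE /touchP[y ye]].
move=> /(subsetP IH); rewrite inE => /orP[]yB xe; rewrite !inE.
  suff -> : x \in cover [set e in E | ~~ [disjoint e & hball E X r]].
    by rewrite orbT.
  by apply/coverP; exists e => //; rewrite inE eE; apply/touchP; exists y.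
suff -> : x \in cover [set e in E | ~~ [disjoint e & hball E Y r]].
  by rewrite !orbT.
by apply/coverP; exists e => //; rewrite inE eE; apply/touchP; exists y.
Qed.

Lemma hball_sym E x y r : y \in hball E [set x] r -> x \in hball E [set y] r.
Proof.
elim: r y => [|r IH] y /=; first by rewrite !inE eq_sym.
rewrite inE => /orP[/IH|/coverP[e]].
  by move=> h; rewrite inE h.
rewrite inE => /andP[eE /touchP[z ze /IH xz]] ye.
suff /subsetP : hball E [set z] r \subset hball E [set y] r.+1 by exact.
rewrite -addn1 -hballD; apply: hballS.
rewrite sub1set !inE; apply/orP; right; apply/coverP; exists e => //.
by rewrite inE eE; apply/touchP; exists y; rewrite ?inE.
Qed.

Lemma hball_induced E D X r : hball E X r \subset D ->
  hball (induced E D) X r = hball E X r.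
Proof.
elim: r => [|r IH] //= sD.
have sD' : hball E X r \subset D by apply: subset_trans sD; apply: subsetUl.
rewrite IH //; congr (_ :|: cover _); apply/setP => e; rewrite !inE.
case eE: (e \in E) => //=; rewrite andbC; case ne: (~~ _) => //=.
apply: subset_trans sD; apply: subset_trans (subsetUr _ _); apply: cover_ub.
by rewrite inE eE.
Qed.

Lemma hball_closed E X A r : X \subset A ->
  (forall e, e \in E -> ~~ [disjoint e & A] -> e \subset A) ->
  hball E X r \subset A.
Proof.
move=> sXA cA; elim: r => [|r IH] //=; rewrite subUset IH /=.
apply/subsetP => x /coverP[e]; rewrite inE => /andP[eE /touchP[y ye yB]].
apply: (subsetP _); apply: cA => //; apply/touchP; exists y => //.
exact: (subsetP IH).
Qed.

Lemma hball_dcore E M r : uniform E ->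
  hball E (cover (dcore M E)) r \subset cover (dcore (M + r) E).
Proof.
move=> uE; elim: r => [|r IH]; first by rewrite addn0.
rewrite /= subUset addnS; apply/andP; split.
  by apply: subset_trans IH _; apply/coverS/dcore_leq.
apply: coverS; apply/subsetP => e; rewrite inE => /andP[eE /touchP[x xe xB]].
by apply: touch_dcore => //; apply/touchP; exists x => //; apply: (subsetP IH).
Qed.

End Hypergraphs.

Section Transport.
Variables (d : nat) (V W : finType) (f : V -> W).
Hypothesis injf : injective f.
Implicit Types (E F : {set {set V}}) (X : {set V}).

Definition emap E : {set {set W}} := [set f @: e | e : {set V} in E].

Lemma emap_inj : injective emap.
Proof. exact/imset_inj/imset_inj. Qed.

Lemma mem_emap E (e : {set V}) : (f @: e \in emap E) = (e \in E).
Proof. by rewrite mem_imset //; apply: imset_inj. Qed.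

Lemma card_emap E : #|emap E| = #|E|.
Proof. by rewrite card_imset //; apply: imset_inj. Qed.

Lemma cover_emap E : cover (emap E) = f @: cover E.
Proof.
apply/setP => y; apply/coverP/imsetP => [[_ /imsetP[e eE ->]]|].
  by case/imsetP => x xe ->; exists x => //; apply/coverP; exists e.
case=> x /coverP[e eE xe] ->; exists (f @: e); first exact: imset_f.
exact: imset_f.
Qed.

Lemma emapS E F : (emap E \subset emap F) = (E \subset F).
Proof.
apply/idP/idP => [/subsetP h|]; last exact: imsetS.
by apply/subsetP => e eE; rewrite -mem_emap; apply: h; rewrite mem_emap.
Qed.

Lemma sub_emap E (F : {set {set W}}) : F \subset emap E ->
  exists2 F' : {set {set V}}, F' \subset E & F = emap F'.
Proof.
move=> sF; exists [set e in E | f @: e \in F].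
  by apply/subsetP => e; rewrite inE => /andP[].
apply/setP => w; apply/idP/imsetP => [wF|[e]]; last first.
  by rewrite inE => /andP[_ eF] ->.
have /imsetP[e eE ew] := subsetP sF _ wF.
by exists e => //; rewrite inE eE -ew.
Qed.

Lemma edense_emap F : edense d (emap F) = edense d F.
Proof. by rewrite /edense cover_emap card_imset // card_emap. Qed.

Lemma dcore_emap N E : dcore d N (emap E) = emap (dcore d N E).
Proof.
apply/setP => w; apply/dcoreP/imsetP => [[F [sF cF dF wF]]|].
  have [F' sF' eF] := sub_emap sF; move: cF dF wF; rewrite {}eF.
  rewrite card_emap edense_emap => cF dF /imsetP[e eF' ->]; exists e => //.
  by apply/dcoreP; exists F'.
case=> e /dcoreP[F [sF cF dF eF]] ->; exists (emap F); split.
- by rewrite emapS.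
- by rewrite card_emap.
- by rewrite edense_emap.
- by rewrite mem_emap.
Qed.

Lemma disjoint_imset (A B : {set V}) : [disjoint f @: A & f @: B] = [disjoint A & B].
Proof.
by rewrite -!setI_eq0 -imsetI; [rewrite imset_eq0|move=> x y _ _; apply: injf].
Qed.

Lemma hball_emap E X r : hball (emap E) (f @: X) r = f @: hball E X r.
Proof.
elim: r => [|r IH] //=; rewrite IH imsetU -cover_emap; congr (_ :|: cover _).
apply/setP => w; rewrite inE; apply/andP/imsetP => [[/imsetP[e eE ->]]|].
  by rewrite disjoint_imset => h; exists e => //; rewrite inE eE.
case=> e; rewrite inE => /andP[eE h] ->.
by rewrite mem_emap disjoint_imset.
Qed.

Lemma uniform_emap E : uniform d (emap E) = uniform d E.
Proof.
apply/subsetP/subsetP => h e.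
  by move=> eE; have := h (f @: e); rewrite mem_emap !inE card_imset //; apply.
by move=> /imsetP[e' /h]; rewrite !inE => ? ->; rewrite card_imset.
Qed.

End Transport.

(** * Sparse neighbourhoods are trees *)

Definition setcard (T : finType) (A : {set T}) : nat := #|A|.

Ltac fold_setcard :=
  repeat match goal with
  | H : is_true (leq _ _) |- _ => move: H
  | H : @eq nat _ _ |- _ => move: H
  end;
  unfold reverse_coercion;
  repeat match goal with
  | |- context [@card.body ?T (@mem ?a ?b (@pred_of_set.body ?T2 ?A))] =>
    change (@card.body T (@mem a b (@pred_of_set.body T2 A)))
      with (@setcard T2 A)
  end;
  repeat match goal with
  | |- context [@setcard ?T ?A] => generalize (@setcard T A)
  end; clear.
(** Linear and polynomial arithmetic over cardinals of sets of sets, whose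
    convertible forms are identified first. *)
Ltac card_lia := fold_setcard; lia.
Ltac card_nia := fold_setcard; nia.

Section Sparse.
Variables (d : nat) (V : finType).
Implicit Types (E F G Y : {set {set V}}) (e A U X : {set V}) (x y : V).

Lemma card_cover_submod F G :
  #|cover (F :|: G)| + #|cover (F :&: G)| <= #|cover F| + #|cover G|.
Proof.
rewrite -(cardsUI (cover F)) coverU leq_add2l; apply: subset_leq_card.
by rewrite subsetI !coverS // ?subsetIl ?subsetIr.
Qed.

(** By submodularity of the number of covered vertices, the union of two dense
    subfamilies of a sparse family is dense; hence a maximal dense subfamily of
    [Y] contains all the dense families that [Y] is made of. *)
Lemma card_cover_core N Y : (forall F, F \subset Y -> d * #|F| <= #|cover F|) ->
  dcore d N Y = Y -> #|cover Y| = d * #|Y|.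
Proof.
move=> sp coreY; apply/eqP; rewrite eqn_leq sp // andbT.
pose P F := (F \subset Y) && edense d F.
have P0 : P set0.
  by rewrite /P sub0set /edense /cover big_set0 !cards0.
have [F /andP[sFY dF] maxF] := arg_maxnP (fun F => #|F|) P0.
suff -> : Y = F by [].
apply/eqP; rewrite eqEsubset sFY andbT; apply/subsetP => e.
rewrite -{1}coreY => /dcoreP[G [sGY _ dG eG]].
have sU : F :|: G \subset Y by rewrite subUset sFY.
have sI : F :&: G \subset Y by apply: subset_trans sFY; apply: subsetIl.
have /maxF/= : P (F :|: G).
  rewrite /P sU /edense; move: (card_cover_submod F G) (sp _ sI) dF dG.
  by rewrite /edense; have := cardsUI F G; card_nia.
move=> le; suff -> : F = F :|: G by rewrite inE eG orbT.
by apply/eqP; rewrite eqEcard subsetUl.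
Qed.

(** Connected families around [x], in the form of a construction history: each
    edge costs at most [d] new vertices, which gives [grown_card]. *)
Inductive grown x : {set {set V}} -> Prop :=
| Grown0 : grown x set0
| GrownS F e : grown x F -> ~~ [disjoint e & x |: cover F] ->
    #|e| = d.+1 -> grown x (e |: F).

Lemma cover1U e F : cover (e |: F) = e :|: cover F.
Proof. by rewrite coverU {1}/cover big_set1. Qed.

Lemma cover0 : cover (set0 : {set {set V}}) = set0.
Proof. by rewrite /cover big_set0. Qed.

Lemma grown_card x F : grown x F -> #|x |: cover F| <= d * #|F| + 1.
Proof.
elim=> [|A e gA IH ne ce]; first by rewrite cover0 setU0 cards1 leq_addl.
have [eA|eA] := boolP (e \in A); first by rewrite (setUidPr (_ : [set e] \subset A)) ?sub1set.
rewrite cover1U setUCA cardsU1 eA.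
by have := card_attach ce ne; card_lia.
Qed.

Lemma grownU x F G : grown x F -> grown x G -> grown x (F :|: G).
Proof.
move=> gF; elim=> [|A e gA IH /touchP[y ye yA] ce]; first by rewrite setU0.
rewrite setUCA; apply: GrownS => //; apply/touchP; exists y => //.
move: yA; rewrite coverU !inE => /orP[->//|->]; first by rewrite !orbT.
Qed.

(** The last clause says that the edges of the path stay closer to [x] than its
    end does, so that a path cannot use the edge it is going to be closed with. *)
Lemma grown_path E x i y : uniform d E -> y \in hball E [set x] i ->
  exists F, [/\ grown x F, F \subset E, #|F| <= i, y \in x |: cover F &
    forall e, e \in F -> exists2 j, j < i & ~~ [disjoint e & hball E [set x] j]].
Proof.
move=> uE; elim: i y => [|i IH] y /=.
  rewrite inE => /eqP ->; exists set0; split; rewrite ?sub0set ?cards0 //.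
  - exact: Grown0.
  - by rewrite !inE eqxx.
  - by move=> e; rewrite inE.
rewrite inE => /orP[/IH[F [gF sF cF yF tF]]|/coverP[e]].
  exists F; split=> //; first exact: leqW.
  by move=> e /tF[j ji]; exists j => //; apply: leqW.
rewrite inE => /andP[eE ne] ye; have /touchP[z ze /IH[F [gF sF cF zF tF]]] := ne.
exists (e |: F); split.
- apply: GrownS => //; first by apply/touchP; exists z.
  exact: uniform_card eE.
- by rewrite subUset sub1set eE.
- by rewrite cardsU1; case: (_ \notin _) => /=; card_lia.
- by rewrite cover1U !inE ye orbT.
- move=> e'; rewrite !inE => /orP[/eqP ->|/tF[j ji]]; first by exists i.
  by exists j => //; apply: leqW.
Qed.

Section Ball.
Variables (E : {set {set V}}) (x : V).
Hypothesis uE : uniform d E.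
Let B i := hball E [set x] i.

Let first_at e i := ~~ [disjoint e & B i] /\ (forall j, j < i -> [disjoint e & B j]).

(** An edge with two vertices at the minimal distance [i] from [x] closes a
    cycle with the two paths leading to them. *)
Lemma two_roots_dense e i u w : e \in E -> first_at e i ->
  u \in e -> u \in B i -> w \in e -> w \in B i -> u != w ->
  e \in dcore d (i + i).+1 E.
Proof.
move=> eE [_ fe] ue uB we wB uw.
have [F [gF sF cF uF tF]] := grown_path uE uB.
have [G [gG sG cG wG tG]] := grown_path uE wB.
have gFG := grownU gF gG.
have eFG : e \notin F :|: G.
  rewrite inE; apply/norP; split; apply/negP.
    by move=> /tF[j /fe ->].
  by move=> /tG[j /fe ->].
apply/dcoreP; exists (e |: (F :|: G)); split; last by rewrite !inE eqxx.
- by rewrite !subUset sub1set eE sF.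
- by rewrite cardsU1 eFG; have := cardsU F G; card_lia.
- rewrite /edense cover1U cardsU1 eFG.
  have h1 : #|e :|: cover (F :|: G)| <= #|e :|: (x |: cover (F :|: G))|.
    by apply/subset_leq_card/setUS/subsetUr.
  apply: (leq_trans h1).
  have := cardsUI e (x |: cover (F :|: G)); rewrite (uniform_card uE eE).
  have : 1 < #|e :&: (x |: cover (F :|: G))|.
    have : [set u; w] \subset e :&: (x |: cover (F :|: G)).
      rewrite subUset !sub1set !inE ue we /= coverU.
      move: uF wG; rewrite !inE => /orP[->|->] /orP[->|->] //=; 
      by rewrite ?orbT.
    by move=> /subset_leq_card; rewrite cards2 uw.
  by have := grown_card gFG; card_lia.
Qed.

(** Two edges leading from earlier layers to the same vertex [y] close a cycle
    through [y]; both must start from the same layer. *)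
Lemma two_parents_dense e1 e2 i1 i2 y : e1 \in E -> e2 \in E -> e1 != e2 ->
  first_at e1 i1 -> first_at e2 i2 -> y \in e1 -> y \in e2 ->
  y \notin B i1 -> y \notin B i2 -> e1 \in dcore d (i1 + i1).+2 E.
Proof.
move=> e1E e2E e12 [/touchP[u1 u1e u1B] f1] [/touchP[u2 u2e u2B] f2] ye1 ye2.
move=> yB1 yB2.
have next k u e : e \in E -> u \in e -> u \in B k -> y \in e -> y \in B k.+1.
  move=> eE ue uB ye; apply: (subsetP (hball_touch eE _)) ye.
  by apply/touchP; exists u.
have E12 : i1 = i2.
  apply/eqP; rewrite eqn_leq; apply/andP; split; rewrite leqNgt; apply/negP => lt.
    by case/negP: yB1; apply: (subsetP (hball_leq _ _ lt)); exact: next e2E u2e u2B ye2.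
  by case/negP: yB2; apply: (subsetP (hball_leq _ _ lt)); exact: next e1E u1e u1B ye1.
rewrite -{}E12 in f2 u2B yB2 *.
have [F [gF sF cF uF tF]] := grown_path uE u1B.
have [G [gG sG cG wG tG]] := grown_path uE u2B.
have gFG := grownU gF gG.
have gH : grown x (e1 |: (F :|: G)).
  apply: GrownS => //; last exact: uniform_card e1E.
  apply/touchP; exists u1 => //; rewrite coverU !inE.
  by move: uF; rewrite !inE => /orP[->|->]; rewrite ?orbT.
have e1FG : e1 \notin F :|: G.
  rewrite inE; apply/norP; split; apply/negP.
    by move=> /tF[j /f1 ->].
  by move=> /tG[j /f1 ->].
have e2FG : e2 \notin e1 |: (F :|: G).
  rewrite !inE; apply/norP; split; first by rewrite eq_sym.
  apply/norP; split; apply/negP.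
    by move=> /tF[j /f2 ->].
  by move=> /tG[j /f2 ->].
apply/dcoreP; exists (e2 |: (e1 |: (F :|: G))); split; last by rewrite !inE eqxx orbT.
- by rewrite !subUset !sub1set e1E e2E sF.
- by rewrite !cardsU1 e2FG e1FG; have := cardsU F G; card_lia.
- rewrite /edense cover1U cardsU1 e2FG.
  set H := e1 |: (F :|: G) in gH e2FG *.
  have h1 : #|e2 :|: cover H| <= #|e2 :|: (x |: cover H)|.
    by apply/subset_leq_card/setUS/subsetUr.
  apply: (leq_trans h1).
  have := cardsUI e2 (x |: cover H); rewrite (uniform_card uE e2E).
  have uy : y != u2 by apply: contraNneq yB2 => ->.
  have : 1 < #|e2 :&: (x |: cover H)|.
    have : [set y; u2] \subset e2 :&: (x |: cover H).
      rewrite subUset !sub1set !inE ye2 u2e /= /H cover1U coverU !inE ye1 orbT /=.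
      by move: wG; rewrite !inE => /orP[->|->]; rewrite ?orbT.
    by move=> /subset_leq_card; rewrite cards2 uy.
  by have := grown_card gH; card_lia.
Qed.

(** Since no short cycle is near, each edge has a single vertex closest to the
    centre, and the sets of the [d] other vertices of the edges are pairwise
    disjoint. One more vertex is covered: the closest vertex of an edge that
    comes closest to the centre lies in none of these sets. *)
Lemma hball_forest r F : [disjoint B r & cover (dcore d (r + r).+1 E)] ->
  F \subset induced E (B r) -> F != set0 -> d * #|F| < #|cover F|.
Proof.
move=> far sF F0.
have FE e : e \in F -> e \in E.
  by move=> /(subsetP sF); rewrite inE => /andP[].
have FB e : e \in F -> e \subset B r.
  by move=> /(subsetP sF); rewrite inE => /andP[].
have notcore k e : k <= (r + r).+1 -> e \in F -> e \notin dcore d k E.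
  move=> kr eF; apply/negP => /(subsetP (dcore_leq d E kr)) ec.
  have [y ye] := uniform_neq0 uE (FE _ eF).
  have := disjointFr far (subsetP (FB _ eF) _ ye).
  by rewrite (subsetP (cover_ub ec)).
pose m e := find (fun i => ~~ [disjoint e & B i]) (iota 0 r.+1).
have has_m e : e \in F -> has (fun i => ~~ [disjoint e & B i]) (iota 0 r.+1).
  move=> eF; apply/hasP; exists r; first by rewrite mem_iota /=; card_lia.
  have [y ye] := uniform_neq0 uE (FE _ eF).
  by apply/touchP; exists y => //; apply: (subsetP (FB _ eF)).
have m_le e : e \in F -> m e <= r.
  by move=> /has_m; rewrite has_find size_iota.
have m_first e : e \in F -> first_at e (m e).
  move=> eF; split.
    have := nth_find 0 (has_m _ eF).
    by rewrite nth_iota // ltnS m_le.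
  move=> j jm; have := before_find 0 jm.
  rewrite nth_iota; first by move/negbFE.
  by apply: leq_trans jm _; rewrite ltnW // ltnS m_le.
pose ch e := if e \in F then e :\: B (m e) else set0.
have ch_disj e1 e2 : e1 != e2 -> [disjoint ch e1 & ch e2].
  move=> e12; rewrite /ch; case: ifP => [F1|_]; last first.
    by rewrite -setI_eq0 set0I.
  case: ifP => [F2|_]; last by rewrite -setI_eq0 setI0.
  apply: contraT => /touchP[y]; rewrite !inE => /andP[n1 y1] /andP[n2 y2].
  have := two_parents_dense (FE _ F1) (FE _ F2) e12 (m_first _ F1) (m_first _ F2)
    y1 y2 n1 n2.
  suff lt : m e1 < r by rewrite (negPf (notcore _ _ _ F1)) //; card_lia.
  rewrite ltn_neqAle m_le // andbT; apply: contraNneq n1 => ->.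
  exact: (subsetP (FB _ F1)).
have ch_card e : e \in F -> #|ch e| = d.
  move=> eF; rewrite /ch eF cardsD (uniform_card uE (FE _ eF)).
  have [/touchP[u ue uB] _] := m_first _ eF.
  suff -> : e :&: B (m e) = [set u] by rewrite cards1 subn1.
  apply/setP => w; rewrite !inE; apply/andP/eqP => [[we wB]|->//].
  apply/eqP; apply: contraT => wu.
  have := two_roots_dense (FE _ eF) (m_first _ eF) we wB ue uB wu.
  by rewrite (negPf (notcore _ _ _ eF)) //; have := m_le _ eF; card_lia.
have [e0 e0F] := set0Pn _ F0.
have [e eF emin] := arg_minnP m e0F.
have [/touchP[u ue uB] _] := m_first _ eF.
have -> : d * #|F| = #|\bigcup_e ch e|.
  rewrite -[RHS]sum1_card partition_disjoint_bigcup // mulnC -sum_nat_const.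
  rewrite [LHS]big_mkcond [RHS](eq_bigr (fun e' => #|ch e'|)) => [|e' _].
    by apply: eq_bigr => e' _; case: ifPn => [/ch_card->//|h]; rewrite /ch (negPf h) cards0.
  by rewrite sum1_card.
apply: (@leq_trans #|u |: \bigcup_e' ch e'|).
  rewrite cardsU1 (_ : u \notin _) //; apply/negP => /bigcupP[e' _].
  rewrite /ch; case: ifP => [e'F|_]; last by rewrite inE.
  rewrite inE => /andP[/negP nB _]; apply: nB; apply: (subsetP (hball_leq _ _ (emin _ e'F))).
  exact: uB.
apply: subset_leq_card; rewrite subUset sub1set; apply/andP; split.
  by apply/coverP; exists e.
apply/bigcupsP => e' _; rewrite /ch; case: ifP => [e'F|_]; last exact: sub0set.
by apply: subset_trans (subsetDl _ _) _; apply: cover_ub.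
Qed.

End Ball.

(** The event that the core is [Y], up to rare families, as requirements on
    three disjoint sets of edges: those of [Y], those that meet a dense family
    of [Y] small enough to be extended by one edge, and those avoiding [Y]. *)
Definition core_like N Y E :=
  [&& Y \subset E,
      [forall e in E, ~~ [disjoint e & cover (dcore d N Y)] ==> (e \in Y)] &
      dcore d N.+1 [set e in E | [disjoint e & cover Y]] == set0].

(** Families that occur near the fixed vertex set [U] with vanishing
    probability, as they span too few vertices outside [U]. *)
Definition rare_near N U E :=
  [exists J : {set {set V}}, [&& J \subset E, 0 < #|J| <= N &
     #|cover J :\: U| < d * #|J|]].

Lemma rare_nearS N U E F : E \subset F -> rare_near N U E -> rare_near N U F.
Proof.
move=> sEF /existsP[J /and3P[sJ cJ dJ]]; apply/existsP; exists J.
by rewrite (subset_trans sJ sEF) cJ dJ.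
Qed.

Lemma dcore_is_core_like N Y E : uniform d E -> dcore d N.+1 E = Y ->
  core_like N Y E.
Proof.
move=> uE <-; apply/and3P; split; first exact: dcore_sub.
  apply/forall_inP => e eE; apply/implyP; rewrite dcore_dcore //.
  exact: touch_dcore.
apply/eqP/setP => e; rewrite inE; apply/negP => /dcoreP[F [sF cF dF eF]].
have := subsetP sF _ eF; rewrite inE => /andP[eE dis].
have ec : e \in dcore d N.+1 E.
  apply/dcoreP; exists F; split=> //; apply: subset_trans sF _.
  by apply/subsetP => ?; rewrite inE => /andP[].
have [y ye] := uniform_neq0 uE eE.
by have := disjointFr dis ye; rewrite (subsetP (cover_ub ec)).
Qed.

(** Let [F] be a dense family that is not contained in [Y], and [J] its part
    outside [Y]. If the part [F0] inside [Y] is not dense, then [J] has less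
    than [d] new vertices per edge. If it is, then [J] cannot meet it, so [J]
    is dense as well: it meets [Y] elsewhere, and is rare, or it avoids [Y]. *)
Lemma core_like_dcore N Y E : uniform d E ->
  (forall F, F \subset Y -> d * #|F| <= #|cover F|) ->
  dcore d N.+1 Y = Y -> core_like N Y E ->
  dcore d N.+1 E = Y \/ rare_near N.+1 (cover Y) (E :\: Y).
Proof.
move=> uE sp coreY /and3P[sYE /forall_inP notouch /eqP out].
have [eq|neq] := eqVneq (dcore d N.+1 E) Y; [by left|right].
have : ~~ (dcore d N.+1 E \subset Y).
  by apply: contraNN neq => h; rewrite eqEsubset h -{1}coreY dcoreS.
case/subsetPn => e /dcoreP[F [sF cF dF eF]] eY.
pose J := F :\: Y; pose F0 := F :&: Y.
have cJ : 0 < #|J| by rewrite card_gt0; apply/set0Pn; exists e; rewrite !inE eY.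
have cFJ : #|F| = #|F0| + #|J| by rewrite cardsID.
have cU : cover F0 \subset cover F :&: cover Y.
  by rewrite subsetI !coverS ?subsetIl ?subsetIr.
have cJU : #|cover J :\: cover Y| <= #|cover F :\: cover Y|.
  by apply/subset_leq_card/setSD/coverS/subsetDl.
have cFY : #|cover F :\: cover Y| + #|cover F0| <= #|cover F|.
  by rewrite -(cardsID (cover Y) (cover F)) addnC leq_add2r subset_leq_card.
have sJE : J \subset E :\: Y by apply: setSD.
have sp0 := sp _ (subsetIr F Y); rewrite -/F0 in sp0.
apply/existsP; exists J; rewrite sJE cJ /=.
apply/andP; split; first by card_lia.
move: dF; rewrite /edense => dF.
have [h|h] := ltnP (d * #|F0|) #|cover F0|; first by card_nia.
have F0core : F0 \subset dcore d N Y.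
  by apply: dcore_ub => //; [exact: subsetIr|card_lia].
have disJ : [disjoint cover J & cover F0].
  apply: contraT => /touchP[y /coverP[e' e'J ye'] yF0].
  move: (e'J); rewrite !inE => /andP[e'Y e'F].
  have := implyP (notouch _ (subsetP sF _ e'F)); rewrite (negPf e'Y) => -> //.
  by apply/touchP; exists y => //; apply: (subsetP (coverS F0core)).
have cFU : #|cover F| = #|cover F0| + #|cover J|.
  rewrite -(setID F Y) coverU -/F0 -/J -cardsUI setIC.
  by move: disJ; rewrite -setI_eq0 => /eqP ->; rewrite cards0 addn0.
have [disY|/touchP[y yJ yY]] := boolP [disjoint cover J & cover Y].
  have : J \subset dcore d N.+1 [set e in E | [disjoint e & cover Y]].
    apply: dcore_ub; last by rewrite /edense; card_nia.
      apply/subsetP => e' e'J; rewrite inE (subsetP (subset_trans sJE (subsetDl _ _))) //=.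
      by apply: disjointWl disY; apply: cover_ub.
    by card_lia.
  by rewrite out subset0 => /eqP J0; rewrite J0 cards0 in cJ.
suff : #|cover J :\: cover Y| < #|cover J| by card_nia.
apply: proper_card; apply/properP; split; first exact: subsetDl.
by exists y => //; rewrite inE yY.
Qed.

(** A dense family with a vertex in [U] has less than [d] vertices per edge
    outside [U]. *)
Lemma dcore_out N U E : uniform d E ->
  dcore d N [set e in E | [disjoint e & U]] = set0 ->
  dcore d N E = set0 \/ rare_near N U E.
Proof.
move=> uE out; have [|/set0Pn[e /dcoreP[F [sF cF dF eF]]]] := eqVneq (dcore d N E) set0.
  by left.
right; apply/existsP; exists F; rewrite sF cF andbT.
have cF0 : 0 < #|F| by rewrite card_gt0; apply/set0Pn; exists e.
rewrite cF0 /=; have [dis|/touchP[y yF yU]] := boolP [disjoint cover F & U].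
  have : F \subset dcore d N [set e in E | [disjoint e & U]].
    apply: dcore_ub => //; apply/subsetP => e' e'F; rewrite inE (subsetP sF) //=.
    by apply: disjointWl dis; apply: cover_ub.
  by rewrite out subset0 => /eqP J0; rewrite J0 cards0 in cF0.
apply: leq_trans (proper_card _) dF; apply/properP; split; first exact: subsetDl.
by exists y => //; rewrite inE yU.
Qed.

End Sparse.

(** * The Ehrenfeucht-Fraisse game inside vertex sets *)

Definition swap (T U : Type) (a : T * U) := (a.2, a.1).

Definition lefts (T U : finType) (s : seq (T * U)) : {set T} :=
  [set x in [seq a.1 | a <- s]].
Definition rights (T U : finType) (s : seq (T * U)) : {set U} :=
  [set x in [seq a.2 | a <- s]].

Section Position.
Variables (V W : finType) (E : {set {set V}}) (F : {set {set W}}).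
Variables (P : {set V}) (Q : {set W}).
Implicit Types (s t : seq (V * W)).

Definition piso s :=
  [/\ {in s &, forall a b, (a.1 == b.1) = (a.2 == b.2)},
      {in s, forall a, (a.1 \in P) = (a.2 \in Q)} &
      forall t, {subset t <= s} -> (lefts t \in E) = (rights t \in F)].

Lemma pisoS s t : {subset t <= s} -> piso s -> piso t.
Proof.
move=> sts [h1 h2 h3]; split.
- by move=> a b /sts ? /sts ?; apply: h1.
- by move=> a /sts ?; apply: h2.
- by move=> u us; apply: h3 => a /us /sts.
Qed.

End Position.

Lemma mem_lefts (V W : finType) (s : seq (V * W)) a : a \in s -> a.1 \in lefts s.
Proof. by move=> ?; rewrite inE; apply: map_f. Qed.

Lemma mem_rights (V W : finType) (s : seq (V * W)) a : a \in s -> a.2 \in rights s.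
Proof. by move=> ?; rewrite inE; apply: map_f. Qed.

Lemma leftsP (V W : finType) (s : seq (V * W)) x :
  reflect (exists y, (x, y) \in s) (x \in lefts s).
Proof.
rewrite inE; apply: (iffP mapP) => [[[a b] h /= ->]|[y h]]; first by exists b.
by exists (x, y).
Qed.

Lemma rights_swap (V W : finType) (s : seq (V * W)) :
  rights [seq swap a | a <- s] = lefts s.
Proof. by apply/setP => x; rewrite !inE -map_comp. Qed.

Lemma lefts_swap (V W : finType) (s : seq (V * W)) :
  lefts [seq swap a | a <- s] = rights s.
Proof. by apply/setP => x; rewrite !inE -map_comp. Qed.

Lemma swapK (T U : Type) : cancel (@swap T U) (@swap U T).
Proof. by case. Qed.

Lemma map_swapK (T U : Type) (s : seq (T * U)) :
  [seq swap a | a <- [seq swap a | a <- s]] = s.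
Proof. exact: (mapK (@swapK T U)). Qed.

Section Game.

(** The Ehrenfeucht-Fraisse game of [m] rounds with moves inside the vertex sets
    [D] and [C], on hypergraphs with a marked set of vertices. Positions are
    lists of pairs, so that forgetting and reordering moves is list inclusion. *)
Fixpoint ef (V W : finType) (E : {set {set V}}) (F : {set {set W}})
    (P : {set V}) (Q : {set W}) m (D : {set V}) (C : {set W})
    (s : seq (V * W)) : Prop :=
  piso E F P Q s /\
  if m is m'.+1 then
    (forall x, x \in D -> exists2 y, y \in C & ef E F P Q m' D C ((x, y) :: s)) /\
    (forall y, y \in C -> exists2 x, x \in D & ef E F P Q m' D C ((x, y) :: s))
  else True.

End Game.

Lemma piso_swap (V W : finType) (E : {set {set V}}) (F : {set {set W}})
  (P : {set V}) (Q : {set W}) s :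
  piso E F P Q s -> piso F E Q P [seq swap a | a <- s].
Proof.
move=> [h1 h2 h3]; split.
- by move=> _ _ /mapP[a sa ->] /mapP[b sb ->] /=; rewrite h1.
- by move=> _ /mapP[a sa ->] /=; rewrite h2.
- move=> t ts; pose u := [seq swap a | a <- t].
  have tu : t = [seq swap a | a <- u] by rewrite map_swapK.
  rewrite {1 2}tu lefts_swap rights_swap h3 //.
  by move=> _ /mapP[a /ts /mapP[b sb ->] ->]; rewrite swapK.
Qed.

Lemma ef_swap (V W : finType) (E : {set {set V}}) (F : {set {set W}})
  (P : {set V}) (Q : {set W}) m D C s :
  ef E F P Q m D C s -> ef F E Q P m C D [seq swap a | a <- s].
Proof.
elim: m s => [|m IH] s /= [hs h]; split=> //; try exact: piso_swap.
by case: h => h1 h2; split=> [y /h2|x /h1] [z zD /IH]; exists z.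
Qed.

Section GameTheory.
Variables (V W : finType) (E : {set {set V}}) (F : {set {set W}}).
Variables (P : {set V}) (Q : {set W}).
Implicit Types (D A : {set V}) (B C : {set W}) (s t : seq (V * W)).
Local Notation ef := (ef E F P Q).

Lemma ef_piso m D C s : ef m D C s -> piso E F P Q s.
Proof. by case: m => [|m] []. Qed.

Lemma ef_sub m D C s t : {subset t <= s} -> ef m D C s -> ef m D C t.
Proof.
elim: m s t => [|m IH] s t ts /= [hs h]; split=> //; try exact: pisoS hs.
have ts' a : {subset a :: t <= a :: s}.
  by move=> b; rewrite !inE => /orP[->//|/ts ->]; rewrite orbT.
by case: h => h1 h2; split=> [x /h1|x /h2] [y yD h]; exists y => //; apply: IH h.
Qed.

Lemma ef_leq m n D C s : m <= n -> ef n D C s -> ef m D C s.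
Proof.
elim: m n s => [|m IH] n s mn h; first by split=> //; apply: ef_piso h.
case: n mn h => // n mn /= [hs [h1 h2]]; split=> //.
by split=> [x /h1|x /h2] [y yD h]; exists y => //; apply: IH h.
Qed.

Lemma ef_moves m l D C s : {subset l <= D} -> ef (size l + m) D C s ->
  exists t, [/\ [seq a.1 | a <- t] = l, {subset [seq a.2 | a <- t] <= C} &
    ef m D C (t ++ s)].
Proof.
elim: l s => [|x l IH] s lD /=; first by exists [::]; split.
case=> _ [h _]; have [|y yD {}h] := h x; first by apply: lD; rewrite mem_head.
have [|t [tl tD ht]] := IH _ _ h; first by move=> z zl; apply: lD; rewrite inE zl orbT.
exists ((x, y) :: t); split=> /=; first by rewrite tl.
  by move=> z; rewrite inE => /orP[/eqP ->//|/tD].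
by apply: ef_sub ht => z; rewrite !(inE, mem_cat) orbCA.
Qed.

(** Moves inside the subsets are answered by the strategy of the larger game: an
    answer outside the subset would be exposed within [c] further rounds. *)
Lemma ef_restrict c m D C A B s : A \subset D -> B \subset C ->
  (forall t a, {subset s <= t} -> a \in t -> ef c D C t ->
     (a.1 \in A) = (a.2 \in B)) ->
  ef (m + c) D C s -> ef m A B s.
Proof.
move=> sA sB; elim: m s => [|m IH] s def h; first by split=> //; apply: ef_piso h.
have := h; rewrite addSn /= => -[hs [h1 h2]]; split=> //.
have step x y : ef (m + c) D C ((x, y) :: s) ->
    (x \in A) = (y \in B) /\ ef m A B ((x, y) :: s).
  move=> h'; split.
    apply: (def ((x, y) :: s) (x, y)); [|exact: mem_head|].
      by move=> b sb; rewrite inE sb orbT.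
    by apply: ef_leq h'; apply: leq_addl.
  apply: IH h' => t a st ta; apply: def => // b bs.
  by apply: st; rewrite inE bs orbT.
split=> [x xA|y yA].
  have [y _ /step[e h']] := h1 _ (subsetP sA _ xA).
  by exists y; rewrite -?e.
have [x _ /step[e h']] := h2 _ (subsetP sB _ yA).
by exists x; rewrite ?e.
Qed.

(** Each extra unit of radius costs the [d.+1] rounds needed to name an edge. *)
Lemma ef_hball_imp d r m s t D C a : uniform d E ->
  {subset t <= s} -> r * d.+1 <= m -> ef m D C s -> a \in s ->
  a.1 \in hball (induced E D) (P :|: lefts t) r ->
  a.2 \in hball (induced F C) (Q :|: rights t) r.
Proof.
move=> uE; elim: r m s a => [|r IH] m s a ts rm h /=.
  have [h1 h2 _] := ef_piso h.
  move=> sa; rewrite !in_setU h2 // => /orP[->//|/leftsP[y ty]].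
  have /eqP -> : a.2 == y by rewrite -(h1 _ _ sa (ts _ ty)).
  by rewrite (mem_rights ty) orbT.
move=> sa; rewrite !in_setU => /orP[aB|/coverP[e]].
  by apply/orP; left; apply: IH h _ aB => //; rewrite mulSn in rm; lia.
rewrite inE => /andP[]; rewrite inE => /andP[eE eD] /touchP[x xe xB] ae.
have sz : size (enum e) = d.+1 by rewrite -cardE (uniform_card uE eE).
have h' : ef (size (enum e) + r * d.+1) D C s.
  by apply: ef_leq h; rewrite sz -mulSn.
have [|u [ue uD hu]] := ef_moves _ h'.
  by move=> y; rewrite mem_enum => /(subsetP eD).
have [h1 _ h3] := ef_piso hu.
have eu : lefts u = e by apply/setP => y; rewrite inE ue mem_enum.
have usub : {subset u <= u ++ s} by move=> b ub; rewrite mem_cat ub.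
have eF : rights u \in F by rewrite -h3 // eu.
apply/orP; right; apply/coverP; exists (rights u).
  rewrite inE inE eF /=; apply/andP; split.
    by apply/subsetP => y; rewrite inE => /uD.
  move: (xe); rewrite -eu => /leftsP[y xy].
  apply/touchP; exists y; first exact: (mem_rights xy).
  apply: (IH (r * d.+1) (u ++ s) (x, y)) => //; last exact: usub.
  by move=> b /ts sb; rewrite mem_cat sb orbT.
move: ae; rewrite -eu => /leftsP[y ay].
suff /eqP -> : a.2 == y by exact: (mem_rights ay).
have sa' : a \in u ++ s by rewrite mem_cat sa orbT.
by rewrite -(h1 _ _ sa' (usub _ ay)).
Qed.

End GameTheory.

Section Locality.
Variables (d : nat) (V W : finType) (E : {set {set V}}) (F : {set {set W}}).
Variables (P : {set V}) (Q : {set W}).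
Hypotheses (uE : uniform d E) (uF : uniform d F).
Implicit Types (D A : {set V}) (B C : {set W}) (s t : seq (V * W)).
Local Notation ef := (ef E F P Q).

Lemma ef_hball r m s t D C a :
  {subset t <= s} -> r * d.+1 <= m -> ef m D C s -> a \in s ->
  (a.1 \in hball (induced E D) (P :|: lefts t) r) =
  (a.2 \in hball (induced F C) (Q :|: rights t) r).
Proof.
move=> ts rm h sa; apply/idP/idP; first exact: (ef_hball_imp uE ts rm h sa).
move=> aB; have ts' : {subset [seq swap b | b <- t] <= [seq swap b | b <- s]}.
  by move=> _ /mapP[b /ts bs ->]; apply: map_f.
have := ef_hball_imp uF ts' rm (ef_swap h) (map_f (@swap V W) sa).
by rewrite lefts_swap rights_swap; apply.
Qed.

Lemma ef_to_hball r m s t D C : {subset t <= s} ->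
  hball E (P :|: lefts t) r \subset D -> hball F (Q :|: rights t) r \subset C ->
  ef (m + r * d.+1) D C s ->
  ef m (hball E (P :|: lefts t) r) (hball F (Q :|: rights t) r) s.
Proof.
move=> ts sD sC; apply: ef_restrict => // u a su au hu.
rewrite -(hball_induced sD) -(hball_induced sC).
by apply: (ef_hball _ (leqnn _) hu au) => b /ts /su.
Qed.

Section Union.
Variables (A1 A2 : {set V}) (B1 B2 : {set W}).
Hypotheses (dA : [disjoint A1 & A2]) (dB : [disjoint B1 & B2]).
Hypothesis cE : forall e, e \in E -> e \subset A1 :|: A2 ->
  (e \subset A1) || (e \subset A2).
Hypothesis cF : forall e, e \in F -> e \subset B1 :|: B2 ->
  (e \subset B1) || (e \subset B2).

Lemma piso_cat s1 s2 :
  {in s1, forall a, (a.1 \in A1) && (a.2 \in B1)} ->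
  {in s2, forall a, (a.1 \in A2) && (a.2 \in B2)} ->
  piso E F P Q s1 -> piso E F P Q s2 -> piso E F P Q (s1 ++ s2).
Proof.
move=> in1 in2 [p1 p2 p3] [q1 q2 q3]; split.
- move=> a b; rewrite !mem_cat => /orP[]sa /orP[]sb; [exact: p1| | |exact: q1].
  + have /andP[a1 a2] := in1 _ sa; have /andP[b1 b2] := in2 _ sb.
    transitivity false.
      by apply: contraTF a1 => /eqP ->; rewrite (disjointFl dA).
    by apply/esym; apply: contraTF a2 => /eqP ->; rewrite (disjointFl dB).
  + have /andP[a1 a2] := in2 _ sa; have /andP[b1 b2] := in1 _ sb.
    transitivity false.
      by apply: contraTF a1 => /eqP ->; rewrite (disjointFr dA).
    by apply/esym; apply: contraTF a2 => /eqP ->; rewrite (disjointFr dB).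
- by move=> a; rewrite mem_cat => /orP[]?; [exact: p2|exact: q2].
move=> t ts.
have [t1|n1] := boolP (all (mem s1) t); first by apply: p3; apply/allP.
have [t2|n2] := boolP (all (mem s2) t); first by apply: q3; apply/allP.
have mix1 : ~~ ((lefts t \subset A1) || (lefts t \subset A2)).
  apply/negP => /orP[]/subsetP h; [case/negP: n1|case/negP: n2];
    apply/allP => a ta; have := ts _ ta; have := h _ (mem_lefts ta);
    rewrite mem_cat => aA /orP[] //.
    by move=> /in2/andP[]; rewrite (disjointFr dA).
  by move=> /in1/andP[]; rewrite (disjointFl dA).
have mix2 : ~~ ((rights t \subset B1) || (rights t \subset B2)).
  apply/negP => /orP[]/subsetP h; [case/negP: n1|case/negP: n2];
    apply/allP => a ta; have := ts _ ta; have := h _ (mem_rights ta);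
    rewrite mem_cat => aA /orP[] //.
    by move=> /in2/andP[_]; rewrite (disjointFr dB).
  by move=> /in1/andP[_]; rewrite (disjointFl dB).
transitivity false.
  apply: contraNF mix1 => tE; apply: cE tE _; apply/subsetP => x /leftsP[y /ts].
  by rewrite mem_cat in_setU => /orP[/in1|/in2]/andP[/= -> //]; rewrite orbT.
apply/esym; apply: contraNF mix2 => tF; apply: cF tF _; apply/subsetP => y.
rewrite inE => /mapP[a /ts]; rewrite mem_cat in_setU => h ->.
by case/orP: h => [/in1|/in2]/andP[_ ->] //; rewrite orbT.
Qed.

(** Games on vertex sets between which no edge runs are played in parallel. *)
Lemma ef_cat m s1 s2 :
  {in s1, forall a, (a.1 \in A1) && (a.2 \in B1)} ->
  {in s2, forall a, (a.1 \in A2) && (a.2 \in B2)} ->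
  ef m A1 B1 s1 -> ef m A2 B2 s2 -> ef m (A1 :|: A2) (B1 :|: B2) (s1 ++ s2).
Proof.
elim: m s1 s2 => [|m IH] s1 s2 in1 in2 H1 H2;
  have hp := piso_cat in1 in2 (ef_piso H1) (ef_piso H2); first by split.
have cons1 x y : x \in A1 -> y \in B1 -> ef m A1 B1 ((x, y) :: s1) ->
    ef m (A1 :|: A2) (B1 :|: B2) ((x, y) :: s1 ++ s2).
  move=> xA yB h; apply: (IH ((x, y) :: s1) s2 _ in2 h (ef_leq (leqnSn m) H2)).
  by move=> a; rewrite inE => /orP[/eqP ->|/in1//]; rewrite xA.
have cons2 x y : x \in A2 -> y \in B2 -> ef m A2 B2 ((x, y) :: s2) ->
    ef m (A1 :|: A2) (B1 :|: B2) ((x, y) :: s1 ++ s2).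
  move=> xA yB h; apply: (@ef_sub _ _ _ _ _ _ _ _ _ (s1 ++ (x, y) :: s2)).
    by move=> a; rewrite !(inE, mem_cat) orbCA.
  apply: (IH s1 ((x, y) :: s2) in1 _ (ef_leq (leqnSn m) H1) h).
  by move=> a; rewrite inE => /orP[/eqP ->|/in2//]; rewrite xA.
case: H1 H2 cons1 cons2 => _ [f1 b1] [_ [f2 b2]] cons1 cons2; split=> //; split.
  move=> x; rewrite in_setU => /orP[]xA.
    by have [y yB h] := f1 _ xA; exists y; [rewrite in_setU yB|apply: cons1].
  by have [y yB h] := f2 _ xA; exists y; [rewrite in_setU yB orbT|apply: cons2].
move=> y; rewrite in_setU => /orP[]yB.
  by have [x xA h] := b1 _ yB; exists x; [rewrite in_setU xA|apply: cons1].
by have [x xA h] := b2 _ yB; exists x; [rewrite in_setU xA orbT|apply: cons2].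
Qed.

End Union.

End Locality.

(** * Game types and locality *)

Section Image.
Variables (I V W : finType) (f : I -> V) (g : I -> W).
Hypotheses (injf : injective f) (injg : injective g).
Variables (E : {set {set V}}) (F : {set {set W}}) (P : {set V}) (Q : {set W}).
Variable I0 : {set I}.
Hypothesis edgeI : forall A : {set I}, A \subset I0 -> (f @: A \in E) = (g @: A \in F).
Hypothesis markI : forall i, i \in I0 -> (f i \in P) = (g i \in Q).

Lemma ef_image m (l : seq I) : {subset l <= I0} ->
  ef E F P Q m (f @: I0) (g @: I0) [seq (f i, g i) | i <- l].
Proof.
have hp k : {subset k <= I0} -> piso E F P Q [seq (f i, g i) | i <- k].
  move=> kI; split.
  - move=> _ _ /mapP[i _ ->] /mapP[j _ ->] /=.
    by rewrite (inj_eq injf) (inj_eq injg).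
  - by move=> _ /mapP[i /kI il ->] /=; apply: markI.
  - move=> t ts; pose A := [set i in k | (f i, g i) \in t].
    have -> : lefts t = f @: A.
      apply/setP => x; apply/leftsP/imsetP => [[y xy]|[i]]; last first.
        by rewrite inE => /andP[_ it] ->; exists (g i).
      have /mapP[i il e] := ts _ xy; exists i; last by case: e.
      by rewrite inE il -e.
    have -> : rights t = g @: A.
      apply/setP => y; rewrite inE; apply/mapP/imsetP => [[[x z] /= xy ->]|[i]].
        have /mapP[i il e] := ts _ xy; exists i; last by case: e.
        by rewrite inE il -e.
      by rewrite inE => /andP[_ it] ->; exists (f i, g i).
    by apply: edgeI; apply/subsetP => i; rewrite inE => /andP[/kI].
elim: m l => [|m IH] l lI; first by split=> //; apply: hp.
split; first exact: hp.
split=> [_ /imsetP[i iI ->]|_ /imsetP[i iI ->]].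
  exists (g i); first exact: imset_f.
  by apply: (IH (i :: l)) => j; rewrite inE => /orP[/eqP ->|/lI].
exists (f i); first exact: imset_f.
by apply: (IH (i :: l)) => j; rewrite inE => /orP[/eqP ->|/lI].
Qed.

End Image.

Lemma ef_mark (V W : finType) (E : {set {set V}}) (F : {set {set W}})
  (P D : {set V}) (Q C : {set W}) m s :
  [disjoint D & P] -> [disjoint C & Q] ->
  {in s, forall a, (a.1 \in D) && (a.2 \in C)} ->
  ef E F set0 set0 m D C s -> ef E F P Q m D C s.
Proof.
move=> dP dQ; elim: m s => [|m IH] s inD /= [[h1 _ h3] h].
  by split=> //; split=> // a /inD/andP[a1 a2]; rewrite (disjointFr dP) // (disjointFr dQ).
split; first by split=> // a /inD/andP[a1 a2]; rewrite (disjointFr dP) // (disjointFr dQ).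
case: h => f b; split=> [x xD|y yC].
  have [y yC h] := f _ xD; exists y => //; apply: IH h => a.
  by rewrite inE => /orP[/eqP ->|/inD//]; rewrite xD.
have [x xD h] := b _ yC; exists x => //; apply: IH h => a.
by rewrite inE => /orP[/eqP ->|/inD//]; rewrite xD.
Qed.

Fixpoint qdepth d k (f : formula d k) : nat :=
  match f with
  | FEq _ _ _ => 0
  | FEdge _ _ => 0
  | FNot _ g => qdepth g
  | FAnd _ g h => maxn (qdepth g) (qdepth h)
  | FEx _ g => (qdepth g).+1
  end.

Lemma ef_sat d n n' (H : hypergraph d n) (H' : hypergraph d n') P Q m k
    (f : formula d k) s (v : 'I_k -> 'I_n) (v' : 'I_k -> 'I_n') :
  qdepth f <= m -> ef (edges H) (edges H') P Q m setT setT s ->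
  (forall i, (v i, v' i) \in s) -> sat H f v = sat H' f v'.
Proof.
elim: f m s v v' => {k} [k i j|k t|k g IH|k g IHg h IHh|k g IH] m s v v' /= qm hef vs.
- by have [h1 _ _] := ef_piso hef; apply: (h1 (v i, v' i) (v j, v' j)).
- have [_ _ h3] := ef_piso hef.
  pose u := [seq (v (tnth t i), v' (tnth t i)) | i : 'I_d.+1].
  have := h3 u; rewrite (_ : lefts u = [set v (tnth t i) | i : 'I_d.+1]); last first.
    apply/setP => x; rewrite inE -map_comp; apply/mapP/imsetP => -[i _ ->]; exists i => //.
    by rewrite mem_enum.
  rewrite (_ : rights u = [set v' (tnth t i) | i : 'I_d.+1]); last first.
    apply/setP => x; rewrite inE -map_comp; apply/mapP/imsetP => -[i _ ->]; exists i => //.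
    by rewrite mem_enum.
  by apply=> _ /mapP[i _ ->].
- by rewrite (IH _ _ _ _ qm hef vs).
- move: qm; rewrite geq_max => /andP[qg qh].
  by rewrite (IHg _ _ _ _ qg hef vs) (IHh _ _ _ _ qh hef vs).
- case: m qm hef => // m qm [_ [f b]].
  have ext x y i : (extend_env x v i, extend_env y v' i) \in (x, y) :: s.
    rewrite /extend_env; case: unliftP => [j|] _; last by rewrite mem_head.
    by rewrite inE vs orbT.
  apply/existsP/existsP => -[x hx].
    have [y _ h] := f x (in_setT _); exists y.
    by rewrite -(IH _ _ _ _ qm h (ext x y)).
  have [y _ h] := b x (in_setT _); exists y.
  by rewrite (IH _ _ _ _ qm h (ext y x)).
Qed.

Definition atom k : finType :=
  ({ffun 'I_k * 'I_k -> bool} * {ffun {set 'I_k} -> bool})%type.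

Fixpoint gtypes m k : finType :=
  if m is m'.+1 then (atom k * {set gtypes m' k.+1})%type else atom k.

Section Types.
Variables (V : finType) (E : {set {set V}}) (D : {set V}).

Definition atom_of k (v : 'I_k -> V) : atom k :=
  ([ffun ij => v ij.1 == v ij.2], [ffun A : {set 'I_k} => v @: A \in E]).

(** Equality of types gives a winning strategy for the game ([gtype_ef]), and the
    types for a given number of rounds form a finite set. *)
Fixpoint gtype m k (v : 'I_k -> V) : gtypes m k :=
  match m return gtypes m k with
  | 0 => atom_of v
  | m'.+1 => (atom_of v, [set gtype m' (extend_env x v) | x in D])
  end.

End Types.

Lemma gtype_ef (V W : finType) (E : {set {set V}}) (F : {set {set W}}) D C m k
    (v : 'I_k -> V) (w : 'I_k -> W) :
  gtype E D m v = gtype F C m w ->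
  ef E F set0 set0 m D C [seq (v i, w i) | i : 'I_k].
Proof.
have at_piso j (v' : 'I_j -> V) (w' : 'I_j -> W) : atom_of E v' = atom_of F w' ->
    piso E F set0 set0 [seq (v' i, w' i) | i : 'I_j].
  case=> /ffunP h1 /ffunP h2; split.
  - by move=> _ _ /mapP[i _ ->] /mapP[i' _ ->]; have := h1 (i, i'); rewrite !ffunE.
  - by move=> a _; rewrite !inE.
  - move=> t ts; have := h2 [set i | (v' i, w' i) \in t]; rewrite !ffunE.
    rewrite (_ : v' @: _ = lefts t); last first.
      apply/esym/setP => x; apply/leftsP/imsetP => [[y xy]|[i]]; last first.
        by rewrite inE => it ->; exists (w' i).
      by have /mapP[i il e] := ts _ xy; exists i; [rewrite inE -e|case: e].
    rewrite (_ : w' @: _ = rights t) //.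
    apply/esym/setP => y; rewrite inE; apply/mapP/imsetP => [[[x z] /= xy ->]|[i]].
      by have /mapP[i il e] := ts _ xy; exists i; [rewrite inE -e|case: e].
    by rewrite inE => it ->; exists (v' i, w' i).
elim: m k v w => [|m IH] k v w; first by move=> h; split=> //; apply: at_piso h.
move=> h; have ha : atom_of E v = atom_of F w := congr1 fst h.
have hs : [set gtype E D m (extend_env x v) | x in D] =
    [set gtype F C m (extend_env y w) | y in C] := congr1 snd h.
split; first exact: at_piso.
have step x y : gtype E D m (extend_env x v) = gtype F C m (extend_env y w) ->
    ef E F set0 set0 m D C ((x, y) :: [seq (v i, w i) | i : 'I_k]).
  move=> /IH; apply: ef_sub => a; rewrite inE => /orP[/eqP ->|/mapP[i _ ->]].
    by apply/mapP; exists ord0; rewrite ?mem_enum // /extend_env unlift_none.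
  by apply/mapP; exists (lift ord0 i); rewrite ?mem_enum // /extend_env liftK.
split=> [x xD|y yC].
  have : gtype E D m (extend_env x v) \in [set gtype F C m (extend_env y w) | y in C].
    by rewrite -hs imset_f.
  by case/imsetP => y yC /step hy; exists y.
have : gtype F C m (extend_env y w) \in [set gtype E D m (extend_env x v) | x in D].
  by rewrite hs imset_f.
by case/imsetP => x xD /esym/step hx; exists x.
Qed.

Lemma gtype_image (V W : finType) (f : V -> W) (E : {set {set V}})
    (F : {set {set W}}) (D : {set V}) m k (v : 'I_k -> V) :
  injective f -> (forall A : {set V}, A \subset D -> (f @: A \in F) = (A \in E)) ->
  (forall i, v i \in D) -> gtype F (f @: D) m (f \o v) = gtype E D m v.
Proof.
move=> injf edgeD; elim: m k v => [|m IH] k v vD /=;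
  have at_eq : atom_of F (f \o v) = atom_of E v.
1,3: congr pair; apply/ffunP => x; rewrite !ffunE /= ?(inj_eq injf) //.
1,2: rewrite imset_comp edgeD //; apply/subsetP => _ /imsetP[i _ ->] //.
- by [].
rewrite at_eq; congr pair; rewrite -imset_comp; apply: eq_in_imset => x xD /=.
rewrite -IH; last first.
  by move=> i; rewrite /extend_env; case: unliftP.
congr gtype; apply/funext => i; rewrite /extend_env /=.
by case: unliftP.
Qed.

Section Local.
Variable d : nat.

(** Radius and number of rounds of the local game that support [j] rounds of
    the global one. With [r] the previous radius, vertices within [2 r + 1] of
    the marks are treated as near: no edge meets both the ball of radius [r]
    around the marks and that around a vertex farther away. The next radius
    [3 r + 1] makes the ball of a near vertex visible. *)
Fixpoint rad j := if j is j'.+1 then (rad j' + rad j' + rad j').+1 else 0.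

Fixpoint rank j :=
  if j is j'.+1 then (rank j' + (rad j' + rad j' + rad j').+1 * d.+1).+1 else 0.

(** The bound [q] on the number of chosen vertices is what lets finitely many
    candidates for [y] suffice. *)
Definition extension (V W : finType) (E : {set {set V}}) (F : {set {set W}})
    (P : {set V}) (Q : {set W}) q r m :=
  forall (s : seq (V * W)) x, size s < q ->
  x \notin hball E (P :|: lefts s) (r + r).+1 ->
  exists2 y, y \notin hball F (Q :|: rights s) (r + r).+1 &
    ef E F P Q m (hball E [set x] r) (hball F [set y] r) [:: (x, y)].

Lemma hball_self (V : finType) (E : {set {set V}}) (X : {set V}) r : X \subset hball E X r.
Proof. exact: (@hball_leq V E X 0 r). Qed.

Lemma hball_far (V : finType) (E : {set {set V}}) (X : {set V}) x r :
  x \notin hball E X (r + r).+1 ->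
  [disjoint hball E X r & hball E [set x] r] /\
  (forall e, e \in E -> e \subset hball E X r :|: hball E [set x] r ->
     (e \subset hball E X r) || (e \subset hball E [set x] r)).
Proof.
move=> far.
have near y : y \in hball E X r.+1 -> y \notin hball E [set x] r.
  move=> yX; apply: contraNN far => /hball_sym.
  have : hball E [set y] r \subset hball E X (r + r.+1).
    by rewrite -hballD; apply: hballS; rewrite sub1set.
  by rewrite addnS => /subsetP; apply.
split.
  apply: contraT => /touchP[y yX]; rewrite (negPf (near _ _)) //.
  exact: (subsetP (hball_incr _ _ _)).
move=> e eE /subsetP sub; have [dis|ne] := boolP [disjoint e & hball E X r].
  apply/orP; right; apply/subsetP => y ye.
  by have := sub _ ye; rewrite in_setU (disjointFr dis).
apply/orP; left; apply/subsetP => y ye; have := sub _ ye; rewrite in_setU => /orP[//|].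
by rewrite (negPf (near _ _)) //; apply: (subsetP (hball_touch eE ne)).
Qed.

Lemma lefts_cons (V W : finType) (s : seq (V * W)) x y :
  lefts ((x, y) :: s) = x |: lefts s.
Proof. by apply/setP => z; rewrite !inE. Qed.

Lemma rights_cons (V W : finType) (s : seq (V * W)) x y :
  rights ((x, y) :: s) = y |: rights s.
Proof. by apply/setP => z; rewrite !inE. Qed.

Lemma hball_cons (V : finType) (E : {set {set V}}) (P A : {set V}) x r :
  hball E (P :|: (x |: A)) r = hball E (P :|: A) r :|: hball E [set x] r.
Proof. by rewrite setUCA setUC hballU. Qed.

Section Step.
Variables (V W : finType) (E : {set {set V}}) (F : {set {set W}}).
Variables (P : {set V}) (Q : {set W}).
Hypotheses (uE : uniform d E) (uF : uniform d F).

Definition local_game j s :=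
  ef E F P Q (rank j) (hball E (P :|: lefts s) (rad j))
    (hball F (Q :|: rights s) (rad j)) s.

(** A vertex near the marked set is answered in the local game, a remote one
    by the extension property. *)
Lemma local_game_forth q j s x : size s < q ->
  extension E F P Q q (rad j) (rank j) -> local_game j.+1 s ->
  exists y, local_game j ((x, y) :: s).
Proof.
move=> sq ext game; have s_cons y : {subset s <= (x, y) :: s}.
  by move=> a sa; rewrite inE sa orbT.
have le1 : (rad j + rad j).+1 <= rad j.+1 by rewrite /=; lia.
have le2 : rad j <= rad j.+1 by rewrite /=; lia.
have [near|far] := boolP (x \in hball E (P :|: lefts s) (rad j + rad j).+1).
  have [_ [forth _]] := game.
  have [|y yD] := forth x; first exact: (subsetP (hball_leq _ _ le1)).
  rewrite -/rad -/rank; set c := _ * d.+1 => h.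
  have c1 : (rad j + rad j).+1 * d.+1 <= rank j + c.
    by apply: leq_trans (leq_addl _ _); rewrite leq_mul2r /=; lia.
  have yF : y \in hball F (Q :|: rights s) (rad j + rad j).+1.
    have := ef_hball uE uF (s_cons y) c1 h (mem_head _ _).
    by rewrite !hball_induced ?hball_leq // near => /esym.
  have sub (U : finType) (G : {set {set U}}) (X : {set U}) z :
      z \in hball G X (rad j + rad j).+1 ->
      hball G X (rad j) :|: hball G [set z] (rad j) \subset hball G X (rad j.+1).
    move=> zX; rewrite subUset hball_leq // andTb.
    have -> : rad j.+1 = rad j + (rad j + rad j).+1 by rewrite /=; lia.
    by rewrite -hballD; apply: hballS; rewrite sub1set.
  have {}h : ef E F P Q (rank j + rad j * d.+1) (hball E (P :|: lefts s) (rad j.+1))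
      (hball F (Q :|: rights s) (rad j.+1)) ((x, y) :: s).
    by apply: ef_leq h; rewrite leq_add2l leq_mul2r; lia.
  exists y; apply: (ef_to_hball uE uF _ _ _ h) => //.
    by rewrite lefts_cons hball_cons; exact: sub.
  by rewrite rights_cons hball_cons; exact: sub.
have [y fary hy] := ext s x sq far; exists y.
have [dE cE] := hball_far far; have [dF cF] := hball_far fary.
rewrite /local_game lefts_cons rights_cons !hball_cons.
apply: (@ef_sub _ _ _ _ _ _ _ _ _ (s ++ [:: (x, y)])).
  by move=> a; rewrite mem_cat !inE orbC.
apply: (ef_cat dE dF cE cF) => //.
- move=> a sa; rewrite !(subsetP (hball_self _ _ _)) // in_setU.
    by rewrite mem_rights ?orbT.
  by rewrite mem_lefts ?orbT.
- by move=> a; rewrite inE => /eqP ->; rewrite !(subsetP (hball_self _ _ _)) ?set11.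
have game' : ef E F P Q (rank j + rad j * d.+1) (hball E (P :|: lefts s) (rad j.+1))
    (hball F (Q :|: rights s) (rad j.+1)) s.
  by apply: ef_leq game; apply: leqW; rewrite leq_add2l leq_mul2r; lia.
exact: (ef_to_hball uE uF _ (hball_leq _ _ le2) (hball_leq _ _ le2) game').
Qed.

End Step.

Lemma local_game_swap (V W : finType) (E : {set {set V}}) (F : {set {set W}})
    (P : {set V}) (Q : {set W}) j s :
  local_game E F P Q j s -> local_game F E Q P j [seq swap a | a <- s].
Proof. by rewrite /local_game lefts_swap rights_swap => /ef_swap. Qed.

(** Locality in the style of Gaifman: as remote moves can always be answered,
    only the neighbourhood of the marked sets matters. *)
Lemma local_game_ef (V W : finType) (E : {set {set V}}) (F : {set {set W}})
    (P : {set V}) (Q : {set W}) q j s :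
  uniform d E -> uniform d F -> size s + j <= q ->
  (forall i, i < j -> extension E F P Q q (rad i) (rank i)) ->
  (forall i, i < j -> extension F E Q P q (rad i) (rank i)) ->
  local_game E F P Q j s -> ef E F P Q j setT setT s.
Proof.
move=> uE uF; elim: j s => [|j IH] s sq extE extF game.
  by split=> //; apply: ef_piso game.
have sq' : size s < q by lia.
split; first exact: ef_piso game.
have next x y : local_game E F P Q j ((x, y) :: s) ->
    ef E F P Q j setT setT ((x, y) :: s).
  apply: IH; first by rewrite /=; lia.
    by move=> i ij; apply: extE; lia.
  by move=> i ij; apply: extF; lia.
split=> [x _|y _].
  have [y h] := local_game_forth uE uF x sq' (extE _ (ltnSn j)) game.
  by exists y => //; apply: next.
have sq'' : size [seq swap a | a <- s] < q by rewrite size_map.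
have [x h] := local_game_forth uF uE y sq'' (extF _ (ltnSn j)) (local_game_swap game).
exists x => //; apply: next; have := local_game_swap h.
by rewrite /= map_swapK.
Qed.

End Local.

(** * Trees as components; the dense core decides sentences *)

Section Trees.
Variable d : nat.

Definition forest (V : finType) (E : {set {set V}}) :=
  forall F : {set {set V}}, F \subset E -> F != set0 -> d * #|F| < #|cover F|.

Definition closed_under (V : finType) (E : {set {set V}}) (A : {set V}) :=
  forall e : {set V}, e \in E -> ~~ [disjoint e & A] -> e \subset A.

Lemma closed_underC (V : finType) (E : {set {set V}}) (A : {set V}) :
  closed_under E A -> closed_under E (~: A).
Proof.
move=> cA e eE /touchP[x xe]; rewrite inE => xA.
apply: contraTT xe => /subsetPn[y ye]; rewrite inE negbK => yA.
apply: contraNN xA; apply: (subsetP _); apply: cA => //.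
by apply/touchP; exists y.
Qed.

(** Connectedness is expressed by closed vertex sets; in this form it shows that
    distinct components are disjoint ([copies_same]). *)
Record tree := Tree {
  order : nat;
  tedges : {set {set 'I_order}};
  root : 'I_order;
  tree_uniform : uniform d tedges;
  tree_forest : forest tedges;
  tree_connected : forall A : {set 'I_order}, closed_under tedges A ->
    A = set0 \/ A = setT }.

Definition tree_type m (T : tree) : gtypes m 1 :=
  gtype (tedges T) setT m (fun _ : 'I_1 => root T).

(** One tree is chosen for each of the finitely many types that trees realize. *)
Lemma tree_representatives m : exists k (T : 'I_k -> tree),
  forall T0, exists i, tree_type m (T i) = tree_type m T0.
Proof.
suff H (s : seq (gtypes m 1)) : exists k (T : 'I_k -> tree),
    forall T0, tree_type m T0 \in s -> exists i, tree_type m (T i) = tree_type m T0.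
  have [k [T hT]] := H (enum (gtypes m 1)); exists k, T => T0.
  by apply: hT; rewrite mem_enum.
elim: s => [|a s [k [T hT]]].
  by exists 0, (@empty_env tree) => T0.
have [[T1 <-]|no] := pselect (exists T1, tree_type m T1 = a).
  exists k.+1, (extend_env T1 T) => T0; rewrite inE => /orP[/eqP ->|/hT[i hi]].
    by exists ord0; rewrite /extend_env unlift_none.
  by exists (lift ord0 i); rewrite /extend_env liftK.
exists k, T => T0; rewrite inE => /orP[/eqP h|/hT//].
by case: no; exists T0.
Qed.

Lemma order_gt0 T : 0 < order T.
Proof. exact: leq_ltn_trans (leq0n _) (ltn_ord (root T)). Qed.

Lemma card_tedges T : d * #|tedges T| < order T.
Proof.
have [->|h] := eqVneq (tedges T) set0.
  by rewrite cards0 muln0 order_gt0.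
apply: leq_trans (tree_forest (subxx _) h) _.
by apply: leq_trans (max_card _) _; rewrite card_ord.
Qed.

(** Embeddings of [T] as a connected component. *)
Definition copies (V : finType) (T : tree) (E : {set {set V}}) :
    {set {ffun 'I_(order T) -> V}} :=
  [set f : {ffun 'I_(order T) -> V} | injectiveb f &
    [set e in E | ~~ [disjoint e & f @: setT]] == emap f (tedges T)].

Section Copies.
Variables (V : finType) (T : tree) (E : {set {set V}}).
Hypothesis uE : uniform d E.
Local Notation emb := {ffun 'I_(order T) -> V}.

Lemma copies_inj (f : emb) : f \in copies T E -> injective f.
Proof. by rewrite inE => /andP[/injectiveP]. Qed.

Lemma copies_edge (f : emb) (e : {set V}) : f \in copies T E -> e \in E ->
  ~~ [disjoint e & f @: setT] -> exists2 e0 : {set 'I_(order T)}, e0 \in tedges T & e = f @: e0.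
Proof.
rewrite inE => /andP[_ /eqP/setP/(_ e)]; rewrite inE => h eE ne.
by move: h; rewrite eE ne => /esym/imsetP.
Qed.

Lemma copies_closed (f : emb) : f \in copies T E -> closed_under E (f @: setT).
Proof.
move=> cf e eE /(copies_edge cf eE)[e0 _ ->]; exact/imsetS/subsetT.
Qed.

Lemma copies_mem (f : emb) (A : {set 'I_(order T)}) : f \in copies T E ->
  (f @: A \in E) = (A \in tedges T).
Proof.
move=> cf; apply/idP/idP => [fAE|AT].
  have [|e0 e0T /(imset_inj (copies_inj cf)) -> //] := copies_edge cf fAE.
  have [x xA] := uniform_neq0 uE fAE.
  by apply/touchP; exists x => //; apply: (subsetP (imsetS _ (subsetT _))) xA.
move: cf; rewrite inE => /andP[/injectiveP injf /eqP/setP/(_ (f @: A))].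
by rewrite mem_emap // AT inE => /andP[].
Qed.

Lemma copies_same (f g : emb) y : f \in copies T E -> g \in copies T E ->
  y \in f @: setT -> y \in g @: setT -> f @: setT = g @: setT.
Proof.
move=> cf cg yf yg.
have clA : closed_under (tedges T) (f @^-1: (g @: setT)).
  move=> e eT /touchP[x xe]; rewrite inE => xg.
  apply/subsetP => z ze; rewrite inE.
  have := copies_closed cg; move/(_ (f @: e)); rewrite copies_mem // => /(_ eT) h.
  apply: (subsetP (h _)); last exact: imset_f.
  by apply/touchP; exists (f x) => //; apply: imset_f.
have [A0|AT] := tree_connected clA.
  case/imsetP: yf => x _ yx; have : x \in f @^-1: (g @: setT) by rewrite inE -yx.
  by rewrite A0 inE.
apply/eqP; rewrite eqEcard !card_imset; try exact: copies_inj.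
rewrite leqnn andbT; apply/subsetP => _ /imsetP[x _ ->].
have : x \in f @^-1: (g @: setT) by rewrite AT inE.
by rewrite inE.
Qed.

(** The images of two copies are equal or disjoint, and at most [t ^ t] copies
    share an image of [t] vertices; so each given vertex spoils few copies. *)
Lemma copies_avoid q (X : {set V}) : #|X| <= q ->
  q * order T ^ order T < #|copies T E| ->
  exists2 f : emb, f \in copies T E & [disjoint f @: setT & X].
Proof.
move=> Xq many; apply: contrapT => none.
suff : #|copies T E| <= #|X| * order T ^ order T.
  by move: many (leq_mul Xq (leqnn (order T ^ order T))); lia.
apply: (@leq_trans #|\bigcup_(y in X) [set f in copies T E | y \in f @: setT]|).
  apply: subset_leq_card; apply/subsetP => f cf.
  have [dis|/touchP[y yf yX]] := boolP [disjoint f @: setT & X].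
    by case: none; exists f.
  by apply/bigcupP; exists y => //; rewrite inE cf.
apply: (@leq_trans (\sum_(y in X) order T ^ order T)); last by rewrite sum_nat_const.
elim/big_rec2: _ => [|y m A yX IH]; first by rewrite cards0.
rewrite (leq_trans (leq_card_setU _ _)) // leq_add //.
have [->|/set0Pn[f]] := eqVneq [set f in copies T E | y \in f @: setT] set0.
  by rewrite cards0.
rewrite inE => /andP[cf yf].
apply: (@leq_trans #|[set g : {ffun 'I_(order T) -> V} in ffun_on (mem (f @: setT))]|).
  apply: subset_leq_card; apply/subsetP => g; rewrite inE => /andP[cg yg].
  rewrite inE; apply/ffun_onP => i; rewrite (copies_same cf cg yf yg).
  exact: imset_f.
rewrite cardsE card_ffun_on card_imset ?cardsT ?card_ord //; exact: copies_inj cf.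
Qed.

End Copies.

Definition sparse (V : finType) L (E : {set {set V}}) :=
  [forall F : {set {set V}}, (F \subset E) && (#|F| <= L) ==> (d * #|F| <= #|cover F|)].

(** A tree component contains no edge of the dense core: its edges could be
    removed from a dense family, leaving one that is even denser. *)
Lemma copies_core (V : finType) (T : tree) (E : {set {set V}})
    (f : {ffun 'I_(order T) -> V}) L :
  uniform d E -> sparse L E -> f \in copies T E ->
  [disjoint f @: setT & cover (dcore d L E)].
Proof.
move=> uE /forallP sp cf; apply: contraT => /touchP[y yf /coverP[e]].
case/dcoreP => F [sFE cF dF eF] ye.
pose F1 := [set a in F | a \subset f @: setT].
have injf := copies_inj cf.
have sub1 : F1 \subset emap f (tedges T).
  apply/subsetP => a; rewrite inE => /andP[aF aW].
  have aE := subsetP sFE _ aF; have [z za] := uniform_neq0 uE aE.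
  have [|e0 e0T ->] := copies_edge cf aE; last by rewrite mem_emap.
  by apply/touchP; exists z => //; apply: (subsetP aW).
have F1n : F1 != set0.
  apply/set0Pn; exists e; rewrite inE eF.
  by apply: (copies_closed cf) (subsetP sFE _ eF) _; apply/touchP; exists y.
have dF1 : d * #|F1| < #|cover F1|.
  have [F' sF' eF'] := sub_emap sub1.
  rewrite eF' card_emap // cover_emap card_imset //; apply: tree_forest => //.
  by apply: contraNneq F1n => F'0; rewrite eF' F'0 /emap imset0.
have sD : F :\: F1 \subset E by apply: subset_trans sFE; apply: subsetDl.
have cD : #|F| = #|F1| + #|F :\: F1|.
  rewrite -(cardsID F1 F); congr (_ + _); congr #|pred_of_set _|; apply/setP => a.
  by rewrite !inE; case: (a \in F).
have := sp (F :\: F1); rewrite sD (leq_trans (subset_leq_card (subsetDl _ _)) cF) /=.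
have disC : [disjoint cover F1 & cover (F :\: F1)].
  apply: contraT => /touchP[z /coverP[a]]; rewrite inE => /andP[_ aW] za.
  case/coverP => b; rewrite !inE => /andP[/negP nb bF] zb; case: nb; rewrite bF.
  apply: (copies_closed cf) (subsetP sFE _ bF) _; apply/touchP; exists z => //.
  exact: (subsetP aW).
have cC : #|cover F| = #|cover F1| + #|cover (F :\: F1)|.
  rewrite -{1}(setID F F1) coverU (setIidPr _); last first.
    by apply/subsetP => a; rewrite inE => /andP[].
  by rewrite -cardsUI; move: disC; rewrite -setI_eq0 => /eqP ->; rewrite cards0 addn0.
by move: dF; rewrite /edense; card_nia.
Qed.

(** The edges inside the ball form a forest by [hball_forest], and they connect
    the ball to its centre. *)
Lemma hball_tree (V : finType) (E : {set {set V}}) x r m : uniform d E ->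
  [disjoint hball E [set x] r & cover (dcore d (r + r).+1 E)] ->
  exists T, tree_type m T = gtype E (hball E [set x] r) m (fun _ : 'I_1 => x).
Proof.
move=> uE far; set B := hball E [set x] r in far *.
have xB : x \in B by apply: (subsetP (hball_self _ _ _)); rewrite set11.
have [t [h [injh imh]]] : exists t (h : 'I_t -> V), injective h /\ h @: setT = B.
  exists #|B|, (fun i => enum_val i); split; first exact: enum_val_inj.
  apply/setP => y; apply/imsetP/idP => [[i _ ->]|yB]; first exact: enum_valP.
  by exists (enum_rank_in yB y) => //; rewrite enum_rankK_in.
have [x0 _ xh] : exists2 x0, x0 \in setT & x = h x0.
  by apply/imsetP; rewrite imh.
pose T0 := [set A : {set 'I_t} | h @: A \in E].
have eT0 : emap h T0 = induced E B.
  apply/setP => e; rewrite [RHS]inE; apply/imsetP/andP => [[A]|[eE eB]].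
    by rewrite inE => AE ->; split=> //; rewrite -imh; apply/imsetS/subsetT.
  have he : e = h @: (h @^-1: e).
    apply/setP => y; apply/idP/imsetP => [ye|[i]]; last by rewrite inE => ? ->.
    have := subsetP eB _ ye; rewrite -imh => /imsetP[i _ yi].
    by exists i; rewrite // inE -yi.
  by exists (h @^-1: e) => //; rewrite inE -he.
have uT0 : uniform d T0.
  rewrite -(uniform_emap _ injh) eT0; apply: uniformS uE.
  by apply/subsetP => e; rewrite inE => /andP[].
have fT0 : forest T0.
  move=> F sF F0; rewrite -(card_emap injh) -(card_imset _ injh) -cover_emap.
  apply: (@hball_forest _ _ E x uE r) => //.
    by rewrite -/B -eT0 emapS.
  by rewrite /emap imset_eq0.
have reach (A : {set 'I_t}) : x0 \in A -> closed_under T0 A -> A = setT.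
  move=> xA cA; apply/eqP; rewrite -subTset; apply/subsetP => i _.
  have : h i \in B by rewrite -imh imset_f.
  rewrite /B -(hball_induced (subxx B)) -eT0 => hi.
  suff : h i \in h @: A by rewrite mem_imset.
  apply: (subsetP (hball_closed _ _ _)) hi; first by rewrite sub1set xh imset_f.
  move=> _ /imsetP[e eT ->]; rewrite disjoint_imset // => ne.
  by apply/imsetS/cA.
have cT0 (A : {set 'I_t}) : closed_under T0 A -> A = set0 \/ A = setT.
  move=> cA; have [xA|xA] := boolP (x0 \in A); [right|left]; first exact: reach.
  apply: setC_inj; rewrite setC0; apply: reach; first by rewrite inE.
  exact: closed_underC.
exists (Tree x0 uT0 fT0 cT0); rewrite /tree_type /= -imh.
rewrite -(gtype_image (f := h) (E := T0) (F := E)) //; last by move=> A _; rewrite inE.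
by congr gtype; apply/funext => i; rewrite /= -xh.
Qed.

(** A remote vertex sees a tree; the other structure has a component that is a
    tree of the same type and avoids the vertices already played. *)
Lemma tree_extension (V W : finType) (E : {set {set V}}) (F : {set {set W}})
    L q r m M k (T : 'I_k -> tree) :
  uniform d E -> uniform d F -> (r + r).+1 <= L -> m + r * d.+1 <= M ->
  sparse L F ->
  (forall T0, exists i, tree_type M (T i) = tree_type M T0) ->
  (forall i, q * order (T i) ^ order (T i) < #|copies (T i) F|) ->
  extension E F (cover (dcore d L E)) (cover (dcore d L F)) q r m.
Proof.
move=> uE uF rL mM spF hT many s x sq far.
set P := cover _ in far *; set Q := cover _.
have disP : [disjoint hball E [set x] r & P].
  have [dis _] := hball_far far; rewrite disjoint_sym; apply: disjointWl dis.
  by apply: subset_trans (hball_self _ _ _); apply: subsetUl.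
have [T0 tyT0] : exists T0, tree_type M T0 = gtype E (hball E [set x] r) M (fun _ : 'I_1 => x).
  apply: hball_tree => //; apply: disjointWr disP; exact/coverS/dcore_leq.
have [i tyi] := hT T0; have manyi := many i; move: (T i) tyi manyi => T1 tyT1 manyT1.
have sq' : #|rights s| <= q.
  rewrite cardsE; apply: leq_trans (card_size _) _; rewrite size_map; exact: ltnW.
have [f cf avoid] := copies_avoid uF sq' manyT1.
have injf := copies_inj cf; set Wf := f @: setT in avoid.
pose y := f (root T1); have yW : y \in Wf by apply: imset_f.
have clW : closed_under F Wf by exact: copies_closed cf.
have disQ : [disjoint Wf & Q] by exact: (copies_core uF spF cf).
have ballW : hball F [set y] r \subset Wf by apply: hball_closed; rewrite ?sub1set.
have far' : y \notin hball F (Q :|: rights s) (r + r).+1.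
  have sub : hball F (Q :|: rights s) (r + r).+1 \subset ~: Wf.
    apply: hball_closed; last exact: closed_underC.
    by rewrite subUset -!disjoints_subset ![[disjoint _ & Wf]]disjoint_sym disQ.
  by apply/negP => /(subsetP sub); rewrite inE yW.
exists y => //.
have tyf : gtype F Wf M (fun _ : 'I_1 => y) = tree_type M T1.
  rewrite /tree_type -(gtype_image (f := f) (F := F)) //.
  by move=> A _; apply: copies_mem.
have game : ef E F set0 set0 M (hball E [set x] r) Wf [:: (x, y)].
  have /gtype_ef : gtype E (hball E [set x] r) M (fun _ : 'I_1 => x) =
    gtype F Wf M (fun _ : 'I_1 => y) by rewrite tyf tyT1.
  apply: ef_sub => a; rewrite inE => /eqP ->.
  by apply/mapP; exists ord0; rewrite ?mem_enum.
have l1 : set0 :|: lefts [:: (x, y)] = [set x].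
  by apply/setP => z; rewrite !inE.
have r1 : set0 :|: rights [:: (x, y)] = [set y].
  by apply/setP => z; rewrite !inE.
apply: ef_mark => //; first exact: disjointWl disQ.
  by move=> a; rewrite inE => /eqP ->; rewrite !(subsetP (hball_self _ _ _)) ?set11.
rewrite -l1 -r1; apply: (ef_to_hball uE uF _ _ _ (ef_leq mM game)) => //.
  by rewrite l1.
by rewrite r1.
Qed.

Lemma hball_dcore_eq (V : finType) (E : {set {set V}}) L N r :
  uniform d E -> L + r <= N ->
  hball E (cover (dcore d L E)) r = hball (dcore d N E) (cover (dcore d L E)) r.
Proof.
move=> uE; elim: r => [|r IH] //= LN; rewrite -IH; last by lia.
congr (_ :|: cover _); apply/setP => e; rewrite !inE.
have [ne|] := boolP (~~ _); last by rewrite !andbF.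
rewrite !andbT; apply/idP/idP => [eE|]; last exact: (subsetP (dcore_sub _ _ _)).
rewrite addnS in LN; apply: (subsetP (dcore_leq _ _ LN)); apply: touch_dcore => //.
move/touchP: ne => [z ze zB]; apply/touchP; exists z => //.
by apply: (subsetP (hball_dcore _ _ uE)) zB.
Qed.

(** The edges within distance [R] of the core of order [L] belong to the core of
    order [L + R + 1], so that an isomorphism of the larger cores carries one
    neighbourhood to the other. *)
Lemma core_game (I V W : finType) (E : {set {set V}}) (F : {set {set W}})
    (Y : {set {set I}}) (f : I -> V) (g : I -> W) L R m :
  uniform d E -> uniform d F -> injective f -> injective g ->
  dcore d (L + R).+1 E = emap f Y -> dcore d (L + R).+1 F = emap g Y ->
  ef E F (cover (dcore d L E)) (cover (dcore d L F)) m
    (hball E (cover (dcore d L E)) R) (hball F (cover (dcore d L F)) R) [::].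
Proof.
move=> uE uF injf injg coreE coreF.
have core (U : finType) (G : {set {set U}}) (h : I -> U) : uniform d G ->
    injective h -> dcore d (L + R).+1 G = emap h Y ->
  [/\ cover (dcore d L G) = h @: cover (dcore d L Y),
      hball G (cover (dcore d L G)) R = h @: hball Y (cover (dcore d L Y)) R &
      forall A : {set I}, A \subset hball Y (cover (dcore d L Y)) R ->
        (h @: A \in G) = (A \in Y)].
  move=> uG injh coreG.
  have LR : L <= (L + R).+1 by lia.
  have LR' : L + R <= (L + R).+1 by lia.
  have c1 : cover (dcore d L G) = h @: cover (dcore d L Y).
    by rewrite -(dcore_dcore d G LR) coreG dcore_emap // cover_emap.
  have c2 : hball G (cover (dcore d L G)) R = h @: hball Y (cover (dcore d L Y)) R.
    by rewrite (hball_dcore_eq uG LR') coreG c1 hball_emap.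
  split=> // A sA; apply/idP/idP => [hAG|AY]; last first.
    by apply: (subsetP (dcore_sub d (L + R).+1 G)); rewrite coreG mem_emap.
  rewrite -(mem_emap injh) -coreG; apply: touch_dcore => //.
  have [z zA] := uniform_neq0 uG hAG; apply/touchP; exists z => //.
  apply: (subsetP (hball_dcore L R uG)); rewrite c2.
  exact: (subsetP (imsetS h sA)).
have [e1 e2 e3] := core _ _ _ uE injf coreE.
have [f1 f2 f3] := core _ _ _ uF injg coreF.
rewrite e2 f2; apply: (@ef_image _ _ _ f g injf injg _ _ _ _ _ _ _ m [::]) => // [A sA|i _].
  by rewrite e3 // f3.
by rewrite e1 f1 !mem_imset.
Qed.

Lemma rank_step i j : i < j -> rank d i + rad i * d.+1 <= rank d j.
Proof.
elim: j => // j IH; rewrite ltnS leq_eqVlt => /orP[/eqP ->|/IH h] /=; last first.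
  by apply: leq_trans h _; apply: leqW; apply: leq_addr.
by apply: leqW; rewrite leq_add2l leq_mul2r; lia.
Qed.

Lemma rad_step i j : i < j -> (rad i + rad i).+1 <= rad j.
Proof.
elim: j => // j IH; rewrite ltnS leq_eqVlt => /orP[/eqP ->|/IH h] /=; lia.
Qed.

Definition rich (V : finType) q L k (T : 'I_k -> tree) (E : {set {set V}}) :=
  sparse L E && [forall i, q * order (T i) ^ order (T i) < #|copies (T i) E|].

(** Remote moves are answered by [tree_extension], and the local game starts from
    the isomorphism of the neighbourhoods of the cores ([core_game]). *)
Lemma models_core n n' (H : hypergraph d n) (H' : hypergraph d n')
    (phi : sentence d) q k (T : 'I_k -> tree) (I : finType) (Y : {set {set I}})
    (f : I -> 'I_n) (g : I -> 'I_n') :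
  qdepth phi <= q ->
  (forall T0, exists i, tree_type (rank d q) (T i) = tree_type (rank d q) T0) ->
  rich q (rad q) T (edges H) -> rich q (rad q) T (edges H') ->
  injective f -> injective g ->
  dcore d (rad q + rad q).+1 (edges H) = emap f Y ->
  dcore d (rad q + rad q).+1 (edges H') = emap g Y ->
  models H phi = models H' phi.
Proof.
move=> phiq hT /andP[spH /forallP manyH] /andP[spH' /forallP manyH'] injf injg cH cH'.
have uH : uniform d (edges H) := edges_uniform H.
have uH' : uniform d (edges H') := edges_uniform H'.
have game m := core_game m uH uH' injf injg cH cH'.
apply: (ef_sat phiq _ (s := [::])); last by case.
apply: (local_game_ef (d := d) (q := q)) => //.
- move=> i iq; apply: (tree_extension uH uH' (rad_step iq) (rank_step iq) spH' hT).
  exact: manyH'.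
- move=> i iq; apply: (tree_extension uH' uH (rad_step iq) (rank_step iq) spH hT).
  exact: manyH.
rewrite /local_game.
have l0 : lefts ([::] : seq ('I_n * 'I_n')) = set0 by apply/setP => z; rewrite !inE.
have r0 : rights ([::] : seq ('I_n * 'I_n')) = set0 by apply/setP => z; rewrite !inE.
by rewrite l0 r0 !setU0.
Qed.

End Trees.

(** * Random subsets of a finite set *)

Local Open Scope ring_scope.
Local Open Scope set_scope.

Section RandomSubset.
Variables (R : realType) (X : finType) (pr : X -> R).
Implicit Types (A B C : pred {set X}) (E F S : {set X}).

(** The law of the random subset that contains each [x] with probability [pr x],
    independently. *)
Definition bern E : R := \prod_x (if x \in E then pr x else 1 - pr x).
Definition prob A : R := \sum_(E | A E) bern E.

Lemma probT : prob predT = 1.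
Proof.
transitivity (\prod_x (pr x + (1 - pr x))); first by rewrite finset.bigA_distr.
by rewrite big1 // => x _; rewrite addrC subrK.
Qed.

Lemma eq_prob A B : A =1 B -> prob A = prob B.
Proof. exact: eq_bigl. Qed.

Lemma prob_pattern F S : [disjoint F & S] ->
  prob (fun E => (F \subset E) && [disjoint E & S]) =
  \prod_(x in F) pr x * \prod_(x in S) (1 - pr x).
Proof.
move=> dFS.
pose f x := if x \in S then 0 else pr x.
pose g x := if x \in F then 0 else 1 - pr x.
transitivity (\sum_(E : {set X}) \prod_x (if x \in E then f x else g x)).
  rewrite /prob big_mkcond /=; apply: eq_bigr => E _.
  case: ifPn => [/andP[/subsetP FE dES]|].
    apply: eq_bigr => x _; rewrite /f /g; case: ifPn => xE.
      by rewrite (disjointFr dES xE).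
    by case: ifPn => // /FE; rewrite (negPf xE).
  rewrite negb_and => /orP[/subsetPn[x xF xE]|/touchP[x xE xS]].
    by rewrite (bigD1 x) //= (negPf xE) /g xF mul0r.
  by rewrite (bigD1 x) //= xE /f xS mul0r.
rewrite -finset.bigA_distr [X in _ = X * _]big_mkcond [X in _ = _ * X]big_mkcond.
rewrite -big_split /=.
apply: eq_bigr => x _; rewrite /f /g.
have [xF|xF] := boolP (x \in F); first by rewrite (disjointFr dFS xF) addr0 mulr1.
by case: ifP => _; rewrite ?add0r mul1r // addrC subrK.
Qed.

Lemma sum_split S (f g : {set X} -> R) :
  \sum_(E : {set X}) f (E :&: S) * g (E :\: S) =
  (\sum_(E : {set X} | E \subset S) f E) * (\sum_(E : {set X} | E \subset ~: S) g E).
Proof.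
rewrite big_distrlr /= pair_big /=.
rewrite [RHS](reindex_onto (fun E => (E :&: S, E :\: S)) (fun p => p.1 :|: p.2)) /=.
  apply: eq_bigl => E; rewrite subsetIr subsetDr setID eqxx //.
case=> E F /= /andP[/subsetP ES /subsetP FS]; congr pair; apply/setP => x.
  rewrite !inE; case xE: (x \in E) => /=; first by rewrite ES.
  by apply: contraTF isT => /andP[/FS]; rewrite inE => /negP.
rewrite !inE; case xF: (x \in F); first by have := FS _ xF; rewrite inE => ->; rewrite orbT.
by rewrite orbF; apply: contraTF isT => /andP[/negP nS /ES].
Qed.

Lemma prob_indep S A B :
  prob (fun E => A (E :&: S) && B (E :\: S)) =
  prob (fun E => A (E :&: S)) * prob (fun E => B (E :\: S)).
Proof.
pose w S' E := \prod_(x in S') (if x \in E then pr x else 1 - pr x).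
have wE E : bern E = w S (E :&: S) * w (~: S) (E :\: S).
  rewrite /bern (bigID (mem S)) /=; congr (_ * _).
    by apply: eq_bigr => x xS; rewrite inE xS andbT.
  rewrite /w (eq_bigl (mem (~: S))) => [|x]; last by rewrite !inE.
  by apply: eq_bigr => x; rewrite !inE => ->.
pose a (A : pred {set X}) := \sum_(E : {set X} | E \subset S) (A E)%:R * w S E.
pose b (B : pred {set X}) := \sum_(E : {set X} | E \subset ~: S) (B E)%:R * w (~: S) E.
have main A' B' : prob (fun E => A' (E :&: S) && B' (E :\: S)) = a A' * b B'.
  rewrite /a /b -sum_split /prob big_mkcond; apply: eq_bigr => E _.
  by rewrite wE; case: (A' _); case: (B' _) => /=; rewrite ?mul0r ?mul1r ?mulr0.
have hA : prob (fun E => A (E :&: S)) = a A * b predT.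
  by rewrite -main; apply: eq_prob => E; rewrite andbT.
have hB : prob (fun E => B (E :\: S)) = a predT * b B.
  by rewrite -main; apply: eq_prob.
have hT : a predT * b predT = 1 by rewrite -main -probT; apply: eq_prob.
by rewrite main hA hB -[LHS]mulr1 -hT; ring.
Qed.

Hypothesis pr01 : forall x, 0 <= pr x <= 1.

Lemma bern_ge0 E : 0 <= bern E.
Proof.
apply: prodr_ge0 => x _; have /andP[? ?] := pr01 x.
by case: ifP => _; rewrite ?subr_ge0.
Qed.

Lemma prob_ge0 A : 0 <= prob A.
Proof. by apply: sumr_ge0 => E _; apply: bern_ge0. Qed.

Lemma prob_le_weight A B : (forall E, bern E != 0 -> A E -> B E) ->
  prob A <= prob B.
Proof.
move=> AB; rewrite /prob big_mkcond [leRHS]big_mkcond; apply: ler_sum => E _.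
have [->|h] := eqVneq (bern E) 0; first by rewrite !if_same.
case: ifP => [/(AB _ h) ->//|_]; case: ifP => // _; exact: bern_ge0.
Qed.

Lemma prob_le A B : (forall E, A E -> B E) -> prob A <= prob B.
Proof. by move=> AB; apply: prob_le_weight => E _; apply: AB. Qed.

Lemma prob_le1 A : prob A <= 1.
Proof. by rewrite -probT; apply: prob_le. Qed.

Lemma prob_union (I : finType) (P : pred I) A (B : I -> pred {set X}) :
  (forall E, bern E != 0 -> A E -> exists2 i, P i & B i E) ->
  prob A <= \sum_(i | P i) prob (B i).
Proof.
move=> AB; rewrite /prob; under [leRHS]eq_bigr do rewrite big_mkcond /=.
rewrite exchange_big /= big_mkcond; apply: ler_sum => E _.
have h0 i : 0 <= (if B i E then bern E else 0) by case: ifP => // _; apply: bern_ge0.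
have [e0|h] := eqVneq (bern E) 0.
  by rewrite [leLHS](_ : _ = 0) ?e0 ?if_same //; apply: sumr_ge0 => i _; rewrite if_same.
case: ifP => [/(AB _ h)[i Pi Bi]|_]; last by apply: sumr_ge0.
by rewrite (bigD1 i) //= Bi lerDl sumr_ge0.
Qed.

Lemma probU A B C : (forall E, bern E != 0 -> A E -> B E \/ C E) ->
  prob A <= prob B + prob C.
Proof.
move=> AB; apply: le_trans (prob_union (P := predT)
  (B := fun b : bool => if b then B else C) _) _; last first.
  by rewrite big_bool.
by move=> E h /(AB _ h)[]; [exists true|exists false].
Qed.

Definition mean (g : {set X} -> R) := \sum_E bern E * g E.

Lemma prob_markov A (g : {set X} -> R) c : (forall E, 0 <= g E) ->
  (forall E, A E -> c <= g E) -> c * prob A <= mean g.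
Proof.
move=> g0 Ag; rewrite /prob mulr_sumr big_mkcond; apply: ler_sum => E _.
case: ifP => [/Ag h|_]; first by rewrite mulrC ler_wpM2l // bern_ge0.
by rewrite mulr_ge0 // bern_ge0.
Qed.

End RandomSubset.

(** * First moment estimates *)

Section Counting.
Variables (d : nat) (V : finType).
Local Open Scope nat_scope.
Implicit Types (U S : {set V}).

Definition touching U : {set {set V}} :=
  [set e : {set V} | (#|e| == d.+1) && ~~ [disjoint e & U]].

(** The number of potential edges on [n] vertices that meet a given set of [u]
    vertices. *)
Definition ntouching n u := 'C(n, d.+1) - 'C(n - u, d.+1).

Lemma card_touching U : #|touching U| = ntouching #|V| #|U|.
Proof.
rewrite /ntouching -card_draws -[X in 'C(X, _)](_ : #|~: U| = _); last first.
  by rewrite cardsCs setCK.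
rewrite -cards_draws -cardsDS.
  apply: eq_card => e; rewrite !inE disjoints_subset.
  by case: (_ == _); rewrite ?andbT ?andbF ?andTb.
by apply/subsetP => e; rewrite !inE => /andP[].
Qed.

Lemma cover_small S a : 0 < #|V| -> #|S| <= a ->
  exists g : {ffun 'I_a -> V}, S \subset g @: setT.
Proof.
case/card_gt0P => x0 _ Sa; exists [ffun i : 'I_a => nth x0 (enum S) i].
apply/subsetP => y yS.
have ia : index y (enum S) < a.
  by apply: leq_trans Sa; rewrite cardE index_mem mem_enum.
apply/imsetP; exists (Ordinal ia); rewrite ?ffunE //= nth_index //.
by rewrite mem_enum.
Qed.

(** [J] lives on [U] and at most [a] further vertices, and there are at most
    [2 ^ 2 ^ (#|U| + a)] families on a given choice of those. *)
Lemma card_near U a : 0 < #|V| ->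
  #|[set J : {set {set V}} | #|cover J :\: U| <= a]| <=
    #|V| ^ a * 2 ^ (2 ^ (#|U| + a)).
Proof.
move=> V0; pose B (g : {ffun 'I_a -> V}) := powerset (powerset (U :|: g @: setT)).
apply: (@leq_trans #|\bigcup_g B g|).
  apply: subset_leq_card; apply/subsetP => J; rewrite inE => /(cover_small V0)[g sg].
  apply/bigcupP; exists g => //; rewrite inE; apply/subsetP => e eJ.
  rewrite inE; apply/subsetP => y ye; rewrite in_setU.
  have [//|yU] := boolP (y \in U); apply: (subsetP sg).
  by rewrite inE yU; apply/coverP; exists e.
have cB g : #|B g| <= 2 ^ (2 ^ (#|U| + a)).
  rewrite !card_powerset !leq_exp2l // (leq_trans (leq_card_setU _ _)) //.
  rewrite leq_add2l; apply: leq_trans (leq_imset_card _ _) _.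
  by rewrite cardsT card_ord.
apply: (@leq_trans (\sum_(g : {ffun 'I_a -> V}) 2 ^ (2 ^ (#|U| + a)))).
  elim/big_rec2: _ => [|g m A _ IH]; first by rewrite cards0.
  by rewrite (leq_trans (leq_card_setU _ _)) // leq_add.
by rewrite sum_nat_const card_ffun card_ord.
Qed.

End Counting.

Section Estimates.
Variables (R : realType) (d : nat) (V : finType) (p : R).
Hypothesis p01 : 0 <= p <= 1.
Implicit Types (E F Y J : {set {set V}}) (U : {set V}).

Definition edge_pr (e : {set V}) : R := if #|e| == d.+1 then p else 0.
Local Notation P := (prob edge_pr).
Local Notation n := #|V|.

Let p0 : 0 <= p. Proof. by case/andP: p01. Qed.
Let p1 : p <= 1. Proof. by case/andP: p01. Qed.

Lemma edge_pr01 e : 0 <= edge_pr e <= 1.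
Proof. by rewrite /edge_pr; case: ifP; rewrite ?lexx ?ler01. Qed.

Lemma bern_uniform E : bern edge_pr E != 0 -> uniform d E.
Proof.
apply: contraNT => /subsetPn[e eE]; rewrite inE => ce.
by rewrite /bern (bigD1 e) //= eE /edge_pr (negPf ce) mul0r.
Qed.

Lemma prob_edges Y Q : uniform d Y -> uniform d Q -> [disjoint Y & Q] ->
  P (fun E => (Y \subset E) && [disjoint E & Q]) = p ^+ #|Y| * (1 - p) ^+ #|Q|.
Proof.
move=> uY uQ dis; rewrite prob_pattern // -!prodr_const; congr (_ * _);
  apply: eq_bigr => e eY; rewrite /edge_pr ifT //.
  by rewrite (uniform_card uY).
by rewrite (uniform_card uQ).
Qed.

Lemma prob_contains Y : P (fun E => Y \subset E) <= p ^+ #|Y|.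
Proof.
rewrite (@eq_prob _ _ _ _ (fun E => (Y \subset E) && [disjoint E & set0])).
  rewrite prob_pattern; last by rewrite disjoint_sym disjoints_subset sub0set.
  rewrite big_set0 mulr1 -prodr_const; apply: ler_prod => e _.
  by rewrite /edge_pr; case: ifP; rewrite ?p0 ?lexx.
by move=> E; rewrite [X in _ && X](_ : _ = true) ?andbT // disjoint_sym disjoints_subset sub0set.
Qed.

Lemma prob_contains_some (S : {set {set {set V}}}) j :
  (forall J, J \in S -> #|J| = j) ->
  P (fun E => [exists J in S, J \subset E]) <= #|S|%:R * p ^+ j.
Proof.
move=> Sj; apply: le_trans (prob_union edge_pr01 (P := fun J => J \in S)
  (B := fun J E => J \subset E) _) _.
  by move=> E _ /exists_inP[J]; exists J.
rewrite mulr_natl -sumr_const; apply: ler_sum => J JS.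
by rewrite -(Sj _ JS) prob_contains.
Qed.

(** A bound for the expected number of rare families near a set of [u] vertices;
    every term is of the order of [n ^ (d * j.+1).-1 * p ^ j.+1], hence of [1 / n]. *)
Definition rare_bound N u : R :=
  \sum_(j < N) (n ^ (d * j.+1).-1 * 2 ^ (2 ^ (u + (d * j.+1).-1)))%:R * p ^+ j.+1.

Lemma prob_rare N U : (0 < d)%N -> (0 < n)%N ->
  P (rare_near d N U) <= rare_bound N #|U|.
Proof.
move=> d0 n0.
pose S (j : 'I_N) := [set J : {set {set V}} |
  (#|J| == j.+1) && (#|cover J :\: U| <= (d * j.+1).-1)%N].
apply: le_trans (prob_union edge_pr01 (P := predT)
  (B := fun j E => [exists J in S j, J \subset E]) _) _.
  move=> E _ /existsP[J /and3P[JE /andP[J0 JN] sJ]].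
  have lt : (#|J|.-1 < N)%N by rewrite prednK.
  exists (Ordinal lt) => //; apply/exists_inP; exists J => //.
  by rewrite inE /= prednK // eqxx /= -ltnS prednK // muln_gt0 d0.
apply: ler_sum => j _; apply: le_trans (prob_contains_some (j := j.+1) _) _.
  by move=> J; rewrite inE => /andP[/eqP].
apply: ler_wpM2r; first exact: exprn_ge0.
rewrite ler_nat; apply: leq_trans (card_near U _ n0).
by apply: subset_leq_card; apply/subsetP => J; rewrite !inE => /andP[].
Qed.

Definition core_bound N : R :=
  \sum_(j < N.+1) (d * j)%:R * ((n ^ (d * j) * 2 ^ (2 ^ (d * j)))%:R * p ^+ j).

(** Markov's inequality. The expected size of the core is bounded because a dense
    family with [j] edges has of the order of [n ^ (d * j)] positions, each of
    probability [p ^ j]. *)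
Lemma prob_large_core N K : (0 < n)%N ->
  K%:R * P (fun E => (K <= #|cover (dcore d N E)|)%N) <= core_bound N.
Proof.
move=> n0.
pose S (j : 'I_N.+1) := [set F : {set {set V}} |
  (#|F| == j) && (#|cover F :\: set0| <= d * j)%N].
pose g E : R := \sum_(j < N.+1) \sum_(F in S j) (d * j)%:R * (F \subset E)%:R.
apply: le_trans (prob_markov edge_pr01 (g := g) _ _) _.
- by move=> E; do 2!apply: sumr_ge0 => ? _; rewrite mulr_ge0 ?ler0n.
- move=> E KE; apply: le_trans (_ : #|cover (dcore d N E)|%:R <= _).
    by rewrite ler_nat.
  pose B F := [&& F \subset E, #|F| <= N & edense d F]%N.
  have h1 : (#|cover (dcore d N E)| <= \sum_(F : {set {set V}} | B F) #|cover F|)%N.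
    apply: (@leq_trans #|\bigcup_(F : {set {set V}} | B F) cover F|).
      apply: subset_leq_card; apply/subsetP => x /coverP[e /dcoreP[F [sF cF dF eF]] xe].
      by apply/bigcupP; exists F; [apply/and3P|apply/coverP; exists e].
    elim/big_rec2: _ => [|F m A _ IH]; first by rewrite cards0.
    by rewrite (leq_trans (leq_card_setU _ _)) // leq_add2l.
  apply: le_trans (_ : (\sum_(F : {set {set V}} | B F) #|cover F|)%:R <= _).
    by rewrite ler_nat.
  rewrite natr_sum /g (exchange_big_dep predT) //= big_mkcond; apply: ler_sum => F _.
  have h0 (j : 'I_N.+1) : (F \in S j) -> 0 <= (d * j)%:R * (F \subset E)%:R :> R.
    by move=> _; rewrite mulr_ge0 ?ler0n.
  case: ifPn => [/and3P[sF cF dF]|_]; last exact: sumr_ge0.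
  have lt : (#|F| < N.+1)%N by [].
  rewrite (bigD1 (Ordinal lt)) /=; last by rewrite inE /= eqxx setD0.
  by rewrite sF mulr1 ler_wpDr ?ler_nat // sumr_ge0 // => j /andP[/h0].
rewrite /mean /core_bound.
under eq_bigr do rewrite /g mulr_sumr.
rewrite exchange_big /=; apply: ler_sum => j _.
under eq_bigr do rewrite mulr_sumr.
rewrite exchange_big /=.
apply: le_trans (_ : \sum_(F in S j) (d * j)%:R * p ^+ j <= _).
  apply: ler_sum => F; rewrite inE => /andP[/eqP cF _].
  apply: le_trans (_ : (d * j)%:R * P (fun E => F \subset E) <= _).
    rewrite /prob mulr_sumr [leRHS]big_mkcond; apply: ler_sum => E _.
    case: ifP => _; last by rewrite !mulr0.
    by rewrite mulr1 mulrC.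
  by apply: ler_wpM2l; rewrite ?ler0n // -cF prob_contains.
rewrite sumr_const -[leLHS]mulr_natl mulrCA; apply: ler_wpM2l; first exact: ler0n.
apply: ler_wpM2r; first exact: exprn_ge0.
rewrite ler_nat; have := card_near (set0 : {set V}) (d * j) n0; rewrite cards0 add0n.
by apply: leq_trans; apply: subset_leq_card; apply/subsetP => J; rewrite !inE => /andP[].
Qed.

End Estimates.

(** * The law of the dense core; copies of trees *)

Lemma Pr_random_hypergraphE (R : realType) d n (p : R) (A : pred (hypergraph d n)) :
  Pr_random_hypergraph p A =
  prob (edge_pr d p) (fun E : {set {set 'I_n}} => if insub E is Some H then A H else false).
Proof.
rewrite /prob (reindex_omap (@edges d n) insub) /=; last first.
  by move=> E; case: insubP => // H _ <- _.
apply: eq_big => [H|H _].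
  by rewrite valK eqxx andbT.
rewrite /random_hypergraph_weight /bern [RHS](bigID (mem (potential_edges d n))) /=.
rewrite [X in _ = _ * X]big1 ?mulr1 => [|e].
  by apply: eq_bigr => e; rewrite inE /edge_pr => ->.
move=> eK; rewrite (negPf (contra (subsetP (edges_uniform H) e) eK)).
by move: eK; rewrite inE /edge_pr => /negPf ->; rewrite subr0.
Qed.

Section CoreProbability.
Variables (R : realType) (d : nat) (V : finType) (p : R).
Hypothesis p01 : 0 <= p <= 1.
Implicit Types (E F Y J : {set {set V}}) (U : {set V}).
Local Notation P := (prob (edge_pr d p)).
Local Notation n := #|V|.

Let p0 : 0 <= p. Proof. by case/andP: p01. Qed.
Let p1 : p <= 1. Proof. by case/andP: p01. Qed.
Let pr01 := @edge_pr01 R d V p p01.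

Definition coreless N : R := P (fun E => dcore d N E == set0).

(** The three requirements of [core_like] concern disjoint sets of edges, which
    are independent, and up to rare families the last one has the probability
    that the whole hypergraph has no core. *)
Lemma prob_core N Y : uniform d Y ->
  (forall F, F \subset Y -> (d * #|F| <= #|cover F|)%N) -> dcore d N.+1 Y = Y ->
  `|P (fun E => dcore d N.+1 E == Y) -
    p ^+ #|Y| * (1 - p) ^+ #|touching d (cover (dcore d N Y)) :\: Y| * coreless N.+1|
    <= p ^+ #|Y| * (P (rare_near d N.+1 (cover Y)) + P (rare_near d N.+1 (cover Y))).
Proof.
move=> uY sp coreY; set Q := _ :\: Y; set U := cover Y.
set q := #|Q|; set rho := P (rare_near _ _ _).
have uQ : uniform d Q.
  by apply/subsetP => e; rewrite !inE => /andP[_ /andP[]].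
have dYQ : [disjoint Y & Q].
  by apply: contraT => /touchP[e eY]; rewrite inE eY.
have out_meet e : e \in Y :|: Q -> ~~ [disjoint e & U].
  rewrite inE => /orP[eY|].
    have [y ye] := uniform_neq0 uY eY; apply/touchP; exists y => //.
    by apply/coverP; exists e.
  rewrite !inE => /andP[_ /andP[_ /touchP[y ye yI]]]; apply/touchP; exists y => //.
  exact: (subsetP (coverS (dcore_sub _ _ _))) yI.
pose out E := [set e in E | [disjoint e & U]].
pose Zout := P (fun E => dcore d N.+1 (out E) == set0).
have outD E : out (E :\: (Y :|: Q)) = out E.
  apply/setP => e; rewrite !inE; case dis: [disjoint e & U]; rewrite ?andbF ?andbT //.
  have := contraTN (@out_meet e) dis; rewrite !inE => -> //.
have likeE : P (core_like d N Y) = p ^+ #|Y| * (1 - p) ^+ q * Zout.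
  rewrite -(@prob_edges R d V p Y Q uY uQ dYQ).
  transitivity (P (fun E => [&& Y \subset E :&: (Y :|: Q), [disjoint E :&: (Y :|: Q) & Q] &
      dcore d N.+1 (out (E :\: (Y :|: Q))) == set0])).
    apply/le_anti/andP; split; apply: prob_le_weight => // E /bern_uniform uE.
      case/and3P => YE /forall_inP notouch; rewrite -/(out E) => oE.
      rewrite outD oE andbT; apply/andP; split.
        by rewrite subsetI YE subsetUl.
      apply: contraT => /touchP[e]; rewrite !inE => /andP[eE _] /andP[eY /andP[_ ne]].
      by have := implyP (notouch _ eE) ne; rewrite (negPf eY).
    rewrite outD => /and3P[YE dis oE]; apply/and3P; split=> //.
      by apply: subset_trans YE (subsetIl _ _).
    apply/forall_inP => e eE; apply/implyP => ne; apply: contraT => eY.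
    have eQ : e \in Q by rewrite !inE eY ne (uniform_card uE eE) eqxx.
    by have := disjointFl dis eQ; rewrite !inE eE; move: eQ; rewrite !inE => ->; rewrite orbT.
  have := @prob_indep _ _ (edge_pr d p) (Y :|: Q)
    (fun E => (Y \subset E) && [disjoint E & Q]) (fun E => dcore d N.+1 (out E) == set0).
  rewrite (_ : P _ = P (fun E => [&& Y \subset E :&: (Y :|: Q),
      [disjoint E :&: (Y :|: Q) & Q] & dcore d N.+1 (out (E :\: (Y :|: Q))) == set0]));
    last by apply: eq_prob => E; rewrite andbA.
  move=> ->; congr (_ * _); apply: eq_prob => E; last by rewrite outD.
  rewrite subsetI subsetUl andbT; congr (_ && _).
  rewrite -!setI_eq0 -setIA; congr (_ :&: _ == _).
  by apply/setIidPr/subsetUr.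
have Zlow : coreless N.+1 <= Zout.
  apply: prob_le => // E /eqP cE; rewrite -subset0 -cE; apply: dcoreS.
  by apply/subsetP => e; rewrite inE => /andP[].
have Zhigh : Zout <= coreless N.+1 + rho.
  apply: probU => // E /bern_uniform uE /eqP oE.
  by have [->|] := dcore_out uE oE; [left|right].
have low : P (fun E => dcore d N.+1 E == Y) <= P (core_like d N Y).
  by apply: prob_le_weight => // E /bern_uniform uE /eqP; apply: dcore_is_core_like.
have high : P (core_like d N Y) <=
    P (fun E => dcore d N.+1 E == Y) + p ^+ #|Y| * rho.
  apply: le_trans (_ : _ <= P (fun E => dcore d N.+1 E == Y) +
    P (fun E => (Y \subset E :&: Y) && rare_near d N.+1 U (E :\: Y))) _.
    apply: probU => // E /bern_uniform uE cl.
    have [->|r] := core_like_dcore uE sp coreY cl; first by left.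
    by right; rewrite r subsetI subxx; case/and3P: cl => ->.
  rewrite lerD2l (@prob_indep _ _ (edge_pr d p) Y (fun F => Y \subset F)
    (rare_near d N.+1 U)).
  apply: ler_pM; try exact: prob_ge0.
    apply: le_trans (prob_contains d p01 Y); apply: prob_le => // E.
    by move/subset_trans; apply; apply: subsetIl.
  by apply: prob_le => // E; apply: rare_nearS; apply: subsetDl.
have a0 : 0 <= p ^+ #|Y| by apply: exprn_ge0.
have b0 : 0 <= (1 - p) ^+ q by apply: exprn_ge0; rewrite subr_ge0.
have b1 : (1 - p) ^+ q <= 1 by apply: exprn_ile1; rewrite ?subr_ge0 // gerBl.
have rho0 : 0 <= rho by exact: prob_ge0.
rewrite {}likeE in low high.
set a := p ^+ _ in low high a0 *; set b := (1 - p) ^+ _ in low high b0 b1 *.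
have h1 : a * b * coreless N.+1 <= a * b * Zout by rewrite ler_wpM2l // mulr_ge0.
have h2 : a * b * Zout <= a * b * (coreless N.+1 + rho) by rewrite ler_wpM2l // mulr_ge0.
have h3 : a * (b * rho) <= a * rho by rewrite ler_wpM2l // ler_piMl.
rewrite mulrDr mulrA in h2 h3 *; rewrite ler_norml; apply/andP; split; lra.
Qed.

End CoreProbability.

Section Copies.
Variables (R : realType) (d : nat) (V : finType) (p : R) (T : tree d).
Hypothesis p01 : 0 <= p < 1.
Implicit Types (E F : {set {set V}}).
Local Notation P := (prob (edge_pr d p)).
Local Notation n := #|V|.
Local Notation t := (order T).
Local Notation emb := {ffun 'I_t -> V}.

Let p0 : 0 <= p. Proof. by case/andP: p01. Qed.
Let p1 : p < 1. Proof. by case/andP: p01. Qed.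
Let p01' : 0 <= p <= 1. Proof. by rewrite p0 ltW. Qed.
Let pr01 := @edge_pr01 R d V p p01'.

(** The probability that no edge meets a given set of [u] vertices. *)
Definition absent u : R := (1 - p) ^+ ntouching d n u.

Lemma prob_component F U : uniform d F -> F \subset touching d U ->
  P (fun E => [set e in E | ~~ [disjoint e & U]] == F) =
  p ^+ #|F| * (absent #|U| / (1 - p) ^+ #|F|).
Proof.
move=> uF sF; have c1 : (1 - p) ^+ #|F| != 0 by rewrite expf_neq0 // subr_eq0 gt_eqF.
have -> : absent #|U| / (1 - p) ^+ #|F| = (1 - p) ^+ #|touching d U :\: F|.
  apply: (canLR (mulfK c1)).
  rewrite /absent -card_touching -exprD; congr (_ ^+ _).
  by rewrite cardsDS // subnK // subset_leq_card.
have uQ : uniform d (touching d U :\: F).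
  by apply/subsetP => e; rewrite !inE => /andP[_ /andP[]].
have dis0 : [disjoint F & touching d U :\: F].
  by apply: contraT => /touchP[e eF]; rewrite inE eF.
rewrite -(@prob_edges R d V p _ _ uF uQ dis0).
apply/le_anti/andP; split; apply: prob_le_weight => // E /bern_uniform uE.
    move/eqP => eF; apply/andP; split.
      by rewrite -eF; apply/subsetP => e; rewrite inE => /andP[].
    apply: contraT => /touchP[e eE]; rewrite -eF !inE eE /=.
    by case/andP => /negP nd /andP[_ /nd].
  case/andP => FE dis; apply/eqP/setP => e; rewrite inE; apply/andP/idP => [[eE ne]|eF].
    apply: contraT => eF; have := disjointFr dis eE.
    by rewrite !inE eF ne (uniform_card uE eE) eqxx.
by split; [apply: (subsetP FE)|have := subsetP sF _ eF; rewrite inE => /andP[]].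
Qed.

Definition copy_mean : R :=
  (n ^_ t)%:R * (p ^+ #|tedges T| * (absent t / (1 - p) ^+ #|tedges T|)).

Lemma emap_touching (f : emb) : injective f -> emap f (tedges T) \subset touching d (f @: setT).
Proof.
move=> injf; apply/subsetP => _ /imsetP[e eT ->]; rewrite inE card_imset //.
rewrite (uniform_card (tree_uniform T) eT) eqxx /=.
have [x xe] := uniform_neq0 (tree_uniform T) eT.
by apply/touchP; exists (f x); apply: imset_f.
Qed.

Lemma prob_copy (f : emb) : injectiveb f ->
  P (fun E => f \in copies T E) =
  p ^+ #|tedges T| * (absent t / (1 - p) ^+ #|tedges T|).
Proof.
move=> fb; have injf := injectiveP _ fb.
rewrite (@eq_prob _ _ _ _ (fun E => [set e in E | ~~ [disjoint e & f @: setT]] ==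
  emap f (tedges T))); last by move=> E; rewrite inE fb.
rewrite prob_component ?emap_touching ?uniform_emap ?tree_uniform //.
by rewrite card_emap // card_imset // cardsT card_ord.
Qed.

Lemma prob_two_copies (f g : emb) : injectiveb f -> injectiveb g ->
  [disjoint f @: setT & g @: setT] ->
  P (fun E => (f \in copies T E) && (g \in copies T E)) <=
  (p ^+ #|tedges T|) ^+ 2 * (absent (t + t) / ((1 - p) ^+ #|tedges T|) ^+ 2).
Proof.
move=> fb gb dis; have injf := injectiveP _ fb; have injg := injectiveP _ gb.
pose F := emap f (tedges T) :|: emap g (tedges T).
have sf := emap_touching injf; have sg := emap_touching injg.
have disF : [disjoint emap f (tedges T) & emap g (tedges T)].
  apply: contraT => /touchP[e /imsetP[a aT ea] /imsetP[b _ eb]].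
  have [x xa] := uniform_neq0 (tree_uniform T) aT.
  have fx : f x \in e by rewrite ea imset_f.
  have := disjointFr dis (imset_f f (in_setT x)).
  by move: fx; rewrite eb => /imsetP[z _ ->]; rewrite imset_f.
have cF : #|F| = (#|tedges T| + #|tedges T|)%N.
  rewrite cardsU (card_emap injf) (card_emap injg).
  by move: disF; rewrite -setI_eq0 => /eqP ->; rewrite cards0 subn0.
have cU : #|f @: setT :|: g @: setT| = (t + t)%N.
  rewrite cardsU !card_imset // cardsT card_ord.
  by move: dis; rewrite -setI_eq0 => /eqP ->; rewrite cards0 subn0.
have := @prob_component F (f @: setT :|: g @: setT) _ _.
rewrite cF cU !exprD -!expr2 => <-.
- apply: prob_le => // E; rewrite !inE fb gb /= => /andP[/eqP ef /eqP eg].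
  apply/eqP; rewrite /F -ef -eg; apply/setP => e; rewrite !inE -andb_orr.
  by congr (_ && _); rewrite -!setI_eq0 setIUr setU_eq0 negb_and.
- by rewrite /uniform subUset; apply/andP; split;
    rewrite -/(uniform d _) uniform_emap // tree_uniform.
rewrite subUset; apply/andP; split.
  apply: subset_trans sf _; apply/subsetP => e; rewrite !inE => /andP[-> /touchP[y ye yf]].
  by apply/touchP; exists y; rewrite ?inE ?yf.
apply: subset_trans sg _; apply/subsetP => e; rewrite !inE => /andP[-> /touchP[y ye yf]].
by apply/touchP; exists y; rewrite ?inE ?yf ?orbT.
Qed.

Lemma card_copies E : #|copies T E|%:R =
  \sum_(f : emb | injectiveb f) (f \in copies T E)%:R :> R.
Proof.
rewrite -sum1_card natr_sum big_mkcond [RHS]big_mkcond; apply: eq_bigr => f _.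
by rewrite !inE; case: (injectiveb f) => //=; case: (_ == _).
Qed.

Lemma card_injective : #|[pred f : emb | injectiveb f]| = n ^_ t.
Proof. by rewrite -[t in RHS]card_ord -card_inj_ffuns cardsE. Qed.

Lemma mean_copies : mean (edge_pr d p) (fun E => #|copies T E|%:R) = copy_mean.
Proof.
rewrite /mean; under eq_bigr do rewrite card_copies mulr_sumr.
rewrite exchange_big /= /copy_mean -card_injective mulr_natl -sumr_const.
apply: eq_bigr => f fb; rewrite -(prob_copy fb) /prob [RHS]big_mkcond.
by apply: eq_bigr => E _; case: ifP; rewrite ?mulr1 ?mulr0.
Qed.

(** The correlation between two disjoint copies: the edges that meet both of
    them are excluded only once. *)
Definition pair_factor : R := absent (t + t) / absent t ^+ 2.

Lemma absent_neq0 u : absent u != 0.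
Proof. by rewrite expf_neq0 // subr_eq0 gt_eqF. Qed.

(** Pairs of copies with disjoint images are almost independent, and the copies
    meeting a given one are among its reparametrizations. *)
Lemma mean_copies_sqr :
  mean (edge_pr d p) (fun E => #|copies T E|%:R ^+ 2) <=
  (t ^ t)%:R * copy_mean + copy_mean ^+ 2 * pair_factor.
Proof.
pose q (f g : emb) := P (fun E => (f \in copies T E) && (g \in copies T E)).
pose b : R := (p ^+ #|tedges T|) ^+ 2 * (absent (t + t) / ((1 - p) ^+ #|tedges T|) ^+ 2).
have q0 f g : 0 <= q f g by exact: prob_ge0.
have b0 : 0 <= b.
  have r0 k : 0 <= (1 - p) ^+ k by rewrite exprn_ge0 // subr_ge0 ltW.
  apply: mulr_ge0; first by do 2!apply: exprn_ge0.
  by apply: divr_ge0; [exact: r0|apply: exprn_ge0; exact: r0].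
have -> : mean (edge_pr d p) (fun E => #|copies T E|%:R ^+ 2) =
    \sum_(f : emb | injectiveb f) \sum_(g : emb | injectiveb g) q f g.
  rewrite /mean /q /prob.
  under [RHS]eq_bigr do (under eq_bigr do rewrite big_mkcond; rewrite exchange_big).
  rewrite [RHS]exchange_big; apply: eq_bigr => E _ /=.
  rewrite expr2 card_copies big_distrlr mulr_sumr /=; apply: eq_bigr => f _.
  rewrite mulr_sumr; apply: eq_bigr => g _.
  by case: (f \in _); case: (g \in _); rewrite ?mulr1 ?mulr0 ?mul0r.
have -> : copy_mean ^+ 2 * pair_factor = \sum_(f : emb | injectiveb f) (n ^_ t)%:R * b.
  rewrite sumr_const card_injective -[RHS]mulr_natl /copy_mean /pair_factor /b.
  have := absent_neq0 t; have : (1 - p) ^+ #|tedges T| != 0.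
    by rewrite expf_neq0 // subr_eq0 gt_eqF.
  move: (absent t) (absent (t + t)) ((1 - p) ^+ _) (p ^+ _) (_%:R) => a a2 c x m c0 a0.
  by field; rewrite c0 a0.
rewrite -mean_copies /mean; under [in leRHS]eq_bigr do rewrite card_copies mulr_sumr.
rewrite [X in _ * X]exchange_big /= mulr_sumr -big_split /=; apply: ler_sum => f fb.
have injf := injectiveP _ fb.
rewrite (bigID (fun g : emb => [disjoint f @: setT & g @: setT])) /= addrC; apply: lerD.
  have -> : \sum_E bern (edge_pr d p) E * (f \in copies T E)%:R = P (fun E => f \in copies T E).
    by rewrite /prob [RHS]big_mkcond; apply: eq_bigr => E _; case: ifP; rewrite ?mulr1 ?mulr0.
  apply: le_trans (_ : \sum_(g : emb | g \in ffun_on (mem (f @: setT)))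
     P (fun E => f \in copies T E) <= _); last first.
    by rewrite sumr_const card_ffun_on card_imset // cardsT card_ord mulr_natl.
  rewrite big_mkcond [leRHS]big_mkcond; apply: ler_sum => g _.
  case: ifPn => [/andP[gb meet]|_]; last by case: ifP => // _; apply: prob_ge0.
  case: ifPn => [_|out]; first by apply: prob_le => // E /andP[].
  have <- : P (fun _ : {set {set V}} => false) = 0 by apply: big_pred0.
  apply: (prob_le_weight pr01) => E /bern_uniform uE /andP[cf cg].
  case/negP: out; apply/ffun_onP => i; have /touchP[y yf yg] := meet.
  by rewrite (copies_same uE cf cg yf yg) imset_f.
rewrite -card_injective mulr_natl -sumr_const big_mkcond [leRHS]big_mkcond.
apply: ler_sum => g _; rewrite inE; case: (boolP (injectiveb g)) => //= gb.
by case: ifP => // dis; apply: prob_two_copies.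
Qed.

(** Chebyshev's inequality. *)
Lemma prob_few_copies s : s%:R <= copy_mean ->
  (copy_mean - s%:R) ^+ 2 * P (fun E => (#|copies T E| <= s)%N) <=
  (t ^ t)%:R * copy_mean + copy_mean ^+ 2 * (pair_factor - 1).
Proof.
move=> sm; apply: le_trans (prob_markov pr01
  (g := fun E => (#|copies T E|%:R - copy_mean) ^+ 2) _ _) _.
- by move=> E; apply: sqr_ge0.
- move=> E le; have leR : #|copies T E|%:R <= s%:R :> R by rewrite ler_nat.
  by rewrite -[leRHS]sqrrN opprB ler_pXn2r ?nnegrE ?subr_ge0 //; lra.
have -> : mean (edge_pr d p) (fun E => (#|copies T E|%:R - copy_mean) ^+ 2) =
    mean (edge_pr d p) (fun E => #|copies T E|%:R ^+ 2) - copy_mean ^+ 2.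
  have e1 : \sum_(E : {set {set V}}) bern (edge_pr d p) E = 1 := probT _.
  have e2 : \sum_(E : {set {set V}}) bern (edge_pr d p) E * #|copies T E|%:R = copy_mean.
    exact: mean_copies.
  transitivity (mean (edge_pr d p) (fun E => #|copies T E|%:R ^+ 2)
    - copy_mean * 2 * (\sum_(E : {set {set V}}) bern (edge_pr d p) E * #|copies T E|%:R)
    + copy_mean ^+ 2 * \sum_(E : {set {set V}}) bern (edge_pr d p) E).
    rewrite /mean !mulr_sumr -sumrB -big_split /=; apply: eq_bigr => E _; ring.
  by rewrite e1 e2; ring.
by have := mean_copies_sqr; lra.
Qed.

End Copies.

(** * Limits of sequences *)

Section Sequences.
Variable R : realType.
Implicit Types (u v w : nat -> R) (a b : R).

(** Sealed in an inductive type, so that statements about limits are not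
    unfolded to inclusions of filters. *)
Variant tends u a : Prop := Tends of (u @ \oo --> a)%classic.

Lemma tendsP u a : tends u a <->
  forall e : R, 0 < e -> exists N, forall n, (N <= n)%N -> `|u n - a| <= e.
Proof.
split=> [[/cvgrPdist_le h] e e0|h].
  have [N _ hN] := h _ e0; exists N => n Nn; rewrite distrC; exact: hN.
split; apply/cvgrPdist_le => e e0; have [N hN] := h _ e0.
by exists N => // n Nn; rewrite distrC; apply: hN.
Qed.

Lemma tends_eq N u v a : tends u a -> (forall n, (N <= n)%N -> u n = v n) -> tends v a.
Proof.
move=> /tendsP h uv; apply/tendsP => e /h[M hM]; exists (maxn M N) => n.
by rewrite geq_max => /andP[Mn Nn]; rewrite -uv // hM.
Qed.

Lemma tends_squeeze N u v w a : (forall n, (N <= n)%N -> u n <= v n <= w n) ->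
  tends u a -> tends w a -> tends v a.
Proof.
move=> uvw [hu] [hw]; split; apply: squeeze_cvgr hu hw; exists N => // n Nn; exact: uvw.
Qed.

Lemma tends_cst a : tends (fun=> a) a.
Proof. by split; apply: cvg_cst. Qed.

Lemma tendsD u v a b : tends u a -> tends v b -> tends (fun n => u n + v n) (a + b).
Proof. by move=> [hu] [hv]; split; apply: cvgD. Qed.

Lemma tendsB u v a b : tends u a -> tends v b -> tends (fun n => u n - v n) (a - b).
Proof. by move=> [hu] [hv]; split; apply: cvgB. Qed.

Lemma tendsM u v a b : tends u a -> tends v b -> tends (fun n => u n * v n) (a * b).
Proof. by move=> [hu] [hv]; split; apply: cvgM. Qed.

Lemma tendsV u a : a != 0 -> tends u a -> tends (fun n => (u n)^-1) a^-1.
Proof. by move=> a0 [hu]; split; apply: cvgV. Qed.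

Lemma tendsX u a k : tends u a -> tends (fun n => u n ^+ k) (a ^+ k).
Proof.
move=> ua; elim: k => [|k IH].
  by rewrite expr0; apply: (@tends_eq 0 _ _ _ (tends_cst (1 : R))) => n _; rewrite expr0.
rewrite exprS; apply: (@tends_eq 0 _ _ _ (tendsM ua IH)); first by move=> n _; rewrite exprS.
Qed.

Lemma tends_sum (I : Type) (r : seq I) (Q : pred I) (u : I -> nat -> R) (a : I -> R) :
  (forall i, Q i -> tends (u i) (a i)) ->
  tends (fun n => \sum_(i <- r | Q i) u i n) (\sum_(i <- r | Q i) a i).
Proof.
move=> h; elim: r => [|i r IH].
  rewrite big_nil; apply: (@tends_eq 0 _ _ _ (tends_cst (0 : R))); first by move=> n _; rewrite big_nil.
rewrite big_cons; case: ifP => Qi; last first.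
  by apply: (@tends_eq 0 _ _ _ IH); first by move=> n _; rewrite big_cons Qi.
by apply: (@tends_eq 0 _ _ _ (tendsD (h _ Qi) IH)); first by move=> n _; rewrite big_cons Qi.
Qed.

Lemma tends_prod (I : Type) (r : seq I) (u : I -> nat -> R) (a : I -> R) :
  (forall i, tends (u i) (a i)) ->
  tends (fun n => \prod_(i <- r) u i n) (\prod_(i <- r) a i).
Proof.
move=> h; elim: r => [|i r IH].
  rewrite big_nil; apply: (@tends_eq 0 _ _ _ (tends_cst (1 : R))); first by move=> n _; rewrite big_nil.
rewrite big_cons.
by apply: (@tends_eq 0 _ _ _ (tendsM (h i) IH)); first by move=> n _; rewrite big_cons.
Qed.

Lemma tends_invn : tends (fun n => n%:R^-1) 0.
Proof.
apply/tendsP => e e0; have /tendsP/(_ _ e0)[N hN] : tends harmonic 0 by split; apply: cvg_harmonic.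
exists N.+1 => -[//|n]; rewrite ltnS => Nn; exact: hN.
Qed.

Lemma tends_expR u a : tends u a -> tends (fun n => expR (u n)) (expR a).
Proof. by move=> [hu]; split; apply: continuous_cvg hu; apply: continuous_expR. Qed.

Lemma tends_gt a b u : b < a -> tends u a -> exists N, forall n, (N <= n)%N -> b < u n.
Proof.
move=> ba /tendsP/(_ ((a - b) / 2))[|N hN]; first by rewrite divr_gt0 // subr_gt0.
by exists N => n /hN; rewrite ler_norml => /andP[h2 h3]; lra.
Qed.

Lemma tends_lt a b u : a < b -> tends u a -> exists N, forall n, (N <= n)%N -> u n < b.
Proof.
move=> ba /tendsP/(_ ((b - a) / 2))[|N hN]; first by rewrite divr_gt0 // subr_gt0.
by exists N => n /hN; rewrite ler_norml => /andP[h2 h3]; lra.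
Qed.

Lemma tends_shift k : tends (fun n => (n - k)%:R / n%:R) 1.
Proof.
have := tendsB (tends_cst (1 : R)) (tendsM (tends_cst k%:R) tends_invn).
rewrite mulr0 subr0; move=> h; apply: (@tends_eq k.+1 _ _ _ h) => n kn.
have n0 : n%:R != 0 :> R by rewrite pnatr_eq0; lia.
by rewrite natrB ?(ltnW kn) // mulrBl divff.
Qed.

Lemma tends_ffact k j : tends (fun n => ((n - k) ^_ j)%:R / n%:R ^+ j) 1.
Proof.
have h (i : 'I_j) : tends (fun n => (n - (k + i))%:R / n%:R) 1 by exact: tends_shift.
have := @tends_prod 'I_j (index_enum _) _ _ h; rewrite big1 //.
move=> hp; apply: (@tends_eq 0 _ _ _ hp) => n _; rewrite prodf_div; congr (_ / _).
  by rewrite ffact_prod natr_prod; apply: eq_bigr => i _; rewrite subnDA.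
by rewrite prodr_const card_ord.
Qed.

Lemma tends_bin k j : tends (fun n => 'C(n - k, j)%:R / n%:R ^+ j) (j`!%:R)^-1.
Proof.
have := tendsM (tends_cst (j`!%:R)^-1) (tends_ffact k j); rewrite mulr1.
move=> hp; apply: (@tends_eq 0 _ _ _ hp) => n _; rewrite -bin_ffact natrM.
have f0 : j`!%:R != 0 :> R by rewrite pnatr_eq0 -lt0n fact_gt0.
by rewrite mulrA [_ * j`!%:R]mulrC mulKf.
Qed.

(** A squeeze between exponentials, as
    [expR (- (x / (1 - x))) <= 1 - x <= expR (- x)] for [0 <= x < 1]. *)
Lemma tends_one_minus u (b : nat -> nat) a : (forall n, 0 <= u n) ->
  tends u 0 -> tends (fun n => u n * (b n)%:R) a ->
  tends (fun n => (1 - u n) ^+ b n) (expR (- a)).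
Proof.
move=> u0 hu hub.
have [N hN] := tends_lt (ltr01 : (0 : R) < 1) hu.
have hlow : tends (fun n => expR (- ((u n * (b n)%:R) / (1 - u n)))) (expR (- a)).
  have h1 : tends (fun n => (1 - u n)^-1) 1.
    have := tendsB (tends_cst (1 : R)) hu; rewrite subr0 => h.
    by have := tendsV (oner_neq0 R) h; rewrite invr1.
  have := tendsB (tends_cst (0 : R)) (tendsM hub h1); rewrite mulr1 sub0r => h.
  by apply: (@tends_eq 0 _ _ _ (tends_expR h)) => n _; rewrite sub0r.
have hhigh : tends (fun n => expR (- (u n * (b n)%:R))) (expR (- a)).
  have := tendsB (tends_cst (0 : R)) hub; rewrite sub0r => h.
  by apply: (@tends_eq 0 _ _ _ (tends_expR h)) => n _; rewrite sub0r.
apply: tends_squeeze hlow hhigh => n /hN un1.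
have p0 : 0 < 1 - u n by rewrite subr_gt0.
apply/andP; split.
  have -> : - (u n * (b n)%:R / (1 - u n)) = (b n)%:R * (- (u n / (1 - u n))).
    by rewrite mulrN; congr (- _); ring.
  rewrite expRM_natl; apply: lerXn2r; rewrite ?nnegrE ?expR_ge0 ?(ltW p0) //.
  rewrite expRN -[leRHS]invrK lef_pV2 ?posrE ?invr_gt0 ?expR_gt0 //.
  apply: le_trans (expR_ge1Dx _); rewrite le_eqVlt; apply/orP; left; apply/eqP.
  by field; rewrite gt_eqF.
rewrite [u n * _]mulrC -mulrN expRM_natl.
apply: lerXn2r; rewrite ?nnegrE ?expR_ge0 ?(ltW p0) //.
exact: expR_ge1Dx.
Qed.

(** Such a sequence is Cauchy. *)
Lemma approximable_cvg u : (forall e, 0 < e -> exists a, exists N,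
    forall n, (N <= n)%N -> `|u n - a| <= e) -> cvg (u @ \oo)%classic.
Proof.
move=> h; apply/cauchy_cvgP/cauchy_exP => e e0.
have [a [N hN]] := h (e / 2) (divr_gt0 e0 (ltr0n _ 2)).
exists a; exists N => // n /= Nn; rewrite /ball /= distrC.
by apply: le_lt_trans (hN _ Nn) _; lra.
Qed.

End Sequences.

(** * Asymptotics of the random hypergraph *)

Section Asymptotics.
Variables (R : realType) (d : nat) (lambda : R) (p : nat -> R).
Hypothesis d_gt0 : (0 < d)%N.
Hypothesis lambda_gt0 : 0 < lambda.
Hypothesis p01 : forall n, 0 <= p n <= 1.
Hypothesis p_equiv : asymp_equiv p (fun n => lambda / n%:R ^+ d).

Local Notation Pr n := (prob (@edge_pr R d 'I_n (p n))).

Let pge0 n : 0 <= p n. Proof. by case/andP: (p01 n). Qed.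

(** The sequence that tends to [lambda]: probabilities are expressed by its
    powers and by powers of [n]. *)
Definition scaled n : R := n%:R ^+ d * p n.

Lemma tends_scaled : tends scaled lambda.
Proof.
have h : tends (fun n => p n / (lambda / n%:R ^+ d)) 1 by split.
have := tendsM (tends_cst lambda) h; rewrite mulr1 => h'.
apply: (@tends_eq _ 0 _ _ _ h') => n _; rewrite /scaled invfM invrK.
by rewrite mulrCA mulVKf ?gt_eqF // mulrC.
Qed.

Lemma scaledX n j : n%:R ^+ (d * j) * p n ^+ j = scaled n ^+ j.
Proof. by rewrite exprM -exprMn. Qed.

Lemma tends_p : tends p 0.
Proof.
have := tendsM tends_scaled (tendsX d (tends_invn R)).
rewrite expr0n (negPf (lt0n_neq0 d_gt0)) mulr0 => h.
apply: (@tends_eq _ 1 _ _ _ h) => n n1; rewrite /scaled exprVn mulrAC.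
by rewrite divff ?mul1r // expf_neq0 // pnatr_eq0 -lt0n.
Qed.

(** Removing the [u] vertices one at a time counts [u] binomial coefficients,
    each equivalent to [n ^ d / d!]. *)
Lemma tends_ntouching u : tends (fun n => p n * (ntouching d n u)%:R)
  (u%:R * lambda / d`!%:R).
Proof.
have h (k : 'I_u) : tends (fun n => scaled n * ('C(n - k.+1, d)%:R / n%:R ^+ d))
    (lambda / d`!%:R) := tendsM tends_scaled (tends_bin R k.+1 d).
have := @tends_sum R 'I_u (index_enum _) predT _ _ (fun k _ => h k).
rewrite sumr_const card_ord -[X in tends _ X]mulr_natl mulrA => h'.
apply: (@tends_eq _ (maxn 1 u) _ _ _ h') => n; rewrite geq_max => /andP[n1 un].
have -> : ntouching d n u = (\sum_(k < u) 'C(n - k.+1, d))%N.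
  rewrite /ntouching; elim: u un {h h'} => [|v IH] vn; first by rewrite subn0 subnn big_ord0.
  rewrite big_ord_recr /= -IH; last exact: ltnW.
  have le1 : ('C(n - v, d.+1) <= 'C(n, d.+1))%N by apply: leq_bin2l; apply: leq_subr.
  have := binS (n - v.+1) d; rewrite -subSn // subSS => e.
  by rewrite e in le1 *; lia.
rewrite natr_sum mulr_sumr; apply: eq_bigr => k _; rewrite /scaled.
have n0 : n%:R ^+ d != 0 :> R by rewrite expf_neq0 // pnatr_eq0 -lt0n.
by rewrite [_ * p n]mulrC -mulrA; congr (_ * _); rewrite mulrC divfK.
Qed.

Lemma tends_absent u : tends (fun n => @absent R d 'I_n (p n) u)
  (expR (- (u%:R * lambda / d`!%:R))).
Proof.
have := tends_one_minus pge0 tends_p (tends_ntouching u) => h.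
by apply: (@tends_eq _ 0 _ _ _ h) => n _; rewrite /absent card_ord.
Qed.

Lemma tends_one_minus_cst m : tends (fun n => (1 - p n) ^+ m) 1.
Proof.
have := tendsX m (tendsB (tends_cst (1 : R)) tends_p).
by rewrite subr0 expr1n.
Qed.

Lemma tends_rare_bound N u : tends (fun n => @rare_bound R d 'I_n (p n) N u) 0.
Proof.
have h (j : 'I_N) : tends (fun n => (2 ^ (2 ^ (u + (d * j.+1).-1)))%:R *
    (scaled n ^+ j.+1 * n%:R^-1)) 0.
  have := tendsM (tends_cst (2 ^ (2 ^ (u + (d * j.+1).-1)))%:R)
    (tendsM (tendsX j.+1 tends_scaled) (tends_invn R)).
  by rewrite !mulr0.
have := @tends_sum R 'I_N (index_enum _) predT _ _ (fun j _ => h j).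
rewrite big1 // => h'; apply: (@tends_eq _ 1 _ _ _ h') => n n1.
apply: eq_bigr => j _; rewrite card_ord natrM mulrAC mulrC; congr (_ * _).
have n0 : n%:R != 0 :> R by rewrite pnatr_eq0 -lt0n.
have dj : (0 < d * j.+1)%N by rewrite muln_gt0 d_gt0.
rewrite -scaledX -{1}(prednK dj) exprS natrX mulrC -mulrA mulKf //.
Qed.

Lemma core_bounded N : exists C, exists n0, forall n, (n0 <= n)%N ->
  @core_bound R d 'I_n (p n) N <= C.
Proof.
have h (j : 'I_N.+1) : tends (fun n => (d * j)%:R * ((2 ^ (2 ^ (d * j)))%:R * scaled n ^+ j))
    ((d * j)%:R * ((2 ^ (2 ^ (d * j)))%:R * lambda ^+ j)).
  by apply: tendsM (tends_cst _) (tendsM (tends_cst _) (tendsX j tends_scaled)).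
have h' := @tends_sum R 'I_N.+1 (index_enum _) predT _ _ (fun j _ => h j).
set L := \sum_(_ <- _ | _) _ in h'.
have lt : L < L + 1 by rewrite ltrDl.
have [n0 hn0] := tends_lt lt h'.
exists (L + 1), n0.
move=> n /hn0/ltW; apply: le_trans; rewrite le_eqVlt; apply/orP; left; apply/eqP.
apply: eq_bigr => j _; rewrite card_ord; congr (_ * _).
by rewrite natrM -scaledX [(n ^ _)%:R]natrX -mulrA; apply: mulrCA.
Qed.

Lemma tends_pair_factor (T : tree d) :
  tends (fun n => @pair_factor R d 'I_n (p n) T) 1.
Proof.
have h1 := tends_absent (order T + order T); have h2 := tends_absent (order T).
set a := expR _ in h2; have a0 : a ^+ 2 != 0 by rewrite expf_neq0 // gt_eqF ?expR_gt0.
have := tendsM h1 (tendsV a0 (tendsX 2 h2)).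
rewrite (_ : expR _ = a ^+ 2) ?divff // /a -expRM_natl; congr expR.
by rewrite natrD; ring.
Qed.

(** A tree has more than [d] vertices per edge, which leaves a free factor [n] in
    the expected number of its copies. *)
Lemma copy_mean_large (T : tree d) : exists2 c, 0 < c & exists n0, forall n, (n0 <= n)%N ->
  p n < 1 /\ c * n%:R <= @copy_mean R d 'I_n (p n) T.
Proof.
set t := order T; set e := #|tedges T|.
have h := tendsM (tends_ffact R 0 t) (tendsM (tendsX e tends_scaled) (tends_absent t)).
set b := 1 * _ in h; have b0 : 0 < b.
  by rewrite /b mul1r mulr_gt0 ?exprn_gt0 ?expR_gt0.
have b2 : b / 2 < b by rewrite ltr_pdivrMr // ltr_pMr // ltr1n.
have [n1 hn1] := tends_gt b2 h.
have [n2 hn2] := tends_lt (ltr01 : (0 : R) < 1) tends_p.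
exists (b / 2); first by rewrite divr_gt0.
exists (maxn 1 (maxn n1 n2)) => n; rewrite !geq_max => /and3P[n_gt0 /hn1 hb /hn2 hp].
split=> //; rewrite /copy_mean -/t -/e card_ord.
have te : (d * e < t)%N by exact: card_tedges.
have nR : n%:R != 0 :> R by rewrite pnatr_eq0 -lt0n.
have nge1 : 1 <= n%:R :> R by rewrite ler1n.
have q0 : 0 < 1 - p n by rewrite subr_gt0.
have abs0 : 0 <= @absent R d 'I_n (p n) t by rewrite exprn_ge0 // ltW.
rewrite subn0 in hb.
apply: le_trans (_ : ((n ^_ t)%:R / n%:R ^+ t * (scaled n ^+ e * @absent R d 'I_n (p n) t)) *
   n%:R <= _); first by rewrite ler_wpM2r // ltW.
set A := @absent _ _ _ _ _ in abs0 *.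
have f0 : 0 <= (n ^_ t)%:R :> R by rewrite ler0n.
rewrite -scaledX -!mulrA ler_wpM2l //.
have swap5 (a1 a2 a3 a4 a5 : R) : a1 * (a2 * (a3 * (a4 * a5))) = a3 * a4 * (a1 * (a2 * a5)).
  by ring.
have pA : 0 <= p n ^+ e * A by apply: mulr_ge0; [apply: exprn_ge0|exact: abs0].
rewrite swap5 [leRHS]mulrA ler_wpM2l //.
apply: (@le_trans _ _ 1); last first.
  by rewrite invf_ge1 ?exprn_gt0 // exprn_ile1 ?gerBl ?(ltW q0).
rewrite ler_pdivrMl ?exprn_gt0 ?(lt_le_trans ltr01) // mulr1 -exprSr.
exact: ler_weXn2l.
Qed.

(** The expected number of copies tends to infinity and its variance is of
    smaller order than its square. *)
Lemma tends_few_copies (T : tree d) s :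
  tends (fun n => Pr n (fun E => (#|copies T E| <= s)%N)) 0.
Proof.
have [c c0 [n0 hn0]] := copy_mean_large T.
set t := order T; have c0' : c != 0 by rewrite gt_eqF.
have hupper : tends (fun n => 4 * ((t ^ t)%:R * c^-1) * n%:R^-1 +
    4 * (@pair_factor R d 'I_n (p n) T - 1)) 0.
  have := tendsD (tendsM (tends_cst (4 * ((t ^ t)%:R * c^-1))) (tends_invn R))
    (tendsM (tends_cst (4 : R)) (tendsB (tends_pair_factor T) (tends_cst (1 : R)))).
  by rewrite subrr !mulr0 addr0.
have [n1 hn1] : exists n1, forall n, (n1 <= n)%N -> (2 * s)%:R <= c * n%:R.
  exists (Num.truncn ((2 * s)%:R / c)).+1 => n lt; rewrite mulrC -ler_pdivrMr //.
  apply: ltW; apply: lt_le_trans (truncnS_gt _) _; first by rewrite ler_nat.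
apply: (@tends_squeeze R (maxn 1 (maxn n0 n1)) _ _ _ _ _ (tends_cst 0) hupper) => n.
rewrite !geq_max => /and3P[n_gt0 /hn0[pn1 mean_ge] /hn1 hs].
have p01' : 0 <= p n < 1 by rewrite pge0.
have nR : 0 < n%:R :> R by rewrite ltr0n.
set m := copy_mean _ _ _ in mean_ge.
have m0 : 0 < m by apply: lt_le_trans mean_ge; rewrite mulr_gt0.
have ms : 2 * s%:R <= m by apply: le_trans mean_ge; rewrite -natrM.
have ms' : s%:R <= m by have := ler0n R s; lra.
have := prob_few_copies p01' ms'; rewrite -/m -/t.
set P0 := prob _ _; set k := pair_factor _ _ _.
have P0ge : 0 <= P0 by apply: prob_ge0; apply: edge_pr01.
move=> cheb; rewrite P0ge /=.
have hm : m ^+ 2 / 4 <= (m - s%:R) ^+ 2.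
  have := ler0n R s; nra.
have h1 : m ^+ 2 / 4 * P0 <= (t ^ t)%:R * m + m ^+ 2 * (k - 1).
  by apply: le_trans cheb; rewrite ler_wpM2r.
have h2 : P0 <= 4 * ((t ^ t)%:R / m) + 4 * (k - 1).
  rewrite -(ler_pM2l (_ : 0 < m ^+ 2 / 4)); last by rewrite divr_gt0 ?exprn_gt0.
  apply: le_trans h1 _; rewrite le_eqVlt; apply/orP; left; apply/eqP.
  by field; rewrite gt_eqF.
apply: le_trans h2 _; rewrite lerD2r -mulrA ler_wpM2l //.
rewrite -mulrA ler_wpM2l // -invfM lef_pV2 ?posrE // ?mulr_gt0 //.
Qed.

End Asymptotics.

(** * Shapes of the dense core *)

Definition labelings (V : finType) c (Y0 : {set {set 'I_c}}) (Y : {set {set V}}) :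
    {set {ffun 'I_c -> V}} :=
  [set f : {ffun 'I_c -> V} | injectiveb f & Y == emap f Y0].

Lemma labelings_sub (V : finType) c (Y0 : {set {set 'I_c}}) (Y : {set {set V}}) :
  cover Y0 = setT -> (#|labelings Y0 Y| <= c`!)%N.
Proof.
move=> full; have [->|/set0Pn[f]] := eqVneq (labelings Y0 Y) set0; first by rewrite cards0.
rewrite inE => /andP[/injectiveP injf /eqP Yf].
have cY : #|cover Y| = c by rewrite Yf cover_emap full card_imset // cardsT card_ord.
have := card_inj_ffuns_on 'I_c (mem (cover Y)); rewrite card_ord cY ffactnn => <-.
apply: subset_leq_card; apply/subsetP => g; rewrite !inE => /andP[injg /eqP Yg].
rewrite injg andbT; apply/ffun_onP => i.
by rewrite Yg cover_emap full imset_f.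
Qed.

(** A family spanning [c] vertices has [c!] labelings, distributed among the
    families on ['I_c] that it is isomorphic to. *)
Lemma sum_labelings (V : finType) c (Y : {set {set V}}) :
  (\sum_(Y0 : {set {set 'I_c}} | cover Y0 == setT) #|labelings Y0 Y| =
   (#|cover Y| == c) * c`!)%N.
Proof.
under eq_bigr do rewrite -sum1_card big_mkcond /=.
rewrite exchange_big /=.
transitivity (\sum_(f : {ffun 'I_c -> V} | injectiveb f) (f @: setT == cover Y))%N.
  rewrite [RHS]big_mkcond; apply: eq_bigr => f _.
  under eq_bigr do rewrite inE.
  case: ifPn => [/injectiveP injf|_]; last by rewrite big1.
  have [eqY|neY] := eqVneq (f @: setT) (cover Y); last first.
    rewrite big1 // => Y0 /eqP full; case: eqP => // Yf; case/eqP: neY.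
    by rewrite Yf cover_emap full.
  pose Y1 := [set e : {set 'I_c} | f @: e \in Y].
  have Y1E : Y = emap f Y1.
    apply/setP => e; apply/idP/imsetP => [eY|[e0]]; last by rewrite inE => h ->.
    have ef : e = f @: (f @^-1: e).
      apply/setP => y; apply/idP/imsetP => [ye|[i]]; last by rewrite inE => ? ->.
      have : y \in f @: setT by rewrite eqY; apply/coverP; exists e.
      by case/imsetP => i _ yi; exists i; rewrite // inE -yi.
    by exists (f @^-1: e) => //; rewrite inE -ef.
  have full1 : cover Y1 == setT.
    by rewrite -(inj_eq (imset_inj injf)) -cover_emap -Y1E eqY.
  rewrite (bigD1 Y1) //= -Y1E eqxx big1 ?addn0 // => Y0 /andP[_ ne].
  by case: eqP => // Yf; case/eqP: ne; apply: (emap_inj injf); rewrite -Yf.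
have [cY|cY] := eqVneq #|cover Y| c; last first.
  rewrite mul0n big1 // => f /injectiveP injf; case: eqP => // e; case/eqP: cY.
  by rewrite -e card_imset // cardsT card_ord.
have := card_inj_ffuns_on 'I_c (mem (cover Y)); rewrite card_ord cY ffactnn mul1n => <-.
rewrite -sum1_card big_mkcond [RHS]big_mkcond.
apply: eq_bigr => f _; rewrite inE andbC; case: ifPn => //= /injectiveP injf.
rewrite eqEcard card_imset // cardsT card_ord cY leqnn andbT.
suff -> : (f @: setT \subset cover Y) = (f \in ffun_on (mem (cover Y))) by case: ifP.
apply/subsetP/ffun_onP => [h i|h _ /imsetP[i _ ->]]; last exact: h.
by apply: h; apply: imset_f.
Qed.

Lemma sum_labelings_lt (R : realType) (V : finType) (Y : {set {set V}}) K :
  \sum_(c < K) \sum_(Y0 : {set {set 'I_c}} | cover Y0 == setT)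
    #|labelings Y0 Y|%:R / c`!%:R = (#|cover Y| < K)%N%:R :> R.
Proof.
transitivity (\sum_(c < K) (#|cover Y| == c)%:R : R).
  by apply: eq_bigr => c _; rewrite -mulr_suml -natr_sum sum_labelings natrM mulfK.
case: ltnP => [lt|ge].
  rewrite (bigD1 (Ordinal lt)) //= eqxx big1 ?addr0 // => c ne.
  by case: eqP => // e; case/eqP: ne; apply: val_inj; rewrite /= e.
rewrite big1 // => c _; case: eqP => // e.
by have := ltn_ord c; rewrite -e ltnNge ge.
Qed.

Section Shapes.
Variables (R : realType) (d : nat) (lambda : R) (p : nat -> R).
Hypothesis d_gt0 : (0 < d)%N.
Hypothesis lambda_gt0 : 0 < lambda.
Hypothesis p01 : forall n, 0 <= p n <= 1.
Hypothesis p_equiv : asymp_equiv p (fun n => lambda / n%:R ^+ d).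
Variable N : nat.

Local Notation Pr n := (prob (@edge_pr R d 'I_n (p n))).
Local Notation core E := (dcore d N.+1 E).
Local Notation Z n := (@coreless R d 'I_n (p n) N.+1).

Let pge0 n : 0 <= p n. Proof. by case/andP: (p01 n). Qed.
Let pr01 n := @edge_pr01 R d 'I_n (p n) (p01 n).

(** The probability that the dense core is isomorphic to [Y0], counted with
    the proportion of labelings of the core that lead to [Y0]. *)
Definition shape_prob n c (Y0 : {set {set 'I_c}}) : R :=
  mean (@edge_pr R d 'I_n (p n)) (fun E => #|labelings Y0 (core E)|%:R) / c`!%:R.

Lemma shape_probE n c (Y0 : {set {set 'I_c}}) :
  shape_prob n Y0 =
  (\sum_(f : {ffun 'I_c -> 'I_n} | injectiveb f) Pr n (fun E => core E == emap f Y0)) / c`!%:R.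
Proof.
rewrite /shape_prob /mean /prob; congr (_ / _).
under [RHS]eq_bigr do rewrite big_mkcond.
rewrite exchange_big; apply: eq_bigr => E _ /=.
rewrite -sum1_card natr_sum mulr_sumr [LHS]big_mkcond [RHS]big_mkcond.
apply: eq_bigr => f _; rewrite inE; case: (injectiveb f) => //=.
by rewrite mulr1.
Qed.

Lemma tends0_abs n0 (u b : nat -> R) : (forall n, (n0 <= n)%N -> `|u n| <= b n) ->
  tends b 0 -> tends u 0.
Proof.
move=> ub hb; have hb' := tendsB (tends_cst (0 : R)) hb; rewrite subr0 in hb'.
apply: tends_squeeze hb' hb => n /ub.
by rewrite sub0r ler_norml.
Qed.

Lemma tends_norm (u : nat -> R) a : tends u a -> tends (fun n => `|u n - a|) 0.
Proof.
move=> /tendsP h; apply/tendsP => e /h[n0 hn]; exists n0 => n /hn.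
by rewrite subr0 normr_id.
Qed.

Lemma card_inj_ord n c : #|[pred f : {ffun 'I_c -> 'I_n} | injectiveb f]| = (n ^_ c)%N.
Proof. by rewrite -[n in RHS]card_ord -[c in RHS]card_ord -card_inj_ffuns cardsE. Qed.

(** The number of edges to be excluded around a labeled copy of [Y0] does not
    depend on the copy. *)
Lemma card_boundary n c (Y0 : {set {set 'I_c}}) (f : 'I_c -> 'I_n) :
  uniform d Y0 -> injective f ->
  (#|touching d (cover (dcore d N (emap f Y0))) :\: emap f Y0| +
   #|[set a in Y0 | ~~ [disjoint a & cover (dcore d N Y0)]]|)%N =
  ntouching d n #|cover (dcore d N Y0)|.
Proof.
move=> uY injf; rewrite dcore_emap // cover_emap.
set I := cover _.
have -> : ntouching d n #|I| = #|touching d (f @: I)|.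
  by rewrite card_touching card_ord card_imset.
rewrite -(cardsID (emap f Y0) (touching d (f @: I))) addnC; congr (_ + _)%N.
rewrite -(card_emap injf); congr #|pred_of_set _|; apply/setP => a; rewrite !inE.
apply/imsetP/andP => [[b]|[/andP[_ ne] /imsetP[b bY ab]]].
  rewrite inE => /andP[bY ne] ->; rewrite mem_emap // bY card_imset // disjoint_imset //.
  by rewrite (uniform_card uY bY) eqxx.
exists b => //; rewrite inE bY /=; by move: ne; rewrite ab disjoint_imset.
Qed.

Definition shape_ok c (Y0 : {set {set 'I_c}}) :=
  [/\ uniform d Y0, forall F : {set {set 'I_c}}, F \subset Y0 -> (d * #|F| <= #|cover F|)%N &
      core Y0 = Y0].

(** There are about [n ^ c] labeled positions, and [c] is [d * #|Y0|] by
    [card_cover_core]: this balances the factor [p ^ #|Y0|] of [prob_core]. *)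
Lemma shape_prob_ok c (Y0 : {set {set 'I_c}}) : cover Y0 = setT -> shape_ok Y0 ->
  exists2 w, 0 <= w & tends (fun n => shape_prob n Y0 - w * Z n) 0.
Proof.
move=> full [uY sp coreY].
have cc : c = (d * #|Y0|)%N.
  by rewrite -(card_cover_core sp coreY) full cardsT card_ord.
set e := #|Y0| in cc.
pose i := #|cover (dcore d N Y0)|.
pose m := #|[set a in Y0 | ~~ [disjoint a & cover (dcore d N Y0)]]|.
pose u n := (n ^_ c)%:R / n%:R ^+ c * scaled d p n ^+ e / c`!%:R.
pose v n := u n * (@absent R d 'I_n (p n) i / (1 - p n) ^+ m).
have tu : tends u (lambda ^+ e / c`!%:R).
  rewrite -[lambda ^+ e]mul1r; apply: tendsM (tends_cst _).
  apply: tendsM; last exact/tendsX/tends_scaled.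
  by apply: (@tends_eq _ 0 _ _ _ (tends_ffact R 0 c)) => n _; rewrite subn0.
set a := expR (- (i%:R * lambda / d`!%:R)).
have tv : tends v (lambda ^+ e / c`!%:R * (a / 1)).
  apply: (tendsM tu); apply: tendsM; first exact: tends_absent.
  apply: tendsV; first exact: oner_neq0.
  exact: tends_one_minus_cst d_gt0 lambda_gt0 p_equiv m.
set w := _ * (a / 1) in tv.
exists w.
  by rewrite /w invr1 mulr1 mulr_ge0 ?divr_ge0 ?exprn_ge0 ?expR_ge0 ?ler0n // ltW.
have trb := tends_rare_bound d_gt0 lambda_gt0 p_equiv N.+1 c.
have [n1 hn1] := tends_lt (ltr01 : (0 : R) < 1) (tends_p d_gt0 lambda_gt0 p_equiv).
have tb : tends (fun n => u n * (@rare_bound R d 'I_n (p n) N.+1 c +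
    @rare_bound R d 'I_n (p n) N.+1 c) + `|v n - w|) 0.
  have := tendsD (tendsM tu (tendsD trb trb)) (tends_norm tv).
  by rewrite !addr0 mulr0.
apply: (@tends0_abs (maxn 1 n1)) tb => n; rewrite geq_max => /andP[n_gt0 /hn1 pn1].
have q0 : 1 - p n != 0 by rewrite subr_eq0 gt_eqF.
set rb := rare_bound _ _ _ _ _.
have Z0 : 0 <= Z n by apply: prob_ge0.
have Z1 : Z n <= 1 by apply: prob_le1.
pose B : R := p n ^+ e * (@absent R d 'I_n (p n) i / (1 - p n) ^+ m) * Z n.
have uE : u n = (n ^_ c)%:R * p n ^+ e / c`!%:R.
  rewrite /u -scaledX {2}cc; congr (_ / _); rewrite mulrA divfK //.
  by rewrite expf_neq0 // pnatr_eq0 -lt0n.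
have vE : v n * Z n = ((n ^_ c)%:R * B) / c`!%:R.
  have assoc (x1 x2 x3 x4 x5 : R) : x1 * x2 * x3 * x4 * x5 = x1 * (x2 * x4 * x5) * x3 by ring.
  by rewrite /v uE /B assoc.
have key : `|shape_prob n Y0 - v n * Z n| <= u n * (rb + rb).
  rewrite shape_probE vE -mulrBl normrM uE [in leRHS]mulrAC.
  rewrite [X in _ * X <= _]ger0_norm ?invr_ge0 ?ler0n // ler_wpM2r ?invr_ge0 ?ler0n //.
  rewrite -card_inj_ord mulr_natl -sumr_const -sumrB.
  apply: le_trans (ler_norm_sum _ _ _) _.
  rewrite -mulrA mulr_natl -sumr_const; apply: ler_sum => f /injectiveP injf.
  have uYf : uniform d (emap f Y0) by rewrite uniform_emap.
  have spf (F : {set {set 'I_n}}) : F \subset emap f Y0 -> (d * #|F| <= #|cover F|)%N.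
    move=> /sub_emap[F' sF' ->].
    by rewrite card_emap // cover_emap card_imset // sp.
  have cf : core (emap f Y0) = emap f Y0 by rewrite dcore_emap // coreY.
  have cYf : #|cover (emap f Y0)| = c by rewrite cover_emap full card_imset // cardsT card_ord.
  have := prob_core (p01 n) uYf spf cf.
  rewrite (card_emap injf) -/e.
  have -> : (1 - p n) ^+ #|touching d (cover (dcore d N (emap f Y0))) :\: emap f Y0| =
      @absent R d 'I_n (p n) i / (1 - p n) ^+ m.
    apply: (canRL (mulfK _)); first by rewrite expf_neq0.
    by rewrite -exprD card_boundary // /absent card_ord.
  move=> h; apply: le_trans h _; rewrite ler_wpM2l ?exprn_ge0 //.
  have n0' : (0 < #|'I_n|)%N by rewrite card_ord.
  have := prob_rare (p01 n) N.+1 (cover (emap f Y0)) d_gt0 n0'.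
  by rewrite cYf => h; apply: lerD.
have -> : shape_prob n Y0 - w * Z n = (shape_prob n Y0 - v n * Z n) + (v n - w) * Z n.
  by rewrite mulrBl addrA subrK.
apply: le_trans (ler_normD _ _) _; apply: lerD => //.
by rewrite normrM (ger0_norm Z0) ler_piMr.
Qed.

(** A shape that is not covered by [shape_prob_ok] is impossible or contains a
    family with less than [d] vertices per edge, which is rare. *)
Lemma shape_limit c (Y0 : {set {set 'I_c}}) : exists2 w, 0 <= w &
  cover Y0 = setT -> tends (fun n => shape_prob n Y0 - w * Z n) 0.
Proof.
have [full|nfull] := eqVneq (cover Y0) setT; last first.
  by exists 0 => // h; rewrite h eqxx in nfull.
have [ok|nok] := pselect (shape_ok Y0).
  by have [w w0 h] := shape_prob_ok full ok; exists w.
exists 0 => // _.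
have c0 : 0 < c`!%:R :> R by rewrite ltr0n fact_gt0.
have shape0 n : 0 <= shape_prob n Y0.
  rewrite /shape_prob divr_ge0 ?ler0n //; apply: sumr_ge0 => E _.
  by rewrite mulr_ge0 ?ler0n // bern_ge0.
suff : tends (fun n => shape_prob n Y0) 0.
  by move=> h; apply: (@tends_eq _ 0 _ _ _ h) => n _; rewrite mul0r subr0.
have zero : (forall n E, bern (@edge_pr R d 'I_n (p n)) E != 0 -> labelings Y0 (core E) = set0) ->
    tends (fun n => shape_prob n Y0) 0.
  move=> h; apply: (@tends_eq _ 0 _ _ _ (tends_cst 0)) => n _.
  rewrite /shape_prob /mean big1 ?mul0r // => E _.
  have [->|ne] := eqVneq (bern (@edge_pr R d 'I_n (p n)) E) 0; first by rewrite mul0r.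
  by rewrite h // cards0 mulr0.
have [uY|nuY] := boolP (uniform d Y0); last first.
  apply: zero => n E /bern_uniform uE; apply/eqP; apply: contraT => /set0Pn[f].
  rewrite inE => /andP[/injectiveP injf /eqP cE]; case/negP: nuY.
  rewrite -(uniform_emap _ injf) -cE; apply: uniformS uE; exact: dcore_sub.
have [coreY|ncoreY] := eqVneq (core Y0) Y0; last first.
  apply: zero => n E _; apply/eqP; apply: contraT => /set0Pn[f].
  rewrite inE => /andP[/injectiveP injf /eqP cE]; case/eqP: ncoreY.
  by apply: (emap_inj injf); rewrite -dcore_emap // -cE dcore_dcore.
have [F sF dF] : exists2 F : {set {set 'I_c}}, F \subset Y0 & (#|cover F| < d * #|F|)%N.
  apply: contrapT => nF; case: nok; split=> // F sF.
  by rewrite leqNgt; apply/negP => dF; case: nF; exists F.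
have trb := tends_rare_bound d_gt0 lambda_gt0 p_equiv #|Y0| 0.
apply: (@tends_squeeze _ 1 _ _ _ _ _ (tends_cst 0) trb) => n n_gt0.
rewrite shape0 /=.
have n0' : (0 < #|'I_n|)%N by rewrite card_ord.
have := prob_rare (p01 n) #|Y0| set0 d_gt0 n0'; rewrite cards0; apply: le_trans.
rewrite /shape_prob ler_pdivrMr // /mean /prob mulr_suml [leRHS]big_mkcond.
apply: ler_sum => E _; case: ifPn => [_|norare].
  by rewrite ler_wpM2l ?bern_ge0 // ler_nat labelings_sub.
suff -> : labelings Y0 (core E) = set0 by rewrite cards0 mulr0.
apply/eqP; apply: contraT => /set0Pn[f]; rewrite inE => /andP[/injectiveP injf /eqP cE].
case/negP: norare; apply/existsP; exists (emap f F); apply/and3P; split.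
- by apply: subset_trans (dcore_sub d N.+1 E); rewrite cE emapS.
- by rewrite card_emap // subset_leq_card // andbT; case: #|F| dF => //; rewrite muln0.
- by rewrite setD0 card_emap // cover_emap card_imset.
Qed.

Lemma sum_shape_probE n K (a : forall c, {set {set 'I_c}} -> R) :
  \sum_(c < K) \sum_(Y0 : {set {set 'I_c}} | cover Y0 == setT) a c Y0 * shape_prob n Y0 =
  \sum_E bern (@edge_pr R d 'I_n (p n)) E *
    \sum_(c < K) \sum_(Y0 : {set {set 'I_c}} | cover Y0 == setT)
      a c Y0 * (#|labelings Y0 (core E)|%:R / c`!%:R).
Proof.
under [RHS]eq_bigr do rewrite mulr_sumr.
rewrite [RHS]exchange_big; apply: eq_bigr => c _ /=.
under [RHS]eq_bigr do rewrite mulr_sumr.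
rewrite [RHS]exchange_big; apply: eq_bigr => Y0 _ /=.
rewrite /shape_prob /mean mulr_suml mulr_sumr; apply: eq_bigr => E _.
by rewrite -!mulrA mulrCA.
Qed.

Lemma sum_shape_prob n K :
  \sum_(c < K) \sum_(Y0 : {set {set 'I_c}} | cover Y0 == setT) shape_prob n Y0 =
  Pr n (fun E => (#|cover (core E)| < K)%N).
Proof.
transitivity (\sum_(c < K) \sum_(Y0 : {set {set 'I_c}} | cover Y0 == setT)
    1 * shape_prob n Y0).
  by apply: eq_bigr => c _; apply: eq_bigr => Y0 _; rewrite mul1r.
have -> := sum_shape_probE n K (fun _ _ => 1).
rewrite /prob [RHS]big_mkcond; apply: eq_bigr => E _.
have -> : \sum_(c < K) \sum_(Y0 : {set {set 'I_c}} | cover Y0 == setT)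
    1 * (#|labelings Y0 (core E)|%:R / c`!%:R) = (#|cover (core E)| < K)%N%:R :> R.
  rewrite -sum_labelings_lt.
  by apply: eq_bigr => c _; apply: eq_bigr => Y0 _; rewrite mul1r.
by case: ifP; rewrite ?mulr1 ?mulr0.
Qed.

(** Outside [Bad] and the event that the core is large, the labelings of the
    core all vote for the right verdict, and their weights add up to one. *)
Lemma prob_by_shape n K (A Bad : pred {set {set 'I_n}})
    (a : forall c, {set {set 'I_c}} -> bool) :
  (forall E c (Y0 : {set {set 'I_c}}) f, uniform d E -> ~~ Bad E ->
     f \in labelings Y0 (core E) -> A E = a c Y0) ->
  `|Pr n A - \sum_(c < K) \sum_(Y0 : {set {set 'I_c}} | cover Y0 == setT)
     (a c Y0)%:R * shape_prob n Y0| <=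
  Pr n (fun E => (K <= #|cover (core E)|)%N) + Pr n Bad.
Proof.
move=> decided; rewrite (sum_shape_probE n K (fun c Y0 => (a c Y0)%:R)).
rewrite /prob [X in `|X - _|]big_mkcond [X in _ <= X + _]big_mkcond.
rewrite [X in _ <= _ + X]big_mkcond -sumrB -big_split /=.
apply: le_trans (ler_norm_sum _ _ _) _; apply: ler_sum => E _.
set w := bern _ E; set S := \sum_(_ < K) _.
have w0 : 0 <= w by exact: bern_ge0.
have [we|wn] := eqVneq w 0.
  by rewrite we mul0r !if_same subrr normr0 addr0.
have uE : uniform d E by exact: bern_uniform wn.
set tot : R := (#|cover (core E)| < K)%N%:R.
have term0 c (Y0 : {set {set 'I_c}}) : 0 <= #|labelings Y0 (core E)|%:R / c`!%:R :> R.
  by rewrite divr_ge0 ?ler0n.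
have S0 : 0 <= S by do 2!apply: sumr_ge0 => ? _; rewrite mulr_ge0 ?ler0n.
have S1 : S <= tot.
  rewrite /tot -sum_labelings_lt; apply: ler_sum => c _; apply: ler_sum => Y0 _.
  by rewrite ler_piMl // lern1 leq_b1.
have Sgood : ~~ Bad E -> S = (A E)%:R * tot.
  move=> good; rewrite /tot -sum_labelings_lt mulr_sumr; apply: eq_bigr => c _.
  rewrite mulr_sumr; apply: eq_bigr => Y0 _.
  have [->|/set0Pn[f fl]] := eqVneq (labelings Y0 (core E)) set0.
    by rewrite cards0 mul0r !mulr0.
  by rewrite (decided _ _ _ _ uE good fl).
have -> : (if A E then w else 0) - w * S = w * ((A E)%:R - S).
  by rewrite mulrBr; case: (A E); rewrite ?mulr1 ?mulr0.
have -> : (if (K <= #|cover (core E)|)%N then w else 0) + (if Bad E then w else 0) =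
    w * ((K <= #|cover (core E)|)%N%:R + (Bad E)%:R).
  by rewrite mulrDr; case: (Bad E); case: (K <= _)%N; rewrite ?mulr1 ?mulr0.
rewrite normrM (ger0_norm w0) ler_wpM2l //.
have [bad|/Sgood ->] := boolP (Bad E).
  rewrite -[true%:R]/(1 : R).
  have tot1 : tot <= 1 by rewrite /tot lern1 leq_b1.
  have A01 : 0 <= ((A E)%:R : R) <= 1 by rewrite ler0n lern1 leq_b1.
  have K0 : 0 <= ((K <= #|cover (core E)|)%N%:R : R) by rewrite ler0n.
  by case/andP: A01 => A0 A1; rewrite ler_norml; apply/andP; split; lra.
rewrite /tot ltnNge; case: (K <= _)%N => /=.
  by rewrite mulr0 subr0 addr0 ger0_norm ?ler0n // lern1 leq_b1.
by rewrite mulr1 subrr normr0 addr0.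
Qed.

End Shapes.

(** * Convergence *)

Section Convergence.
Variables (R : realType) (d : nat) (lambda : R) (p : nat -> R).
Hypothesis d_gt0 : (0 < d)%N.
Hypothesis lambda_gt0 : 0 < lambda.
Hypothesis p01 : forall n, 0 <= p n <= 1.
Hypothesis p_equiv : asymp_equiv p (fun n => lambda / n%:R ^+ d).

Local Notation Pr n := (prob (@edge_pr R d 'I_n (p n))).

Lemma not_sparse (V : finType) L (E : {set {set V}}) :
  ~~ sparse d L E -> rare_near d L set0 E.
Proof.
case/forallPn => F; rewrite negb_imply -ltnNge => /andP[/andP[sF cF] dF].
apply/existsP; exists F; rewrite sF cF setD0 dF !andbT.
by case: #|F| dF => //; rewrite muln0.
Qed.

(** Sparsity fails by a rare family near the empty set, and each of the finitely
    many trees has few copies with vanishing probability. *)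
Lemma tends_poor q L k (T : 'I_k -> tree d) :
  tends (fun n => Pr n (fun E => ~~ rich q L T E)) 0.
Proof.
have h := @tends_sum R _ (index_enum 'I_k) predT _ _ (fun i _ =>
  tends_few_copies d_gt0 lambda_gt0 p01 p_equiv (T i) (q * order (T i) ^ order (T i))).
have := tendsD (tends_rare_bound d_gt0 lambda_gt0 p_equiv L 0) h.
rewrite big1 // addr0 => h'.
apply: (@tends_squeeze _ 1 _ _ _ _ _ (tends_cst 0) h') => n n_gt0.
have pr01 := @edge_pr01 R d 'I_n (p n) (p01 n).
rewrite prob_ge0 //=; have n0 : (0 < #|'I_n|)%N by rewrite card_ord.
have := prob_rare (p01 n) L set0 d_gt0 n0; rewrite cards0 => rare.
apply: le_trans (_ : _ <= Pr n (rare_near d L set0) + Pr n (fun E =>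
  [exists i, (#|copies (T i) E| <= q * order (T i) ^ order (T i))%N])) _.
  apply: probU => // E _; rewrite negb_and => /orP[/not_sparse|/forallPn[i]]; first by left.
  by rewrite -leqNgt => hi; right; apply/existsP; exists i.
apply: lerD => //; apply: prob_union => // E _ /existsP[i hi]; by exists i.
Qed.

(** The shape probabilities are asymptotically proportional to each other, and
    together they make up almost the whole probability. So the mixture is close
    to its share [S / W] of the total weight, even if the probability [Z n] of an
    empty core were not known to converge. *)
Lemma shape_mixture N K (g : nat -> R) (a : forall c, {set {set 'I_c}} -> bool) e :
  0 < e -> e < 1 ->
  (exists n0, forall n, (n0 <= n)%N ->
    Pr n (fun E => (K <= #|cover (dcore d N.+1 E)|)%N) <= e) ->
  (exists n0, forall n, (n0 <= n)%N ->
    `|g n - \sum_(c < K) \sum_(Y0 : {set {set 'I_c}} | cover Y0 == setT)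
       (a c Y0)%:R * shape_prob d p N n Y0| <= e) ->
  exists b, exists n0, forall n, (n0 <= n)%N -> `|g n - b| <= e * 4.
Proof.
move=> e0 e1 [n1 large] [n2 near].
pose wt c Y0 := s2val (cid2 (@shape_limit R d lambda p d_gt0 lambda_gt0 p01 p_equiv N c Y0)).
have wt0 c Y0 : 0 <= wt c Y0 by rewrite /wt; case: cid2.
have wtP c (Y0 : {set {set 'I_c}}) : cover Y0 == setT -> tends (fun n =>
    shape_prob d p N n Y0 - wt c Y0 * @coreless R d 'I_n (p n) N.+1) 0.
  by rewrite /wt => /eqP; case: cid2.
pose Z n := @coreless R d 'I_n (p n) N.+1.
pose W := \sum_(c < K) \sum_(Y0 : {set {set 'I_c}} | cover Y0 == setT) wt c Y0.
pose S := \sum_(c < K) \sum_(Y0 : {set {set 'I_c}} | cover Y0 == setT) (a c Y0)%:R * wt c Y0.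
have SW : S <= W.
  by do 2!apply: ler_sum => ? _; rewrite ler_piMl // lern1 leq_b1.
have S0 : 0 <= S by do 2!apply: sumr_ge0 => ? _; rewrite mulr_ge0 ?ler0n.
have comb (b : forall c, {set {set 'I_c}} -> R) : tends (fun n =>
    \sum_(c < K) \sum_(Y0 : {set {set 'I_c}} | cover Y0 == setT) b c Y0 * shape_prob d p N n Y0 -
    (\sum_(c < K) \sum_(Y0 : {set {set 'I_c}} | cover Y0 == setT) b c Y0 * wt c Y0) * Z n) 0.
  have h (c : 'I_K) : tends (fun n => \sum_(Y0 : {set {set 'I_c}} | cover Y0 == setT)
      b c Y0 * (shape_prob d p N n Y0 - wt c Y0 * Z n)) 0.
    have := @tends_sum R _ (index_enum _) _ _ _ (fun Y0 full => tendsM (tends_cst (b c Y0)) (wtP c Y0 full)).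
    by rewrite big1 // => Y0 _; rewrite mulr0.
  have := @tends_sum R _ (index_enum _) predT _ _ (fun c _ => h c).
  rewrite big1 // => h'; apply: (@tends_eq _ 0 _ _ _ h') => n _.
  rewrite mulr_suml -sumrB; apply: eq_bigr => c _; rewrite mulr_suml -sumrB.
  by apply: eq_bigr => Y0 _; rewrite mulrBr [b _ _ * (wt _ _ * _)]mulrA.
have hS := comb (fun c Y0 => (a c Y0)%:R); rewrite -/S in hS.
have hW := comb (fun _ _ => 1).
have {}hW : tends (fun n => Pr n (fun E => (#|cover (dcore d N.+1 E)| < K)%N) - W * Z n) 0.
  apply: (@tends_eq _ 0 _ _ _ hW) => n _; rewrite -sum_shape_prob; congr (_ - _ * _);
  by apply: eq_bigr => c _; apply: eq_bigr => Y0 _; rewrite mul1r.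
(* Small enough for [W] not to vanish: [e + de] is less than one. *)
pose de := e * (1 - e) / 2.
have de0 : 0 < de by rewrite /de divr_gt0 // mulr_gt0 // subr_gt0.
have [n3 hn3] := (tendsP _ _).1 hW _ de0.
have [n4 hn4] := (tendsP _ _).1 hS _ de0.
have dee : de <= e / 2 by rewrite /de; nra.
have W0 : 0 < W.
  rewrite lt_neqAle (le_trans S0 SW) andbT eq_sym; apply/negP => /eqP W0.
  have n1m := leq_maxl n1 n3; have n3m := leq_maxr n1 n3.
  have := hn3 _ n3m; have := large _ n1m; set m := maxn n1 n3.
  rewrite W0 mul0r !subr0 => h1.
  rewrite ger0_norm; last by apply: prob_ge0; apply: edge_pr01.
  have := @probU R _ _ (@edge_pr01 R d 'I_m (p m) (p01 m)) predT
    (fun E => (#|cover (dcore d N.+1 E)| < K)%N) (fun E => (K <= #|cover (dcore d N.+1 E)|)%N).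
  rewrite probT => h2 h3.
  have : (1 : R) <= de + e.
    apply: le_trans (h2 _) _; last by rewrite lerD.
    by move=> E _ _; case: ltnP; [left|right].
  by rewrite /de; nra.
exists (S / W), (maxn (maxn n1 n2) (maxn n3 n4)) => n.
rewrite !geq_max => /andP[/andP[/large h1 /near h2] /andP[/hn3 h3 /hn4 h4]].
set Q := Pr n (fun E => (#|cover (dcore d N.+1 E)| < K)%N) in h3.
have pr01 := @edge_pr01 R d 'I_n (p n) (p01 n).
have Q1 : Q <= 1 by apply: prob_le1.
have Q0 : 1 - e <= Q.
  rewrite lerBlDr -[leLHS](probT (@edge_pr R d 'I_n (p n))).
  apply: le_trans (_ : _ <= Q + Pr n (fun E => (K <= #|cover (dcore d N.+1 E)|)%N)) _.
    by apply: probU => // E _ _; case: ltnP; [left|right].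
  by rewrite lerD2l.
set A := \sum_(c < K) _ in h2 h4.
have q01 : 0 <= S / W <= 1 by rewrite divr_ge0 ?(ltW W0) //= ler_pdivrMr // mul1r.
have h5 : `|S * Z n - S / W| <= e + de.
  have -> : S * Z n - S / W = S / W * (W * Z n - 1) by field; rewrite gt_eqF.
  case/andP: q01 => q0 q1; rewrite normrM (ger0_norm q0).
  apply: le_trans (ler_piMl _ q1) _; first exact: normr_ge0.
  by move: h3; rewrite !ler_norml => /andP[? ?]; apply/andP; split; lra.
move: h2 h4 h5; rewrite !ler_norml => /andP[? ?] /andP[? ?] /andP[? ?].
by apply/andP; split; lra.
Qed.

(** The constants: [shape_mixture] multiplies the error [e1] by four and needs it
    to be less than one; the cutoff [K] comes from Markov's inequality for the size of
    the core. *)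
Lemma sparse_convergence : convergence_law d p.
Proof.
move=> A [phi defA].
have -> : (fun n => Pr_random_hypergraph (p n) (A n)) =
    (fun n => Pr n (fun E => if insub E is Some H then models (H : hypergraph d n) phi else false)).
  apply/funext => n; rewrite Pr_random_hypergraphE; apply: eq_prob => E.
  by case: insub => // H; apply: defA.
set q := qdepth phi; set L := rad q; set N := (rad q + rad q)%N.
have [k [T hT]] := @tree_representatives d (rank d q).
(* The verdict of a shape; by [models_core] any witness gives the same one. *)
pose a c (Y0 : {set {set 'I_c}}) := `[< exists n (H : hypergraph d n) (f : {ffun 'I_c -> 'I_n}),
  [/\ injective f, rich q L T (edges H), dcore d N.+1 (edges H) = emap f Y0 & models H phi] >].
apply: approximable_cvg => e e_gt0.
pose e1 : R := Num.min (e / 4) (1 / 2).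
have e1_gt0 : 0 < e1 by rewrite lt_min !divr_gt0.
have e1_lt1 : e1 < 1 by rewrite gt_min; apply/orP; right; lra.
have e1_e : e1 * 4 <= e.
  by rewrite -ler_pdivlMr // ge_min lexx.
have [C [n0 hC]] := core_bounded lambda_gt0 p_equiv N.+1.
pose K := (Num.truncn (`|C| / (e1 / 2))).+1.
have K0 : 0 < K%:R :> R by rewrite ltr0n.
have CK : `|C| < e1 / 2 * K%:R.
  by rewrite mulrC -ltr_pdivrMr ?divr_gt0 // truncnS_gt.
have large : forall n, (maxn 1 n0 <= n)%N ->
    Pr n (fun E => (K <= #|cover (dcore d N.+1 E)|)%N) <= e1 / 2.
  move=> n; rewrite geq_max => /andP[n_gt0 /hC hCn].
  have n0' : (0 < #|'I_n|)%N by rewrite card_ord.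
  rewrite -(ler_pM2l K0); apply: le_trans (prob_large_core d (p01 n) N.+1 K n0') _.
  apply: le_trans hCn _; apply: le_trans (ler_norm _) _.
  by apply: ltW; rewrite mulrC.
have [n1 poor] := (tendsP _ _).1 (tends_poor q L T) (e1 / 2) (divr_gt0 e1_gt0 (ltr0n _ 2)).
have [||b [n2 hb]] := @shape_mixture N K (fun n => Pr n (fun E =>
    if insub E is Some H then models (H : hypergraph d n) phi else false)) a e1 e1_gt0 e1_lt1.
- by exists (maxn 1 n0) => n /large h; apply: le_trans h _; lra.
- exists (maxn (maxn 1 n0) n1) => n; rewrite geq_max => /andP[/large h1 /poor h2].
  rewrite subr0 ger0_norm in h2; last by apply: prob_ge0; apply: edge_pr01.
  apply: le_trans (@prob_by_shape R d p p01 N n K _ (fun E => ~~ rich q L T E) a _) _;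
    last first.
    by apply: le_trans (lerD h1 h2) _; lra.
  move=> E c Y0 f uE; rewrite negbK inE => richE /andP[/injectiveP injf /eqP coreE].
  case: insubP => [H _ defH|/negP nE]; last by case: nE.
  rewrite -defH in richE coreE; apply/idP/asboolP => [mH|]; first by exists n, H, f.
  case=> n' [H' [f' [injf' richH' coreH' mH']]].
  by rewrite (models_core (leqnn q) hT richE richH' injf injf' coreE coreH').
by exists b, n2 => n /hb h; apply: le_trans h e1_e.
Qed.

End Convergence.

Local Open Scope classical_set_scope.

Theorem theorem4p7 (R : realType) (d : nat) (hd : (1 <= d)%N)
    (lambda : R) (hlambda : 0 < lambda)
    (p : nat -> R) (hp01 : forall n : nat, 0 <= p n <= 1)
    (hp : asymp_equiv p (fun n : nat => lambda / n%:R ^+ d)) :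
  convergence_law d p.
Proof. exact: sparse_convergence hd hlambda hp01 hp. Qed.
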